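(* Let $\alpha\in\mathbb{C}$ be nonzero, let $n\geq 3$, and let $\phi:M_n\to M_n$ be a map (not assumed linear or additive) whose range contains $\sqrt{(2\alpha)^{-1}}\,\mathcal{I}_n^{\pm}$. Suppose that $$\alpha(AB+BA)\in\mathcal{I}_n\quad\Longleftrightarrow\quad\alpha(\phi(A)\phi(B)+\phi(B)\phi(A))\in\mathcal{I}_n$$ for every $A,B\in M_n$. Then there exist a field automorphism $\sigma$ of $\mathbb{C}$, a non-singular matrix $T\in M_n$ and a scalar $c_\alpha\in\mathbb{C}$ with $c_\alpha^2=\sigma(\alpha)/\alpha$ such that $$\phi([x_{ij}])=c_\alpha T[\sigma(x_{ij})]^{\diamond}T^{-1}\qquad\text{for every }[x_{ij}]\in M_n,$$ where $\diamond$ denotes one of the following maps on $M_n$ (the same one for all matrices): the identity or the transposition.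
   Context: $M_n$ is the algebra of $n\times n$ complex matrices. $\mathcal{I}_n\subseteq M_n$ is the set of all idempotent matrices ($P^2=P$, including $0$). A matrix $P$ is anti-idempotent if $P^2=-P$ and $P\ne0$. $\mathcal{I}_n^{\pm}\subseteq M_n$ is the union of the set of rank-one idempotent matrices and the set of rank-one anti-idempotent matrices. For a scalar $\beta$, $\beta\,\mathcal{I}_n^{\pm}=\{\beta P:P\in\mathcal{I}_n^{\pm}\}$; since $\mathcal{I}_n^{\pm}$ is closed under $P\mapsto-P$, the choice of the square root is irrelevant. The field automorphism $\sigma$ need not be continuous. *)

(* Defs.v *)
From mathcomp Require Import all_boot all_order all_algebra.
From mathcomp Require Import reals complex.

Set Implicit Arguments.
Unset Strict Implicit.
Unset Printing Implicit Defensive.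

Import Order.TTheory GRing.Theory Num.Theory.
Local Open Scope ring_scope.

Definition idempotent_mx (F : fieldType) (n : nat) (P : 'M[F]_n) : Prop :=
  P *m P = P.

Definition antiidempotent_mx (F : fieldType) (n : nat) (P : 'M[F]_n) : Prop :=
  P *m P = - P /\ P <> 0.

Definition rank1_pm_idempotent_mx (F : fieldType) (n : nat) (P : 'M[F]_n)
    : Prop :=
  (\rank P = 1%N /\ idempotent_mx P) \/
  (\rank P = 1%N /\ antiidempotent_mx P).

(* Main.v *)
(* After rescaling by t with t^2 = (2 alpha)^-1, psi(X) = t^-1 phi(t X) preserves
   in both directions the relation "(XY + YX)/2 is idempotent", and every signed
   rank-one idempotent has a preimage th(+-uf).  The matrices anticommuting with
   X can be recovered from this relation, and they almost determine X when
   X^4 = X^2; hence A = th(uf) and th(-uf) have the same square, opposite cubes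
   and proportional nilpotent parts.  An eigenvector of A for an eigenvalue +-1
   remains one when f varies with u fixed, or when u varies with f fixed.
   Incidence arguments show that, up to transposition and sign, the first
   alternative always holds for columns and the second for rows, and that the
   nilpotent parts vanish.  So th(+-uf) = +-vg, where the lines of u and v, and
   of f and g, correspond and incidence is preserved: this is the situation of
   the fundamental theorem of projective geometry, and composing psi with the
   resulting semilinear conjugation we may assume that psi fixes all signed
   rank-one idempotents.  Testing X against larger and larger classes of fixed
   matrices (tripotents, square-zero rank-one matrices, multiples of rank-one
   idempotents, Jordan blocks of size 2) then shows that X and psi(X) agree on
   every generalized eigenvector of X. *)

Require Import Defs.
From HB Require Import structures.
From mathcomp Require Import all_boot all_order all_algebra.
From mathcomp Require Import reals complex.
From mathcomp Require Import boolp ring zify.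

Set Implicit Arguments.
Unset Strict Implicit.
Unset Printing Implicit Defensive.

Import Order.TTheory GRing.Theory Num.Theory.
Local Open Scope ring_scope.

(** Nothing is known about [phi] beyond the relation, not even injectivity, so the work is to
    extract linear information from an idempotency condition. If two distinct nonzero multiples of a
    Jordan product M are both idempotent, then M = 0; testing against multiples of Y therefore
    detects anticommutation with Y, a linear condition. Alternatives that hold pointwise become
    uniform because a vector space over an infinite field is not a finite union of proper subspaces.
    The condition X^4 = X^2 is the relation of X with itself, which preimages inherit from P. The
    main obstacle is that the relation alone leaves room for a nilpotent part in the preimages and
    for a mixture of row and column behaviour; both are excluded only by incidence arguments, where
    n at least 3 supplies a nonzero vector killed by two functionals. Negation and the
    transpositions of argument and value are symmetries of the problem and are used to halve most
    case distinctions. *)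

(** * Pairings of rows and columns, and avoidance of finitely many subspaces *)

Section Basics.
Variables (K : numClosedFieldType) (n : nat).
Implicit Types (X Y Z A B C D : 'M[K]_n) (u v w x y : 'cV[K]_n) (f g h k : 'rV[K]_n).

Lemma mxDE m p (A B : 'M[K]_(m, p)) i j : (A + B) i j = A i j + B i j.
Proof. by rewrite mxE. Qed.
Lemma mxNE m p (A : 'M[K]_(m, p)) i j : (- A) i j = - A i j.
Proof. by rewrite mxE. Qed.
Lemma mxZE m p c (A : 'M[K]_(m, p)) i j : (c *: A) i j = c * A i j.
Proof. by rewrite mxE. Qed.
Lemma mx0E m p i j : (0 : 'M[K]_(m, p)) i j = 0.
Proof. by rewrite mxE. Qed.
Lemma mxMnE m p (A : 'M[K]_(m, p)) (k : nat) i j : (A *+ k) i j = A i j *+ k.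
Proof. by elim: k => [|k IH]; rewrite ?mulr0n ?mx0E // !mulrS mxDE IH. Qed.

Definition dt g v : K := (g *m v) 0 0.

Lemma dtE g v : g *m v = (dt g v)%:M.
Proof. by rewrite [LHS]mx11_scalar. Qed.
Lemma dtDl g h v : dt (g + h) v = dt g v + dt h v.
Proof. by rewrite /dt mulmxDl mxE. Qed.
Lemma dtDr g v w : dt g (v + w) = dt g v + dt g w.
Proof. by rewrite /dt mulmxDr mxE. Qed.
Lemma dtZl c g v : dt (c *: g) v = c * dt g v.
Proof. by rewrite /dt -scalemxAl mxE. Qed.
Lemma dtZr c g v : dt g (c *: v) = c * dt g v.
Proof. by rewrite /dt -scalemxAr mxE. Qed.
Lemma dtNl g v : dt (- g) v = - dt g v.
Proof. by rewrite /dt mulNmx mxE. Qed.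
Lemma dtNr g v : dt g (- v) = - dt g v.
Proof. by rewrite /dt mulmxN mxE. Qed.
Lemma dt0l v : dt 0 v = 0.
Proof. by rewrite /dt mul0mx mxE. Qed.
Lemma dt0r g : dt g 0 = 0.
Proof. by rewrite /dt mulmx0 mxE. Qed.
Lemma dtA g A v : dt (g *m A) v = dt g (A *m v).
Proof. by rewrite /dt mulmxA. Qed.
Lemma dtT g v : dt v^T g^T = dt g v.
Proof. by rewrite /dt -trmx_mul mxE. Qed.

Definition dtL := (dtDl, dtDr, dtZl, dtZr, dtNl, dtNr, dt0l, dt0r).

Lemma outv v g w : v *m g *m w = dt g w *: v.
Proof. by rewrite -mulmxA dtE mul_mx_scalar. Qed.
Lemma outg h v g : h *m (v *m g) = dt h v *: g.
Proof. by rewrite mulmxA dtE mul_scalar_mx. Qed.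
Lemma outo p (v : 'M_(p, 1)) q g w (h : 'M_(1, q)) : (v *m g) *m (w *m h) = dt g w *: (v *m h).
Proof. by rewrite mulmxA -(mulmxA v) dtE mul_mx_scalar -scalemxAl. Qed.

Lemma ex_dual v : v != 0 -> exists g, dt g v = 1.
Proof.
move=> v0; have [i vi] : exists i, v i 0 != 0.
  apply/existsP; move: v0; apply: contraNT; rewrite negb_exists => /forallP H.
  by apply/eqP/colP => i; rewrite mxE; apply/eqP; move: (H i); rewrite negbK.
exists ((v i 0)^-1 *: delta_mx 0 i).
by rewrite dtZl /dt -rowE mxE mulVf.
Qed.

Lemma ex_dualr g : g != 0 -> exists v, dt g v = 1.
Proof.
move=> g0; have [|h hE] := @ex_dual g^T.
  by apply: contra g0 => /eqP/(congr1 trmx); rewrite trmxK trmx0 => ->.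
by exists h^T; rewrite -dtT trmxK.
Qed.

Lemma ex_dual2 v w a b : v != 0 -> ~ (exists c, w = c *: v) ->
  exists g, dt g v = a /\ dt g w = b.
Proof.
move=> v0 ind; have [g0 g0v] := ex_dual v0.
have w'0 : w - dt g0 w *: v != 0.
  by apply/eqP => /eqP; rewrite subr_eq0 => /eqP e; apply: ind; exists (dt g0 w).
have [g1 g1w] := ex_dual w'0.
have [g2 g2v g2w] : exists2 g2, dt g2 v = 0 & dt g2 w = 1.
  exists (g1 - dt g1 v *: g0); first by rewrite !dtL g0v; ring.
  by rewrite !dtL -g1w !dtL; ring.
exists (a *: g0 + (b - a * dt g0 w) *: g2).
by rewrite !dtL g0v g2v g2w; split; ring.
Qed.

Lemma ex_dual2r g h a b : g != 0 -> ~ (exists c, h = c *: g) ->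
  exists v, dt g v = a /\ dt h v = b.
Proof.
move=> g0 ind; have [||k [kg kh]] := @ex_dual2 g^T h^T a b.
- by apply: contra g0 => /eqP/(congr1 trmx); rewrite trmxK trmx0 => ->.
- by case=> c /(congr1 trmx); rewrite linearZ /= !trmxK => e; apply: ind; exists c.
by exists k^T; rewrite -[dt g _]dtT -[dt h _]dtT trmxK.
Qed.

Lemma col_eq0 v : (forall g, dt g v = 0) -> v = 0.
Proof.
move=> H; apply/eqP; apply: contraT => /ex_dual[g]; rewrite H => /esym/eqP.
by rewrite oner_eq0.
Qed.
Lemma mx_eqv m (A B : 'M[K]_(m, n)) : (forall v, A *m v = B *m v) -> A = B.
Proof.
by move=> H; apply/row_matrixP => i; apply/rowP => j; have := H (delta_mx j 0);
   rewrite -!colE => /colP/(_ i); rewrite !mxE.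
Qed.
Lemma mx_eqg m (A B : 'M[K]_(n, m)) : (forall g, g *m A = g *m B) -> A = B.
Proof. by move=> H; apply/row_matrixP => i; rewrite !rowE. Qed.

(** One plus the sum of the norms exceeds the norm of every member of [s]. This is the only source
    of infinitely many scalars. *)
Lemma natP (s : seq K) : exists t : K, t != 0 /\ t \notin s.
Proof.
pose N : K := \sum_(b <- s) `|b| + 1; have N0 : 0 < N.
  by rewrite ltr_wpDl ?ltr01 // sumr_ge0.
exists N; split; first by rewrite gt_eqF.
apply/negP => Ns; have : `|N| <= \sum_(b <- s) `|b|.
  by rewrite (big_rem N) //= lerDl sumr_ge0.
by rewrite gtr0_norm // /N gerDl ler10.
Qed.

Lemma good_scalar (s : seq (K -> Prop)) :
  (forall Q, List.In Q s -> forall t t', Q t -> Q t' -> t = t') ->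
  exists t : K, t != 0 /\ forall Q, List.In Q s -> ~ Q t.
Proof.
move=> H; suff [b Hb] : exists b : seq K, forall Q, List.In Q s -> forall t, Q t -> t \in b.
  have [t [t0 tb]] := natP b; exists t; split=> // Q Qs Qt.
  by move: tb; rewrite (Hb _ Qs).
elim: s H => [|Q s IH] H; first by exists [::].
have [b Hb] := IH (fun R Rs => H R (or_intror Rs)).
have [[t Qt]|nQ] := EM (exists t, Q t).
  exists (t :: b) => R [<-|Rs] t' Rt'; rewrite inE.
    by rewrite (H Q (or_introl erefl) t' t) ?eqxx.
  by rewrite (Hb _ Rs) ?orbT.
exists b => R [<-|Rs] t' Rt'; last exact: (Hb _ Rs).
by case: nQ; exists t'.
Qed.

End Basics.

Section Avoid.
Variables (K : numClosedFieldType) (V : lmodType K).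

Definition lin_closed (Q : V -> Prop) :=
  forall a b x y, Q x -> Q y -> Q (a *: x + b *: y).

(** A subspace over an infinite field is not a finite union of proper subspaces. Take [x0] outside
    all members of [s] and [x1] outside [Q]: on the line x0 + t x1 each member of [s] holds for at
    most one t, since two values would force it at [x0]. *)
Lemma avoid (P : V -> Prop) (s : seq (V -> Prop)) : lin_closed P -> (exists x, P x) ->
  (forall Q, List.In Q s -> lin_closed Q /\ exists2 x, P x & ~ Q x) ->
  exists2 x, P x & forall Q, List.In Q s -> ~ Q x.
Proof.
move=> lP P0; elim: s => [|Q s IH] H; first by case: P0 => x Px; exists x.
have [x0 Px0 H0] := IH (fun R Rs => H R (or_intror Rs)).
have [lQ [x1 Px1 nQx1]] := H Q (or_introl erefl).
have [Qx0|nQx0] := EM (Q x0); last first.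
  by exists x0 => // R [<-|Rs] //; apply: H0.
pose s' := [seq (fun t : K => R (x0 + t *: x1)) | R <- s].
have [|t [t0 Ht]] := @good_scalar K s'.
  move=> R /List.in_map_iff[R' [<- R's]] t t' Rt Rt'.
  have [lR _] := H R' (or_intror R's).
  apply: contrapT => ntt'; apply: (H0 _ R's).
  have tt' : t' - t != 0 by rewrite subr_eq0; apply/eqP => e; apply: ntt'.
  have := lR (t' / (t' - t)) (- t / (t' - t)) _ _ Rt Rt'.
  rewrite !scalerDr !scalerA addrACA -scalerDl -scalerDl.
  have -> : t' / (t' - t) + - t / (t' - t) = 1 by field.
  have -> : t' / (t' - t) * t + - t / (t' - t) * t' = 0 by field.
  by rewrite scale1r scale0r addr0.
exists (x0 + t *: x1); first by have := lP 1 t _ _ Px0 Px1; rewrite scale1r.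
move=> R [<-|Rs].
  move=> Qx; apply: nQx1; have := lQ (t^-1) (- t^-1) _ _ Qx Qx0.
  by rewrite scalerDr scalerA mulVf // scale1r scaleNr addrAC subrr add0r.
apply: (Ht (fun t => R (x0 + t *: x1))); apply/List.in_map_iff; by exists R.
Qed.

End Avoid.

Ltac mxl := let i := fresh "i" in let j := fresh "j" in
  apply/matrixP => i j; rewrite ?(mxDE, mxNE, mxZE, mx0E, mxMnE).

(** Certificate form of linear arithmetic: the goal is a stated multiple [k] of a known equation,
    which [ring] or [field] then checks. *)
Lemma lcomb (R : comRingType) (k c d a b : R) : c = d -> a - b = k * (c - d) -> a = b.
Proof. by move=> ->; rewrite subrr mulr0 => /eqP; rewrite subr_eq0 => /eqP. Qed.

Lemma lcombm (R : ringType) (V : lmodType R) (k : R) (c d a b : V) :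
  c = d -> a - b = k *: (c - d) -> a = b.
Proof. by move=> ->; rewrite subrr scaler0 => /eqP; rewrite subr_eq0 => /eqP. Qed.

(** * The idempotency test for the Jordan product *)

Section Jo.
Variables (K : numClosedFieldType) (n : nat).
Implicit Types (X Y Z A B C D : 'M[K]_n) (u v w x y : 'cV[K]_n) (f g h k : 'rV[K]_n).

Lemma out0 v g : v *m g = 0 -> v = 0 \/ g = 0.
Proof.
have [->|v0] := eqVneq v 0; first by left.
move=> vg0; right; have [h hv] := ex_dual v0.
by have := outg h v g; rewrite vg0 mulmx0 hv scale1r.
Qed.

Lemma two0 : (2 : K) != 0.
Proof. by rewrite pnatr_eq0. Qed.

(** The factor 1/2 makes the product of X with itself X^2, so a signed rank-one idempotent is
    [jo]-related to itself. *)
Definition jp X Y : 'M[K]_n := 2^-1 *: (X *m Y + Y *m X).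
Definition jo X Y := idempotent_mx (jp X Y).
Definition perp X Y := X *m Y + Y *m X = 0.

Lemma jpC X Y : jp X Y = jp Y X.
Proof. by rewrite /jp addrC. Qed.
Lemma joC X Y : jo X Y <-> jo Y X.
Proof. by rewrite /jo jpC. Qed.
Lemma perpC X Y : perp X Y <-> perp Y X.
Proof. by rewrite /perp addrC. Qed.
Lemma jpDl X Y Z : jp (X + Y) Z = jp X Z + jp Y Z.
Proof. by rewrite /jp mulmxDl mulmxDr -scalerDr addrACA. Qed.
Lemma jpZl c X Y : jp (c *: X) Y = c *: jp X Y.
Proof. by rewrite /jp -scalemxAl -scalemxAr -scalerDr !scalerA mulrC. Qed.
Lemma jpDr X Y Z : jp Z (X + Y) = jp Z X + jp Z Y.
Proof. by rewrite ![jp Z _]jpC jpDl. Qed.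
Lemma jpZr c X Y : jp X (c *: Y) = c *: jp X Y.
Proof. by rewrite ![jp X _]jpC jpZl. Qed.
Lemma jpNr X Y : jp X (- Y) = - jp X Y.
Proof. by rewrite -scaleN1r jpZr scaleN1r. Qed.
Lemma jpNl X Y : jp (- X) Y = - jp X Y.
Proof. by rewrite -scaleN1r jpZl scaleN1r. Qed.
Lemma jo_scale c X Y : jo (c *: X) Y <-> jo X (c *: Y).
Proof. by rewrite /jo jpZl jpZr. Qed.
Lemma perp_jp X Y : perp X Y <-> jp X Y = 0.
Proof.
rewrite /perp /jp; split=> [->|]; first by rewrite scaler0.
by move/eqP; rewrite scaler_eq0 invr_eq0 (negPf two0) => /eqP.
Qed.
Lemma perp_jo X Y : perp X Y -> jo X Y.
Proof. by move/perp_jp => e; rewrite /jo e /idempotent_mx mul0mx. Qed.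
Lemma perpZr c X Y : perp X Y -> perp X (c *: Y).
Proof. by move/perp_jp => e; apply/perp_jp; rewrite jpZr e scaler0. Qed.
Lemma perp_lin X : lin_closed (perp X).
Proof.
move=> a b Y Z /perp_jp eY /perp_jp eZ; apply/perp_jp.
by rewrite jpDr !jpZr eY eZ !scaler0 addr0.
Qed.

Lemma idemZ a (M : 'M[K]_n) : a != 0 -> idempotent_mx (a *: M) -> a *: (M *m M) = M.
Proof.
rewrite /idempotent_mx -scalemxAl -scalemxAr !scalerA => a0 H.
by apply: (scalerI a0); rewrite scalerA.
Qed.

(** With M the Jordan product, a M^2 = M = b M^2 forces M^2 = 0 and then M = 0. This is the passage
    from the quadratic relation [jo] to the linear relation [perp]. *)
Lemma jo_perp2 X Y a b : a != 0 -> b != 0 -> a != b ->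
  jo X (a *: Y) -> jo X (b *: Y) -> perp X Y.
Proof.
rewrite /jo !jpZr => a0 b0 ab /(idemZ a0) Ea /(idemZ b0) Eb.
apply/perp_jp; move: (jp X Y) Ea Eb => M Ea Eb.
have : (a - b) *: (M *m M) = 0 by rewrite scalerBl Ea Eb subrr.
move/eqP; rewrite scaler_eq0 subr_eq0 (negPf ab) /= => /eqP e.
by rewrite -Ea e scaler0.
Qed.

Lemma jo_perpN X Y : jo X Y -> jo X (- Y) -> perp X Y.
Proof.
move=> H1 H2; apply: (@jo_perp2 _ _ 1 (-1)); rewrite ?oner_eq0 ?oppr_eq0 ?oner_eq0 //.
- by rewrite -subr_eq0 opprK -[1 + 1]/(2%:R) two0.
- by rewrite scale1r.
by rewrite scaleN1r.
Qed.

Lemma perp_joZ X Y c : perp X Y -> jo X (c *: Y).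
Proof. by move=> /(perpZr c)/perp_jo. Qed.

Lemma perpNr X Y : perp X (- Y) <-> perp X Y.
Proof.
by split=> /(perpZr (-1)); rewrite ?scaleN1r ?opprK //.
Qed.

Lemma jp_out Z v g : jp Z (v *m g) = 2^-1 *: (Z *m v *m g + v *m (g *m Z)).
Proof. by rewrite /jp !mulmxA. Qed.

(** Put y = Zv, l = gZ and s = gZv. Multiplying the idempotency identity by v and by g shows that s
    different from 1 forces y = s v and l = s g, and then s = 0; for s = 1 the identity factors as
    (y - v)(l - g) = 0. *)
Lemma jo_out1 Z v g : dt g v = 1 ->
  jo Z (v *m g) <-> Z *m v = v \/ g *m Z = g \/ (Z *m v = 0 /\ g *m Z = 0).
Proof.
move=> gv; rewrite /jo /idempotent_mx jp_out.
set y := Z *m v; set l := g *m Z.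
have lv : dt l v = dt g y by rewrite dtA.
set s := dt g y in lv *; set q := dt l y.
have two := two0.
have -> : ((2^-1 *: (y *m g + v *m l)) *m (2^-1 *: (y *m g + v *m l)) = 2^-1 *: (y *m g + v *m l))
   <-> (s *: (y *m g) + y *m l + q *: (v *m g) + s *: (v *m l) = 2 *: (y *m g + v *m l)).
  rewrite -scalemxAl -scalemxAr mulmxDl !mulmxDr !outo gv lv -/s -/q scale1r !scalerA.
  split=> [/eqP|/eqP].
    rewrite -subr_eq0 => /eqP/(congr1 (fun M => 4 *: M)); rewrite scaler0 => e.
    by apply/eqP; rewrite -subr_eq0 -e; apply/eqP; mxl; field.
  rewrite -subr_eq0 => /eqP e; apply/eqP; rewrite -subr_eq0; apply/eqP.
  by rewrite -[RHS](scaler0 _ (4^-1)) -e; mxl; field.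
split=> [E|].
  have R := congr1 (mulmx^~ v) E; have L := congr1 (mulmx g) E.
  rewrite /= !mulmxDl -!scalemxAl !mulmxDl !outv gv lv !scale1r in R.
  rewrite /= !mulmxDr -!scalemxAr !mulmxDr !outg gv -/s !scale1r in L.
  have Rs := congr1 (fun z => dt g z) R; rewrite /= !dtL gv -/s in Rs.
  have qE : q = 4 * s - 3 * s ^+ 2 by apply: (lcomb (k := 1) Rs); ring.
  have [s1|s1] := eqVneq s 1; last first.
    have s10 : 2 * (s - 1) != 0 by rewrite mulf_neq0 ?two0 ?subr_eq0.
    have yE : y = s *: v.
      by apply: (scalerI s10); apply: (lcombm (k := 1) R); rewrite qE; mxl; ring.
    have lE : l = s *: g.
      by apply: (scalerI s10); apply: (lcombm (k := 1) L); rewrite qE; mxl; ring.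
    have q2 : q = s ^+ 2 by rewrite /q yE lE !dtL gv; ring.
    have : (s * (s - 1)) * 4 = 0 by move: q2; rewrite qE => e; apply: (lcomb (k := -1) e); ring.
    move/eqP; rewrite !mulf_eq0 subr_eq0 (negPf s1) pnatr_eq0 !orbF => /eqP s0.
    by right; right; rewrite yE lE s0 !scale0r.
  have q1 : q = 1 by rewrite qE s1; ring.
  have : (y - v) *m (l - g) = 0.
    move: E => /eqP; rewrite -subr_eq0 => /eqP <-; rewrite q1 s1 mulmxBl !mulmxBr.
    by mxl; ring.
  by case/out0 => /eqP; rewrite subr_eq0 => /eqP ->; [left|right; left].
case=> [yv|[lg|[y0 l0]]].
- have s1 : s = 1 by rewrite /s yv.
  have q1 : q = 1 by rewrite /q yv lv.
  by rewrite s1 q1 yv; mxl; ring.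
- have s1 : s = 1 by rewrite -lv lg.
  have q1 : q = 1 by rewrite /q lg -/s.
  by rewrite s1 q1 lg; mxl; ring.
by rewrite /q y0 l0 !mul0mx !mulmx0 dt0l scale0r !scaler0 ?scale0r !addr0 ?scaler0.
Qed.

Lemma jo_outc Z v g c : c != 0 -> dt g v = 1 ->
  jo Z (c *: (v *m g)) <->
  c *: (Z *m v) = v \/ c *: (g *m Z) = g \/ (Z *m v = 0 /\ g *m Z = 0).
Proof.
move=> c0 gv; rewrite -jo_scale jo_out1 // -scalemxAl -scalemxAr.
split; (case=> [->|[->|[H1 H2]]]; [by left|by right; left|right; right; split]).
- by apply: (scalerI c0); rewrite H1 scaler0.
- by apply: (scalerI c0); rewrite H2 scaler0.
- by rewrite H1 scaler0.
by rewrite H2 scaler0.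
Qed.

(** Here the identity collapses to (s - 2)(y g + v l) + q v g = 0 with s = gZv and q = gZZv. Either
    s = 2 and then q = 0, or v and g are eigenvectors with opposite eigenvalues. The value 2 is what
    later calibrates scalars. *)
Lemma jo_nil Z v g : dt g v = 0 -> v != 0 -> g != 0 ->
  jo Z (v *m g) <-> (exists c, Z *m v = c *: v /\ g *m Z = - c *: g) \/
     (dt g (Z *m v) = 2 /\ dt g (Z *m (Z *m v)) = 0).
Proof.
move=> gv v0 g0; rewrite /jo /idempotent_mx jp_out.
set y := Z *m v; set l := g *m Z.
have lv : dt l v = dt g y by rewrite dtA.
have qE : dt g (Z *m y) = dt l y by rewrite dtA.
rewrite qE; set s := dt g y in lv *; set q := dt l y.
have two := two0.
have -> : ((2^-1 *: (y *m g + v *m l)) *m (2^-1 *: (y *m g + v *m l)) = 2^-1 *: (y *m g + v *m l))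
   <-> ((s - 2) *: (y *m g + v *m l) + q *: (v *m g) = 0).
  rewrite -scalemxAl -scalemxAr mulmxDl !mulmxDr !outo gv lv -/s -/q scale0r addr0 !scalerA.
  split=> [/eqP|/eqP].
    rewrite -subr_eq0 => /eqP/(congr1 (fun M => 4 *: M)); rewrite scaler0 => <-.
    by mxl; field.
  move=> /eqP e; apply/eqP; rewrite -subr_eq0; apply/eqP.
  by rewrite -[RHS](scaler0 _ (4^-1)) -e; mxl; field.
split=> [E|].
  have [s2|s2] := eqVneq s 2.
    right; split=> //; move: E; rewrite s2 subrr scale0r add0r => /eqP.
    rewrite scaler_eq0 => /orP[/eqP //|/eqP/out0[/eqP|/eqP]].
      by rewrite (negPf v0).
    by rewrite (negPf g0).
  left; have s20 : s - 2 != 0 by rewrite subr_eq0.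
  have [h hg] := ex_dualr g0; pose c' := - (q / (s - 2) + dt l h).
  have yE : y = c' *: v.
    have := congr1 (mulmx^~ h) E; rewrite /= mul0mx !mulmxDl -!scalemxAl !mulmxDl !outv hg !scale1r.
    move=> /eqP e; apply/eqP; rewrite -subr_eq0 /c' -[X in _ == X](scaler0 _ (s - 2)^-1) -(eqP e).
    by apply/eqP; mxl; field.
  have s0 : s = 0 by rewrite /s yE dtL gv mulr0.
  have q0 : q = 0 by rewrite /q yE dtL lv s0 mulr0.
  exists c'; split=> //.
  have [k kv] := ex_dual v0.
  have := congr1 (mulmx k) E; rewrite /= mulmx0 q0 yE s0 scale0r addr0 -scalemxAr mulmxDr !outg kv.
  rewrite dtZr kv scale1r mulr1 => /eqP; rewrite scaler_eq0 sub0r oppr_eq0 (negPf two0) /=.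
  by move=> /eqP e; apply: (lcombm (k := 1) e); mxl; ring.
case=> [[c [yE lE]]|[-> ->]]; last by rewrite subrr scale0r scale0r addr0.
have s0 : s = 0 by rewrite /s yE dtL gv mulr0.
have q0 : q = 0 by rewrite /q yE dtL lv s0 mulr0.
by rewrite q0 yE lE; mxl; rewrite -scalemxAl -scalemxAr !mxE; ring.
Qed.

End Jo.

(** * Matrices with a common anticommutant *)

Section Perp.
Variables (K : numClosedFieldType) (n : nat).
Implicit Types (X Y Z A B C D : 'M[K]_n) (u v w x y : 'cV[K]_n) (f g h k : 'rV[K]_n).

Lemma mx_neq0v A : A != 0 -> exists v, A *m v != 0.
Proof.
move=> A0; apply: contrapT => H; move/eqP: A0; apply; apply: mx_eqv => v.
by rewrite mul0mx; apply/eqP; apply: contraT => H'; case: H; exists v.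
Qed.
Lemma mx_neq0g A : A != 0 -> exists g, g *m A != 0.
Proof.
move=> A0; apply: contrapT => H; move/eqP: A0; apply; apply: mx_eqg => v.
by rewrite mulmx0; apply/eqP; apply: contraT => H'; case: H; exists v.
Qed.

(** Primeness of the matrix algebra, tested on rank-one X. *)
Lemma sand0 B C : (forall X, B *m X *m C = 0) -> B = 0 \/ C = 0.
Proof.
move=> H; have [|/mx_neq0v[v Bv]] := eqVneq B 0; first by left.
right; apply: mx_eqg => g; rewrite mulmx0.
have := H (v *m g); rewrite mulmxA -mulmxA => /out0[/eqP|//].
by rewrite (negPf Bv).
Qed.

Lemma sandeq B C B' C' : B' != 0 -> C != 0 ->
  (forall X, B *m X *m C = B' *m X *m C') -> exists c, B = c *: B' /\ C' = c *: C.
Proof.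
move=> B'0 /mx_neq0g[g /ex_dualr[w gCw]] H.
have BE : B = dt (g *m C') w *: B'.
  have P Z1 Z2 v : (Z1 *m (v *m g) *m Z2) *m w = dt (g *m Z2) w *: (Z1 *m v).
    by rewrite -!mulmxA (mulmxA g) dtE mul_mx_scalar -scalemxAr.
  apply: mx_eqv => v; have := congr1 (mulmx^~ w) (H (v *m g)).
  by rewrite /= !P gCw scale1r -scalemxAl.
exists (dt (g *m C') w); split=> //.
have := @sand0 B' (C' - dt (g *m C') w *: C); case.
- by move=> X; rewrite mulmxBr -H {1}BE -!scalemxAl -scalemxAr subrr.
- by move/eqP; rewrite (negPf B'0).
by move/eqP; rewrite subr_eq0 => /eqP.
Qed.

Lemma jpAA A : jp A A = A *m A.
Proof. by rewrite /jp -mulr2n -scaler_nat scalerA mulVf ?scale1r // two0. Qed.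

(* Spectral data of [A] with [A^4 = A^2]: the projection [A^2], the involutive
   part [A^3] and the square-zero part [A - A^3]. *)
Definition cub A := A *m A *m A.
Definition nilpart A := A - cub A.

Lemma jo_S A : jo A A <-> A *m A *m A *m A = A *m A.
Proof. by rewrite /jo jpAA /idempotent_mx mulmxA. Qed.

Section S.
Variable A : 'M[K]_n.
Hypothesis hA : jo A A.
Let E := A *m A.
Let A1 := cub A.
Let N := nilpart A.

Lemma S_EE : E *m E = E.
Proof. by move/jo_S: hA; rewrite /E mulmxA. Qed.
Lemma S_AE : A *m E = A1.
Proof. by rewrite /E /A1 /cub mulmxA. Qed.
Lemma S_EA : E *m A = A1. Proof. by []. Qed.
Lemma S_AA1 : A *m A1 = E.
Proof. by rewrite -S_AE mulmxA -/E S_EE. Qed.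
Lemma S_A1A : A1 *m A = E.
Proof. by rewrite -S_EA -mulmxA -/E S_EE. Qed.
Lemma S_EA1 : E *m A1 = A1.
Proof. by rewrite -S_EA mulmxA S_EE. Qed.
Lemma S_A1E : A1 *m E = A1.
Proof. by rewrite -S_AE -mulmxA S_EE. Qed.
Lemma S_A1A1 : A1 *m A1 = E.
Proof. by rewrite -{1}S_AE -mulmxA S_EA1 S_AA1. Qed.
Lemma S_EN : E *m N = 0.
Proof. by rewrite /N /nilpart mulmxBr S_EA S_EA1 subrr. Qed.
Lemma S_NE : N *m E = 0.
Proof. by rewrite /N /nilpart mulmxBl S_AE S_A1E subrr. Qed.
Lemma S_AN : A *m N = 0.
Proof. by rewrite /N /nilpart mulmxBr S_AA1 subrr. Qed.
Lemma S_NA : N *m A = 0.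
Proof. by rewrite /N /nilpart mulmxBl S_A1A subrr. Qed.
Lemma S_A1N : A1 *m N = 0.
Proof. by rewrite -S_EA -mulmxA S_AN mulmx0. Qed.
Lemma S_NA1 : N *m A1 = 0.
Proof. by rewrite -S_AE mulmxA S_NA mul0mx. Qed.
Lemma S_NN : N *m N = 0.
Proof. by rewrite {1}/N /nilpart mulmxBl S_AN S_A1N subrr. Qed.
Lemma S_AB : A *m (1%:M - E) = N.
Proof. by rewrite mulmxBr mulmx1 S_AE. Qed.
Lemma S_BA : (1%:M - E) *m A = N.
Proof. by rewrite mulmxBl mul1mx S_EA. Qed.
Lemma S_NB : N *m (1%:M - E) = N.
Proof. by rewrite mulmxBr mulmx1 S_NE subr0. Qed.
Lemma S_BN : (1%:M - E) *m N = N.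
Proof. by rewrite mulmxBl mul1mx S_EN subr0. Qed.
Lemma S_E0 : A1 = 0 -> E = 0.
Proof. by move=> e; rewrite -S_A1A1 e mul0mx. Qed.

(** Compression to the complement of the projection A^2, where A acts as its nilpotent part. *)
Definition corner X := (1%:M - E) *m X *m (1%:M - E).

Lemma perp_N : perp A N.
Proof. by rewrite /perp S_AN S_NA addr0. Qed.

Lemma S_Acorner X : A *m corner X = N *m corner X.
Proof. by rewrite /corner !mulmxA S_AB S_NB. Qed.
Lemma S_cornerA X : corner X *m A = corner X *m N.
Proof. by rewrite /corner -!mulmxA S_BA S_BN. Qed.

(** On the corner A acts as N, and N A = A N = 0, so the two products are NkN and -NkN for k =
    [corner X]. These commutators supply anticommuting test matrices when N is nonzero. *)
Lemma perp_DX X : perp A (corner X *m N - N *m corner X).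
Proof.
rewrite /perp; move: (corner X) (S_Acorner X) (S_cornerA X) => c e1 e2.
rewrite (mulmxBr A) (mulmxBl _ _ A) !mulmxA S_AN e1 -!(mulmxA _ _ A) S_NA e2.
by rewrite mulmx0 mul0mx subr0 sub0r mulmxA subrr.
Qed.

Lemma perp_corner X : N = 0 -> perp A (corner X).
Proof. by move=> N0; rewrite /perp S_Acorner S_cornerA N0 mulmx0 mul0mx addr0. Qed.

(** [ep] and [em] are the spectral projections of A for the eigenvalues 1 and -1; the blocks between
    them anticommute with A. *)
Definition ep := 2^-1 *: (E + A1).
Definition em := 2^-1 *: (E - A1).
Lemma Aep : A *m ep = ep.
Proof. by rewrite /ep -scalemxAr mulmxDr S_AE S_AA1 addrC. Qed.
Lemma epA : ep *m A = ep.
Proof. by rewrite /ep -scalemxAl mulmxDl S_EA S_A1A addrC. Qed.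
Lemma Aem : A *m em = - em.
Proof. by rewrite /em -scalemxAr mulmxBr S_AE S_AA1 -scalerN opprB. Qed.
Lemma emA : em *m A = - em.
Proof. by rewrite /em -scalemxAl mulmxBl S_EA S_A1A -scalerN opprB. Qed.
Lemma Eep : E *m ep = ep.
Proof. by rewrite /E -(mulmxA A) !Aep. Qed.
Lemma A1ep : A1 *m ep = ep.
Proof. by rewrite -S_AE -(mulmxA A) Eep Aep. Qed.
Lemma ep_ep : ep *m ep = ep.
Proof.
rewrite {1}/ep -scalemxAl mulmxDl Eep A1ep; move: ep => x.
by mxl; field.
Qed.
Lemma ep_em : ep + em = E.
Proof. by rewrite /ep /em; mxl; field. Qed.
Lemma ep_sub_em : ep - em = A1.
Proof. by rewrite /ep /em; mxl; field. Qed.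
Lemma ep0 : ep = 0 <-> A1 = - E.
Proof.
rewrite /ep; split=> [/eqP|->]; last by rewrite subrr scaler0.
by rewrite scaler_eq0 invr_eq0 (negPf (two0 K)) addrC addr_eq0 => /eqP.
Qed.
Lemma em0 : em = 0 <-> A1 = E.
Proof.
rewrite /em; split=> [/eqP|->]; last by rewrite subrr scaler0.
by rewrite scaler_eq0 invr_eq0 (negPf (two0 K)) subr_eq0 => /eqP.
Qed.

Lemma perp_pm X : perp A (ep *m X *m em).
Proof. by rewrite /perp !mulmxA Aep -!mulmxA emA !mulmxN subrr. Qed.
Lemma perp_mp X : perp A (em *m X *m ep).
Proof. by rewrite /perp !mulmxA Aem -!mulmxA epA !mulNmx addNr. Qed.

End S.

Lemma perp_sq C D : perp C D -> C *m C *m D = D *m (C *m C).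
Proof.
rewrite /perp => /eqP; rewrite addr_eq0 => /eqP e.
by rewrite -(mulmxA C C D) e mulmxN (mulmxA C D C) e mulNmx opprK mulmxA.
Qed.

Lemma single_perp C D c : c != 0 -> cub C = c *: (C *m C) -> perp C D ->
  C *m C *m D = 0 /\ D *m (C *m C) = 0.
Proof.
move=> c0 H1 pD; have e2 := perp_sq pD.
suff F0 : C *m C *m D = 0 by rewrite -e2 F0.
move: (pD); rewrite /perp => /eqP; rewrite addr_eq0 => /eqP e.
have e3 : cub C *m D = - (D *m cub C).
  by rewrite /cub -(mulmxA _ C D) e mulmxN (mulmxA (C *m C)) e2 -(mulmxA D).
have e4 : D *m cub C = cub C *m D by rewrite H1 -scalemxAr -e2 (scalemxAl c _ D).
have : cub C *m D = - (cub C *m D) by rewrite {1}e3 e4.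
move/eqP; rewrite -subr_eq0 opprK -mulr2n -scaler_nat scaler_eq0 (negPf (two0 K)) /=.
by rewrite H1 -scalemxAl scaler_eq0 (negPf c0) => /eqP.
Qed.

Lemma single_EF A C c : c != 0 -> jo A A -> cub C = c *: (C *m C) ->
  (forall D, perp A D -> perp C D) ->
  A *m A *m (C *m C) = C *m C /\ C *m C *m (A *m A) = C *m C.
Proof.
move=> c0 hA H1 sub; have P D := fun pD => single_perp c0 H1 (sub D pD).
set E := A *m A; set F := C *m C in P *.
have [FN NF] := P _ (perp_N hA).
suff [H2 H3] : (1%:M - E) *m F = 0 /\ F *m (1%:M - E) = 0.
  split; apply/eqP; rewrite eq_sym -subr_eq0; apply/eqP.
    by rewrite -H2 mulmxBl mul1mx.
  by rewrite -H3 mulmxBr mulmx1.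
have [N0|N0] := eqVneq (nilpart A) 0.
  have Q X := P _ (perp_corner hA X N0).
  split.
    case: (@sand0 (1%:M - E) ((1%:M - E) *m F)) => // [X|->]; last by rewrite mul0mx.
    by have [_] := Q X; rewrite /corner -!mulmxA.
  case: (@sand0 (F *m (1%:M - E)) (1%:M - E)) => // [X|->]; last by rewrite mulmx0.
  by have [] := Q X; rewrite /corner !mulmxA.
have Q X := P _ (perp_DX hA X).
split.
  case: (@sand0 (nilpart A) ((1%:M - E) *m F)) => // [X|/eqP]; last by rewrite (negPf N0).
  have [_] := Q X; rewrite mulmxBl -(mulmxA _ _ F) NF mulmx0 sub0r => /eqP.
  by rewrite oppr_eq0 /corner !mulmxA (S_NB hA) -!mulmxA => /eqP.
case: (@sand0 (F *m (1%:M - E)) (nilpart A)) => // [X|/eqP]; last by rewrite (negPf N0).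
have [+ _] := Q X; rewrite (mulmxBr F) (mulmxA F (nilpart A)) FN mul0mx subr0 /corner => e.
by rewrite -[RHS]e -!mulmxA (S_BN hA).
Qed.

(** The tests are the two families of off-diagonal blocks between [ep] and [em]. Each makes C act on
    one spectral space by a scalar; comparing the two on [ep] shows that the scalars are
    opposite. *)
Lemma both_CE A C : jo A A -> ep A != 0 -> em A != 0 ->
  (forall D, perp A D -> perp C D) ->
  exists c, C *m (A *m A) = c *: cub A /\ A *m A *m C = c *: cub A.
Proof.
move=> hA p0 m0 sub.
have [|||c [c1 c2]] := @sandeq (C *m ep A) (em A) (ep A) (- (em A *m C)) => //.
  move=> X; have := sub _ (perp_pm hA X); rewrite /perp !mulmxA => /eqP.
  by rewrite addr_eq0 => /eqP ->; rewrite mulmxN !mulmxA.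
have [|||d [d1 d2]] := @sandeq (C *m em A) (ep A) (em A) (- (ep A *m C)) => //.
  move=> X; have := sub _ (perp_mp hA X); rewrite /perp !mulmxA => /eqP.
  by rewrite addr_eq0 => /eqP ->; rewrite mulmxN !mulmxA.
have dc : d = - c.
  have e : c *: (ep A *m ep A) = - d *: (ep A *m ep A).
    rewrite scalemxAr -c1 mulmxA; move/eqP: d2; rewrite eqr_oppLR => /eqP ->.
    by rewrite mulNmx scaleNr scalemxAl.
  have epp : ep A *m ep A = ep A.
    exact: ep_ep.
  move: e; rewrite epp => /eqP; rewrite -subr_eq0 -scalerBl scaler_eq0 (negPf p0) orbF opprK addrC addr_eq0.
  by move/eqP.
exists c; rewrite -(ep_em A) -[cub A]ep_sub_em mulmxDr mulmxDl c1 d1.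
move/eqP: c2; rewrite eqr_oppLR => /eqP ->; move/eqP: d2; rewrite eqr_oppLR => /eqP ->.
by rewrite dc; split; mxl; ring.
Qed.

(** When A^4 = A^2, at most one of 1 and -1 is an eigenvalue. *)
Definition single A := cub A = A *m A \/ cub A = - (A *m A).

Lemma not_single A : ~ single A -> ep A != 0 /\ em A != 0.
Proof.
by move=> H; split; apply/eqP; [move/ep0|move/em0] => e; apply: H; [right|left].
Qed.

Lemma singleE A : single A -> exists2 c, c * c = 1 & cub A = c *: (A *m A).
Proof.
by case=> ->; [exists 1; rewrite ?mulr1 ?scale1r|exists (-1); rewrite ?mulrNN ?mulr1 ?scaleN1r].
Qed.

Lemma sqr1P (c : K) : c * c = 1 -> c = 1 \/ c = -1.
Proof. by rewrite -expr2 => /eqP; rewrite sqrf_eq1 => /orP[]/eqP; [left|right]. Qed.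

Section Main.
Variables (A C : 'M[K]_n).
Hypotheses (hA : jo A A) (hC : jo C C) (hAC : forall D, perp A D <-> perp C D).

(** If c were 0, the projection A^2 would anticommute with C, hence with A, which is impossible;
    then C^4 = C^2 forces c^2 = 1. *)
Lemma both_CE0 : ep A != 0 -> em A != 0 ->
  exists c, [/\ c * c = 1, C *m (A *m A) = c *: cub A & A *m A *m C = c *: cub A].
Proof.
move=> p0 m0; have [c [c1 c2]] := both_CE hA p0 m0 (fun D => (hAC D).1).
set E := A *m A in c1 c2 *.
have E0 : E != 0.
  by apply: contra p0 => /eqP e; rewrite -(Eep hA) -/E e mul0mx.
have EE : E *m E = E := S_EE hA.
have CA1 : C *m cub A = c *: E.
  by rewrite -(S_EA1 hA) mulmxA c1 -scalemxAl (S_A1A1 hA).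
have CCE : C *m C *m E = (c * c) *: E.
  by rewrite -mulmxA c1 -scalemxAr CA1 scalerA.
have C4E : C *m C *m C *m C *m E = (c * c * (c * c)) *: E.
  have -> : C *m C *m C *m C *m E = C *m C *m (C *m C *m E) by rewrite !mulmxA.
  by rewrite CCE -scalemxAr CCE scalerA.
have [c0|c0] := eqVneq c 0.
  case/eqP: E0; have : perp A E.
    by apply/hAC; rewrite /perp c1 c2 c0 scale0r addr0.
  rewrite /perp (S_AE A) (S_EA A) -mulr2n -scaler_nat => /eqP.
  by rewrite scaler_eq0 (negPf (two0 K)) /= => /eqP/(S_E0 hA).
exists c; split=> //; move/jo_S: hC => hC'.
have := C4E; rewrite hC' CCE => /eqP; rewrite eq_sym -subr_eq0 -scalerBl scaler_eq0 (negPf E0) orbF.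
by rewrite -[X in _ - X]mulr1 -mulrBr mulf_eq0 mulf_eq0 (negPf c0) /= subr_eq0 => /eqP.
Qed.

Lemma both_single : ep A != 0 -> em A != 0 -> single C -> False.
Proof.
move=> p0 m0 /singleE[d d1 dC]; have [c [cc c1 c2]] := both_CE0 p0 m0.
set E := A *m A in c1 c2 *.
have EE : E *m E = E := S_EE hA.
have CA1 : C *m cub A = c *: E.
  by rewrite -(S_EA1 hA) mulmxA c1 -scalemxAl (S_A1A1 hA).
have CCE : C *m C *m E = E.
  by rewrite -mulmxA c1 -scalemxAr CA1 scalerA cc scale1r.
have e1 : cub C *m E = c *: cub A.
  have -> : cub C *m E = C *m (C *m (C *m E)) by rewrite /cub !mulmxA.
  by rewrite c1 -!scalemxAr CA1 -scalemxAr c1 !scalerA cc mul1r.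
have e2 : cub C *m E = d *: E by rewrite dC -scalemxAl CCE.
have e3 : cub A = (c * d) *: E.
  by rewrite -scalerA -e2 e1 scalerA cc scale1r.
have /sqr1P[e|e] : (c * d) * (c * d) = 1 by rewrite mulrACA cc d1 mulr1.
  by case/eqP: m0; apply/em0; rewrite e3 e scale1r.
by case/eqP: p0; apply/ep0; rewrite e3 e scaleN1r.
Qed.
End Main.

Section Main2.
Variables (A C : 'M[K]_n).
Hypotheses (hA : jo A A) (hC : jo C C) (hAC : forall D, perp A D <-> perp C D).
Let hCA D : perp C D <-> perp A D. Proof. by split=> /hAC. Qed.

(** If both matrices have a single sign, their projections absorb each other; mixed cases contradict
    [both_single]; if both have two signs, [both_CE0] used in both directions identifies the
    projections. *)
Lemma perp_cub : exists2 c, c * c = 1 & cub C = c *: cub A /\ C *m C = A *m A.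
Proof.
set E := A *m A; set F := C *m C.
have [sA|nsA] := EM (single A); have [sC|nsC] := EM (single C).
- have [a a1 aA] := singleE sA; have [c c1 cC] := singleE sC.
  have [EF FE] : E *m F = F /\ F *m E = F.
    apply: (single_EF (c := c)) => // [|D /hAC //].
    by apply/eqP => c0; move: c1; rewrite c0 mulr0 => /esym/eqP; rewrite oner_eq0.
  have [FE' EF'] : F *m E = E /\ E *m F = E.
    apply: (single_EF (c := a)) => // [|D /hAC //].
    by apply/eqP => c0; move: a1; rewrite c0 mulr0 => /esym/eqP; rewrite oner_eq0.
  have FEe : F = E by rewrite -EF EF'.
  exists (c * a); first by rewrite mulrACA c1 a1 mulr1.
  by split=> //; rewrite cC aA -/F -/E FEe scalerA -mulrA a1 mulr1.
- by have [p m] := not_single nsC; case: (both_single hC hA hCA p m sA).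
- by have [p m] := not_single nsA; case: (both_single hA hC hAC p m sC).
have [p m] := not_single nsA; have [c [cc c1 c2]] := both_CE0 hA hC hAC p m.
have [p' m'] := not_single nsC; have [d [dd d1 d2]] := both_CE0 hC hA hCA p' m'.
rewrite -/E -/F in c1 c2 d1 d2 *.
have EF : E *m F = F.
  rewrite /E -mulmxA d1 -scalemxAr -(S_EA1 hC) -/F mulmxA d1 -scalemxAl (S_A1A1 hC).
  by rewrite scalerA dd scale1r.
have EF' : E *m F = E.
  rewrite /F mulmxA c2 -scalemxAl -(S_A1E hA) -/E -mulmxA c2 -scalemxAr (S_A1A1 hA).
  by rewrite scalerA cc scale1r.
have FEe : F = E by rewrite -EF EF'.
exists c => //; split=> //.
by rewrite -(S_AE C) -/F FEe c1.
Qed.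

(** The complementary projection 1 - A^2 anticommutes with A, hence with C, and its anticommutator
    with C is twice the nilpotent part of C. *)
Lemma perp_nilp_eq0 : nilpart A = 0 -> nilpart C = 0.
Proof.
move=> N0; have [c cc [C1 CE]] := perp_cub.
have pc : perp C (corner A 1%:M) by apply/hAC/perp_corner.
have Q := S_Acorner hC 1%:M; have Q' := S_cornerA hC 1%:M.
have cE : corner A 1%:M = corner C 1%:M by rewrite /corner CE.
move: pc; rewrite /perp cE Q Q' /corner mulmx1 mulmxA (S_NB hC) (S_NB hC) -mulmxA (S_BN hC) (S_BN hC).
by rewrite -mulr2n -scaler_nat => /eqP; rewrite scaler_eq0 (negPf (two0 K)) => /eqP.
Qed.

(** With R = MN, testing C against the commutators of [perp_DX] gives MXN - NXM = RXB + BXR for all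
    X. Multiplying by N on the left and by M on the right leaves RXR = 0, so R = 0, and [sandeq]
    applies to MXN = NXM. *)
Lemma perp_nilp : exists x : K, nilpart C = x *: nilpart A.
Proof.
have [c cc [C1 CE]] := perp_cub.
have [N0|N0] := eqVneq (nilpart A) 0; first by exists 0; rewrite perp_nilp_eq0 // scale0r.
set M := nilpart C; set N := nilpart A in N0 *.
have CM : C = c *: cub A + M by rewrite /M /nilpart C1 addrC subrK.
have A1N : cub A *m N = 0 := S_A1N hA.
have NA1 : N *m cub A = 0 := S_NA1 hA.
have CN : C *m N = M *m N by rewrite {1}CM mulmxDl -scalemxAl A1N scaler0 add0r.
have NC : N *m C = N *m M by rewrite {1}CM mulmxDr -scalemxAr NA1 scaler0 add0r.
have NN : N *m N = 0 := S_NN hA.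
have MM : M *m M = 0 := S_NN hC.
have NM : N *m M = - (M *m N).
  have : perp C N by apply/hAC/perp_N.
  by rewrite /perp CN NC addrC => /eqP; rewrite addr_eq0 => /eqP.
set B := 1%:M - A *m A.
have NB : N *m B = N := S_NB hA.
have BN : B *m N = N := S_BN hA.
have MB : M *m B = M by rewrite /B -CE; apply: S_NB hC.
have BM : B *m M = M by rewrite /B -CE; apply: S_BN hC.
set R := M *m N in NM CN; have RE : R = M *m N by []; clearbody R.
have eq X : M *m X *m N - N *m X *m M = R *m X *m B + B *m X *m R.
  have Q : C *m corner A X = M *m X *m B.
    by have := S_Acorner hC X; rewrite /corner CE -/B => ->; rewrite -/M !mulmxA MB.
  have Q' : corner A X *m C = B *m X *m M.
    by have := S_cornerA hC X; rewrite /corner CE -/B => ->; rewrite -/M -!mulmxA BM.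
  have : perp C (corner A X *m N - N *m corner A X) by apply/hAC/perp_DX.
  have Q3 : corner A X = B *m X *m B by [].
  rewrite /perp; move: (corner A X) Q3 Q Q' => k kE Q Q'.
  rewrite (mulmxBr C) (mulmxBl _ _ C) !mulmxA CN Q -!(mulmxA _ _ C) NC Q' NM.
  have -> : M *m X *m B *m N = M *m X *m N by rewrite -(mulmxA _ B) BN.
  have -> : N *m (B *m X *m M) = N *m X *m M by rewrite !mulmxA NB.
  have -> : R *m k = R *m X *m B by rewrite kE !mulmxA RE -(mulmxA M N B) NB.
  have -> : k *m - R = - (B *m X *m R).
    by rewrite kE mulmxN RE -!mulmxA (mulmxA B M) BM.
  by move=> e; apply: (lcombm (k := 1) e); mxl; ring.
have NR : N *m R = 0 by rewrite RE mulmxA NM mulNmx RE -mulmxA NN mulmx0 oppr0.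
have RM : R *m M = 0 by rewrite RE -mulmxA NM mulmxN RE mulmxA MM mul0mx oppr0.
have eq2 X : - (R *m X *m N) = N *m X *m R.
  have := congr1 (mulmx N) (eq X); rewrite mulmxBr mulmxDr !mulmxA NM NN NR NB !mul0mx subr0 add0r.
  by rewrite !mulNmx.
have R0 : R = 0.
  have : R = 0 \/ R = 0.
    apply: sand0 => X; have := congr1 (mulmx^~ M) (eq2 X).
    rewrite /= -!mulmxA RM !mulmx0 mulNmx -!mulmxA NM !mulmxN opprK => <-.
    by rewrite mulmxA.
  by case.
have eq3 X : M *m X *m N = N *m X *m M.
  by apply/eqP; rewrite -subr_eq0 eq R0 !(mul0mx, mulmx0) addr0.
by have [x [Mx _]] := sandeq N0 N0 eq3; exists x.
Qed.

End Main2.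

Lemma perp_structure A C : jo A A -> jo C C -> (forall D, perp A D <-> perp C D) ->
  exists c (x : K), [/\ c * c = 1, x != 0 & C = c *: cub A + x *: nilpart A].
Proof.
move=> hA hC hAC.
have [c cc [C1 CE]] := perp_cub hA hC hAC; have [x xE] := perp_nilp hA hC hAC.
have CM : C = c *: cub A + nilpart C by rewrite /nilpart C1 addrC subrK.
(* If x = 0, both nilpotent parts vanish by symmetry, so 1 serves as the required nonzero scalar. *)
have [x0|x0] := eqVneq x 0; last by exists c, x; rewrite -xE.
exists c, 1; split; rewrite ?oner_eq0 // scale1r.
move: xE; rewrite x0 scale0r => M0; rewrite {1}CM M0.
by rewrite (perp_nilp_eq0 hC hA) // => D; split=> /hAC.
Qed.

End Perp.

(** * Preimages of signed rank-one idempotents *)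

Section RepBase.
Variables (K : numClosedFieldType) (n : nat).
Implicit Types (X Y Z A B C D : 'M[K]_n) (u v w x y : 'cV[K]_n) (f g h k : 'rV[K]_n) (e : K).

Lemma ex_ker (k : nat) (M : 'M[K]_(k, n)) : (k < n)%N -> exists2 w : 'cV[K]_n, w != 0 & M *m w = 0.
Proof.
move=> kn; have : kermx M^T != 0.
  rewrite -mxrank_eq0 mxrank_ker mxrank_tr subn_eq0 -ltnNge.
  exact: leq_ltn_trans (rank_leq_row M) kn.
move=> /rowV0Pn[v /sub_kermxP vM v0]; exists v^T.
  by apply: contra v0 => /eqP/(congr1 trmx); rewrite trmxK trmx0 => ->.
by apply: trmx_inj; rewrite trmx_mul trmxK vM trmx0.
Qed.

Lemma ex_ker2 f g : (2 < n)%N -> exists2 w : 'cV[K]_n, w != 0 & dt f w = 0 /\ dt g w = 0.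
Proof.
move=> n3; have [w w0] := ex_ker (col_mx f g) n3.
rewrite mul_col_mx => /eqP; rewrite col_mx_eq0 => /andP[/eqP ef /eqP eg].
by exists w; rewrite // /dt ef eg mxE.
Qed.

Lemma ex_ker1 f : (1 < n)%N -> exists2 w : 'cV[K]_n, w != 0 & dt f w = 0.
Proof. by move=> n3; have [w w0 e] := ex_ker f n3; exists w; rewrite // /dt e mxE. Qed.

Lemma ex_kerl2 v w : (2 < n)%N -> exists2 f : 'rV[K]_n, f != 0 & dt f v = 0 /\ dt f w = 0.
Proof.
move=> n3; have [x x0 [e1 e2]] := ex_ker2 v^T w^T n3; exists x^T.
  by apply: contra x0 => /eqP/(congr1 trmx); rewrite trmxK trmx0 => ->.
by rewrite -[dt _ v]dtT -[dt _ w]dtT trmxK.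
Qed.
Lemma ex_kerl1 v : (1 < n)%N -> exists2 f : 'rV[K]_n, f != 0 & dt f v = 0.
Proof.
move=> n3; have [x x0 e1] := ex_ker1 v^T n3; exists x^T.
  by apply: contra x0 => /eqP/(congr1 trmx); rewrite trmxK trmx0 => ->.
by rewrite -[dt _ v]dtT trmxK.
Qed.

Lemma dt1_neq0r g v : dt g v = 1 -> v != 0.
Proof. by move=> gv; apply/eqP => v0; move: gv; rewrite v0 dt0r => /esym/eqP; rewrite oner_eq0. Qed.
Lemma dt1_neq0l g v : dt g v = 1 -> g != 0.
Proof. by move=> gv; apply/eqP => v0; move: gv; rewrite v0 dt0l => /esym/eqP; rewrite oner_eq0. Qed.

Lemma avoid_row (s : seq 'M[K]_n) : (0 < n)%N -> (forall C, List.In C s -> C != 0) ->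
  exists g, forall C, List.In C s -> g *m C != 0.
Proof.
move=> n0 H; pose Qs := [seq (fun g => g *m C = 0) | C <- s].
have [||Q /List.in_map_iff[C [<- Cs]]|g _ Hg] := @avoid K 'rV[K]_n (fun _ => True) Qs => //.
- by exists 0.
- split=> [a b g h gC hC|]; first by rewrite mulmxDl -!scalemxAl gC hC !scaler0 addr0.
  by have [g gC] := mx_neq0g (H _ Cs); exists g => // /eqP; rewrite (negPf gC).
exists g => C Cs; apply/eqP => gC; apply: (Hg (fun g => g *m C = 0)) => //.
by apply/List.in_map_iff; exists C.
Qed.

Lemma avoid_row1 (s : seq 'M[K]_n) v : (forall C, List.In C s -> C != 0) -> v != 0 ->
  exists g, dt g v = 1 /\ forall C, List.In C s -> g *m C != 0.
Proof.
move=> H v0; have [h hv] := ex_dual v0; have h0 := dt1_neq0l hv.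
have n0 : (0 < n)%N.
  by case: n v v0 {h h0 hv s H} => // v; rewrite [v]flatmx0 eqxx.
(* Avoiding the kernel of v h makes g v nonzero, after which g can be rescaled. *)
have [|g Hg] := @avoid_row (v *m h :: s) n0.
  by move=> C [<-|/H //]; apply/eqP => /out0[/eqP|/eqP]; rewrite ?(negPf v0) ?(negPf h0).
have gv : dt g v != 0.
  have := Hg _ (or_introl erefl); rewrite outg; apply: contra => /eqP ->.
  by rewrite scale0r.
exists ((dt g v)^-1 *: g); rewrite dtZl mulVf //; split=> // C Cs.
by rewrite -scalemxAl scaler_eq0 invr_eq0 (negPf gv) /= Hg //; right.
Qed.

(** Makes a pointwise alternative uniform: finitely many left kernels cover the affine hyperplane g
    v = 1 only if one of them is everything. *)
Lemma cover_row (s : seq 'M[K]_n) v : v != 0 ->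
  (forall g, dt g v = 1 -> exists2 C, List.In C s & g *m C = 0) ->
  exists2 C, List.In C s & C = 0.
Proof.
move=> v0 H; apply: contrapT => N; have [|g [gv Hg]] := @avoid_row1 s v _ v0.
  by move=> C Cs; apply/eqP => C0; apply: N; exists C.
by have [C Cs gC] := H g gv; have := Hg C Cs; rewrite gC eqxx.
Qed.

Lemma trmx_neq0 m p (M : 'M[K]_(m, p)) : (M^T != 0) = (M != 0).
Proof. by congr negb; apply/eqP/eqP => [/(congr1 trmx)|->]; rewrite ?trmxK ?trmx0. Qed.

Lemma cover_col (s : seq 'M[K]_n) g : g != 0 ->
  (forall v, dt g v = 1 -> exists2 C, List.In C s & C *m v = 0) ->
  exists2 C, List.In C s & C = 0.
Proof.
move=> g0 H; have [||C /List.in_map_iff[D [<- Ds]] D0] := @cover_row [seq C^T | C <- s] g^T.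
- by rewrite trmx_neq0.
- move=> v vg; have [|C Cs Cv] := H v^T; first by rewrite -dtT trmxK.
  exists C^T; first by apply/List.in_map_iff; exists C.
  by apply: trmx_inj; rewrite trmx_mul trmxK Cv trmx0.
by exists D => //; apply: trmx_inj; rewrite D0 trmx0.
Qed.

Lemma out_neq0 v g : v != 0 -> g != 0 -> v *m g != 0.
Proof. by move=> v0 g0; apply/eqP => /out0[/eqP|/eqP]; rewrite ?(negPf v0) ?(negPf g0). Qed.

Lemma jo_trP X Y : jo X^T Y^T <-> jo X Y.
Proof.
have e A B : jp A^T B^T = (jp A B)^T.
  by rewrite /jp [RHS]linearZ /= [X in _ = _ *: X]linearD /= !trmx_mul addrC.
rewrite /jo /idempotent_mx e -trmx_mul.
by split=> [/trmx_inj|->].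
Qed.

Lemma jo_NN X Y : jo (- X) (- Y) <-> jo X Y.
Proof. by rewrite /jo jpNl jpNr opprK. Qed.

Lemma jo_oute Z v g e : e * e = 1 -> dt g v = 1 ->
  jo Z (e *: (v *m g)) <-> Z *m v = e *: v \/ g *m Z = e *: g \/ (Z *m v = 0 /\ g *m Z = 0).
Proof.
move=> ee gv; have e0 : e != 0 by apply/eqP => e0; move: ee; rewrite e0 mul0r => /esym/eqP; rewrite oner_eq0.
have eqv m (x y : 'M[K]_(1, m)) : e *: x = y <-> x = e *: y.
  by split=> [<-|->]; rewrite scalerA ee scale1r.
have eqw (x y : 'M[K]_(n, 1)) : e *: x = y <-> x = e *: y.
  by split=> [<-|->]; rewrite scalerA ee scale1r.
by rewrite jo_outc // eqv eqw.
Qed.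

(** Idempotency along a line of matrices is a quadratic equation in the parameter, so three roots
    suffice, by Lagrange interpolation. *)
Lemma pencil (M0 M1 : 'M[K]_n) (x1 x2 x3 x : K) : x1 != x2 -> x1 != x3 -> x2 != x3 ->
  idempotent_mx (M0 + x1 *: M1) -> idempotent_mx (M0 + x2 *: M1) ->
  idempotent_mx (M0 + x3 *: M1) -> idempotent_mx (M0 + x *: M1).
Proof.
move=> n12 n13 n23.
have eqv t : idempotent_mx (M0 + t *: M1) <->
   (M0 *m M0 - M0) + t *: (M0 *m M1 + M1 *m M0 - M1) + (t * t) *: (M1 *m M1) = 0.
  rewrite /idempotent_mx mulmxDl !mulmxDr -!scalemxAl -!scalemxAr.
  by split=> H; apply: (lcombm (k := 1) H); mxl; ring.
rewrite !eqv; move: (M0 *m M0 - M0) (_ - M1) (M1 *m M1) => a b c E1 E2 E3.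
have d12 : x1 - x2 != 0 by rewrite subr_eq0.
have d13 : x1 - x3 != 0 by rewrite subr_eq0.
have d23 : x2 - x3 != 0 by rewrite subr_eq0.
have -> : a + x *: b + (x * x) *: c =
  ((x - x2) * (x - x3) / ((x1 - x2) * (x1 - x3))) *: (a + x1 *: b + (x1 * x1) *: c)
  + (- ((x - x1) * (x - x3)) / ((x1 - x2) * (x2 - x3))) *: (a + x2 *: b + (x2 * x2) *: c)
  + ((x - x1) * (x - x2) / ((x1 - x3) * (x2 - x3))) *: (a + x3 *: b + (x3 * x3) *: c).
  by mxl; field; rewrite d12 d13 d23.
by rewrite E1 E2 E3 !scaler0 !addr0.
Qed.

(* [th] is a section of [psi] over the signed rank-one idempotents. *)
Record rep (psi th : 'M[K]_n -> 'M[K]_n) : Prop := Rep {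
  rep_jo : forall X Y, jo X Y <-> jo (psi X) (psi Y);
  rep_th : forall e u f, e * e = 1 -> dt f u = 1 ->
     psi (th (e *: (u *m f))) = e *: (u *m f) }.

(** The symmetries of the setting: negating the argument, transposing the value and transposing the
    argument. *)
Lemma rep_opp psi th : rep psi th -> rep (fun X => psi (- X)) (fun P => - th P).
Proof.
case=> H1 H2; split=> [X Y|e u f ee fu]; last by rewrite opprK H2.
by rewrite -H1 jo_NN.
Qed.
Lemma rep_tr psi th : rep psi th -> rep (fun X => (psi X)^T) (fun P => th P^T).
Proof.
case=> H1 H2; split=> [X Y|e u f ee fu]; first by rewrite jo_trP.
by rewrite linearZ /= trmx_mul H2 ?dtT // linearZ /= trmx_mul !trmxK.
Qed.
Lemma rep_trd psi th : rep psi th -> rep (fun X => psi X^T) (fun P => (th P)^T).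
Proof.
case=> H1 H2; split=> [X Y|e u f ee fu]; last by rewrite trmxK H2.
by rewrite -H1 jo_trP.
Qed.

End RepBase.

Section Rep1.
Variables (K : numClosedFieldType) (n : nat).
Implicit Types (X Y Z A B C D : 'M[K]_n) (u v w x y : 'cV[K]_n) (f g h k : 'rV[K]_n) (e c : K).
Hypothesis n3 : (2 < n)%N.

Lemma sgn_neq0 e : e * e = 1 -> e != 0.
Proof. by move=> ee; apply/eqP => e0; move: ee; rewrite e0 mul0r => /esym/eqP; rewrite oner_eq0. Qed.
Lemma sgnN e : e * e = 1 -> - e * - e = 1.
Proof. by rewrite mulrNN. Qed.
Lemma sgn1 : 1 * 1 = 1 :> K. Proof. by rewrite mulr1. Qed.
Lemma sgn_neqN e : e * e = 1 -> e != - e.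
Proof.
move=> /sgn_neq0 e0; rewrite -subr_eq0 opprK -mulr2n -mulr_natr mulf_neq0 //.
by rewrite pnatr_eq0.
Qed.

Variables (psi th : 'M[K]_n -> 'M[K]_n).
Hypothesis H : rep psi th.
Notation T e u f := (th (e *: (u *m f))).

Lemma jo_T X e u f : e * e = 1 -> dt f u = 1 ->
  jo X (T e u f) <-> psi X *m u = e *: u \/ f *m psi X = e *: f \/
     (psi X *m u = 0 /\ f *m psi X = 0).
Proof. by move=> ee fu; rewrite (rep_jo H) (rep_th H ee fu) jo_oute. Qed.

Lemma jo_perp_all X : (forall Y, jo X Y) -> X = 0.
Proof.
move=> h; have : perp X 1%:M by apply: jo_perpN; apply: h.
rewrite /perp mulmx1 mul1mx -mulr2n -scaler_nat => /eqP.
by rewrite scaler_eq0 (negPf (two0 K)) => /eqP.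
Qed.

(** A substitute for injectivity: only 0 is related to every matrix. *)
Lemma psi0 X : psi X = 0 -> X = 0.
Proof.
move=> e; apply: jo_perp_all => Y; apply/(rep_jo H); rewrite e.
by apply: perp_jo; rewrite /perp mul0mx mulmx0 addr0.
Qed.

Lemma jo_TT e u f : e * e = 1 -> dt f u = 1 -> jo (T e u f) (T e u f).
Proof.
move=> ee fu; apply/jo_T => //; left.
by rewrite (rep_th H) // -scalemxAl outv fu scale1r.
Qed.

(** Were the first alternative false, every f would lie in the left kernel of Z or of Z - e, so one
    of these matrices would vanish. *)
Lemma row_all Z u e : u != 0 -> Z != 0 ->
  (forall f, dt f u = 1 -> Z *m u = e *: u \/ f *m Z = e *: f \/ (Z *m u = 0 /\ f *m Z = 0)) ->
  Z *m u = e *: u.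
Proof.
move=> u0 Z0 h; apply: contrapT => ne.
have [|C [<-|[<-|[]//]]] := @cover_row K n [:: Z; Z - e%:M] u u0.
- move=> f fu; case: (h f fu) => [//|[fZ|[_ fZ]]].
    by exists (Z - e%:M); [right; left|rewrite mulmxBr fZ mul_mx_scalar subrr].
  by exists Z; first left.
- by move/eqP; rewrite (negPf Z0).
move/eqP; rewrite subr_eq0 => /eqP ZE; apply: ne.
by rewrite ZE mul_scalar_mx.
Qed.

Lemma col_all Z f e : f != 0 -> Z != 0 ->
  (forall u, dt f u = 1 -> Z *m u = e *: u \/ f *m Z = e *: f \/ (Z *m u = 0 /\ f *m Z = 0)) ->
  f *m Z = e *: f.
Proof.
move=> u0 Z0 h; apply: contrapT => ne.
have [|C [<-|[<-|[]//]]] := @cover_col K n [:: Z; Z - e%:M] f u0.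
- move=> u fu; case: (h u fu) => [Zu|[//|[Zu _]]].
    by exists (Z - e%:M); [right; left|rewrite mulmxBl Zu mul_scalar_mx subrr].
  by exists Z; first left.
- by move/eqP; rewrite (negPf Z0).
move/eqP; rewrite subr_eq0 => /eqP ZE; apply: ne.
by rewrite ZE mul_mx_scalar.
Qed.

Lemma row_jo X u e : e * e = 1 -> u != 0 -> X != 0 ->
  (forall f, dt f u = 1 -> jo X (T e u f)) <-> psi X *m u = e *: u.
Proof.
move=> ee u0 X0; split=> [h|Xu f fu]; last by apply/jo_T => //; left.
apply: row_all => // [|f fu]; first by apply: contra X0 => /eqP/psi0 ->.
by apply/jo_T => //; apply: h.
Qed.

Lemma col_jo X f e : e * e = 1 -> f != 0 -> X != 0 ->
  (forall u, dt f u = 1 -> jo X (T e u f)) <-> f *m psi X = e *: f.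
Proof.
move=> ee u0 X0; split=> [h|Xu u fu]; last by apply/jo_T => //; right; left.
apply: col_all => // [|u fu]; first by apply: contra X0 => /eqP/psi0 ->.
by apply/jo_T => //; apply: h.
Qed.

(** The trichotomy of [jo_oute] for [psi X], restated on the source side only: the test persists for
    the opposite sign, for all f or for all u. *)
Lemma jo_T3 X e u f : e * e = 1 -> dt f u = 1 -> jo X (T e u f) ->
  [\/ jo X (T (- e) u f), forall f', dt f' u = 1 -> jo X (T e u f') |
      forall u', dt f u' = 1 -> jo X (T e u' f)].
Proof.
move=> ee fu; rewrite jo_T // => -[h|[h|h]].
- by constructor 2 => f' fu'; apply/jo_T => //; left.
- by constructor 3 => u' fu'; apply/jo_T => //; right; left.
by constructor 1; apply/jo_T => //; [exact: sgnN|right; right].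
Qed.

Lemma pigeon (P1 P2 P3 : K -> Prop) : (forall c, c != 0 -> [\/ P1 c, P2 c | P3 c]) ->
  exists a b, [/\ a != 0, b != 0, a != b &
     [\/ P1 a /\ P1 b, P2 a /\ P2 b | P3 a /\ P3 b]].
Proof.
move=> h; apply: contrapT => N.
have [|t [t0 Ht]] := @good_scalar K [:: (fun t => t != 0 /\ P1 t); (fun t => t != 0 /\ P2 t); (fun t => t != 0 /\ P3 t)].
  move=> Q [<-|[<-|[<-|[]//]]] t t' [t0 Pt] [t'0 Pt']; apply: contrapT => /eqP tt';
  apply: N; exists t, t'; split=> //; [constructor 1|constructor 2|constructor 3]; by [].
case: (h t t0) => Pt.
- by apply: (Ht (fun t => t != 0 /\ P1 t)); [left|].
- by apply: (Ht (fun t => t != 0 /\ P2 t)); [right; left|].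
by apply: (Ht (fun t => t != 0 /\ P3 t)); [right; right; left|].
Qed.

Lemma tri_pt e u f Y : e * e = 1 -> dt f u = 1 -> perp (T e u f) Y ->
  [\/ perp (T (- e) u f) Y, forall f', dt f' u = 1 -> perp (T e u f') Y |
      forall u', dt f u' = 1 -> perp (T e u' f) Y].
Proof.
move=> ee fu pY.
have [|a [b [a0 b0 ab Q]]] := @pigeon (fun c => jo (c *: Y) (T (- e) u f))
  (fun c => forall f', dt f' u = 1 -> jo (c *: Y) (T e u f'))
  (fun c => forall u', dt f u' = 1 -> jo (c *: Y) (T e u' f)).
  by move=> c c0; apply: jo_T3 => //; apply/joC; apply: perp_joZ.
case: Q => -[Qa Qb]; [constructor 1|constructor 2|constructor 3].
- by apply: (jo_perp2 a0 b0 ab); apply/joC.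
- by move=> f' fu'; apply: (jo_perp2 a0 b0 ab); apply/joC; [apply: Qa|apply: Qb].
by move=> f' fu'; apply: (jo_perp2 a0 b0 ab); apply/joC; [apply: Qa|apply: Qb].
Qed.

(** The alternatives of [tri_pt] are linear in Y, so by [avoid] one of them holds for the whole
    anticommutant. *)
Lemma tri_perp e u f : e * e = 1 -> dt f u = 1 ->
  [\/ forall Y, perp (T e u f) Y -> perp (T (- e) u f) Y,
      forall Y, perp (T e u f) Y -> forall f', dt f' u = 1 -> perp (T e u f') Y |
      forall Y, perp (T e u f) Y -> forall u', dt f u' = 1 -> perp (T e u' f) Y].
Proof.
move=> ee fu; apply: contrapT => N.
pose Q1 := perp (T (- e) u f).
pose Q2 Y := forall f', dt f' u = 1 -> perp (T e u f') Y.
pose Q3 Y := forall u', dt f u' = 1 -> perp (T e u' f) Y.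
have wit (Q : 'M[K]_n -> Prop) : ~ (forall Y, perp (T e u f) Y -> Q Y) ->
    exists2 Y, perp (T e u f) Y & ~ Q Y.
  by move=> nQ; apply: contrapT => N'; apply: nQ => Y pY; apply: contrapT => nQY; apply: N'; exists Y.
have [|||Y pY HY] := @avoid K 'M[K]_n (perp (T e u f)) [:: Q1; Q2; Q3].
- exact: perp_lin.
- by exists 0; rewrite /perp mulmx0 mul0mx addr0.
- move=> Q [<-|[<-|[<-|[]//]]]; split.
  + exact: perp_lin.
  + by apply: wit => h; apply: N; constructor 1.
  + by move=> a b X Y hX hY f' f'u; apply: perp_lin; [apply: hX|apply: hY].
  + by apply: wit => h; apply: N; constructor 2.
  + by move=> a b X Y hX hY f' f'u; apply: perp_lin; [apply: hX|apply: hY].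
  + by apply: wit => h; apply: N; constructor 3.
case: (tri_pt ee fu pY) => h.
- by apply: (HY Q1) => //; left.
- by apply: (HY Q2) => //; right; left.
by apply: (HY Q3) => //; right; right; left.
Qed.

Lemma th_inj e u f e' u' f' : e * e = 1 -> dt f u = 1 -> e' * e' = 1 -> dt f' u' = 1 ->
  T e u f = T e' u' f' -> e *: (u *m f) = e' *: (u' *m f').
Proof. by move=> ee fu ee' fu' /(congr1 psi); rewrite !(rep_th H). Qed.

Lemma th_injf e u f f' : e * e = 1 -> dt f u = 1 -> dt f' u = 1 -> T e u f = T e u f' -> f = f'.
Proof.
move=> ee fu f'u /(th_inj ee fu ee f'u) /(scalerI (sgn_neq0 ee)).
by move=> /(congr1 (mulmx f)); rewrite !outg fu !scale1r.
Qed.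
(** Y and 2Y would pass the same tests. Testing with Y itself gives Y^2 = 0, and a square-zero
    rank-one matrix v g with gYv = 2 then separates them. *)
Lemma not_scalar_pair e Y : e * e = 1 -> Y != 0 -> psi Y = e%:M -> psi (2 *: Y) = e%:M -> False.
Proof.
move=> ee Y0 e1 e2.
have j11 : jo (e%:M : 'M[K]_n) e%:M.
  by rewrite /jo jpAA /idempotent_mx -scalar_mxM ee mul1mx.
have two1 : (1 : K) != 2.
  by rewrite -subr_eq0 -[2]/(1 + 1) opprD addrA subrr sub0r oppr_eq0 oner_eq0.
have YY : Y *m Y = 0.
  have : perp Y Y.
    apply: (@jo_perp2 _ _ _ _ 1 2); rewrite ?oner_eq0 ?two0 // ?scale1r; apply/(rep_jo H).
      by rewrite e1.
    by rewrite e1 e2.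
  rewrite /perp -mulr2n -scaler_nat => /eqP.
  by rewrite scaler_eq0 (negPf (two0 K)) => /eqP.
have [v Yv] := mx_neq0v Y0.
have v0 : v != 0 by apply: contra Yv => /eqP ->; rewrite mulmx0.
have [|g [gv gYv]] := @ex_dual2 K n v (Y *m v) 0 2 v0.
  case=> c Ec; have := congr1 (mulmx Y) Ec; rewrite mulmxA YY mul0mx -scalemxAr => /esym/eqP.
  by rewrite scaler_eq0 (negPf Yv) orbF => /eqP c0; move: Yv; rewrite Ec c0 scale0r eqxx.
have g0 : g != 0.
  by apply/eqP => g0; move: gYv; rewrite g0 dt0l => /esym/eqP; rewrite (negPf (two0 K)).
have j1 : jo Y (v *m g).
  by apply/jo_nil => //; right; split=> //; rewrite mulmxA YY mul0mx dt0r.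
have j2 : jo (2 *: Y) (v *m g) by apply/(rep_jo H); rewrite e2 -e1; exact: (rep_jo H _ _).1 j1.
have : perp Y (v *m g).
  apply: (@jo_perp2 _ _ _ _ 1 2); rewrite ?oner_eq0 ?two0 // ?scale1r //.
  by apply/jo_scale.
move=> /(congr1 (mulmx^~ v)); rewrite /= mul0mx mulmxDl mulmxA outv gv scale0r add0r.
rewrite -(mulmxA (v *m g)) outv gYv => /eqP; rewrite scaler_eq0 (negPf v0) orbF.
by rewrite (negPf (two0 K)).
Qed.

Section Vcase.
Variables (e : K) (u : 'cV[K]_n) (f : 'rV[K]_n).
Hypotheses (ee : e * e = 1) (fu : dt f u = 1).
Hypothesis hV : forall Y, perp (T e u f) Y -> forall f', dt f' u = 1 -> perp (T e u f') Y.

Lemma Vcase_row Y : perp (T e u f) Y -> Y != 0 -> psi Y *m u = e *: u.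
Proof.
move=> pY Y0; apply/row_jo => //; first exact: dt1_neq0r fu.
by move=> f' f'u; apply/joC/perp_jo/hV.
Qed.

(** Apply [tri_perp] to f': the sign alternative contradicts [Vcase_row], the column alternative is
    excluded by the assumption on f', and the remaining one is the converse inclusion. *)
Lemma Vcase_eq Y0 f' : perp (T e u f) Y0 -> Y0 != 0 -> dt f' u = 1 ->
  f' *m psi Y0 <> e *: f' -> forall D, perp (T e u f') D <-> perp (T e u f) D.
Proof.
move=> pY Y0n f'u nf'; have u0 : u != 0 := dt1_neq0r fu.
have f'0 := dt1_neq0l f'u.
have Tu := Vcase_row pY Y0n.
case: (tri_perp ee f'u) => h.
- have /perp_jo/joC := h _ (hV pY f'u).
  rewrite jo_T ?sgnN // Tu => -[|[E|[]]].
  + move=> /eqP; rewrite -subr_eq0 -scalerBl scaler_eq0 (negPf u0) orbF subr_eq0.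
    by rewrite (negPf (sgn_neqN ee)).
  + have := congr1 (fun z => dt z u) E; rewrite /= dtA Tu !dtL f'u !mulr1 => /eqP.
    by rewrite (negPf (sgn_neqN ee)).
  by move=> /eqP; rewrite scaler_eq0 (negPf u0) (negPf (sgn_neq0 ee)).
- by move=> D; split=> pD; [apply: h|apply: hV].
case: nf'; apply/col_jo => // u' f'u'.
by apply/joC/perp_jo; apply: h => //; apply: hV.
Qed.

(** A nonzero Y is already contradictory. For generic f' the matrices [T e u f'] would share one
    anticommutant and so lie on the affine line through A1^3 directed by the nilpotent part of A1,
    where passing the test with a fixed B is a quadratic condition. Yet B is built so that exactly
    the f' with f' w = 0 pass: three distinct points pass and a fourth fails. *)
Lemma Vcase_excl Y : perp (T e u f) Y -> perp (T (- e) u f) Y.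
Proof.
move=> pY; apply: contrapT => nY.
have u0 : u != 0 := dt1_neq0r fu.
have Yn : Y != 0.
  by apply/eqP => Y0; apply: nY; rewrite Y0 /perp mulmx0 mul0mx addr0.
have [Y1 [pY1 Y1n sY1]] : exists Y1, [/\ perp (T e u f) Y1, Y1 != 0 & psi Y1 <> e%:M].
  have [s1|s1] := EM (psi Y = e%:M); last by exists Y.
  exists (2 *: Y); split; [by apply: perpZr|by rewrite scaler_eq0 (negPf (two0 K))|].
  by move=> s2; apply: (not_scalar_pair ee Yn s1 s2).
pose D := psi Y1 - e%:M.
have D0 : D != 0 by apply/eqP => /eqP; rewrite subr_eq0 => /eqP.
have gen f' : dt f' u = 1 -> f' *m D != 0 -> forall Z, perp (T e u f') Z <-> perp (T e u f) Z.
  move=> f'u f'D; apply: (Vcase_eq pY1) => // E; move: f'D.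
  by rewrite mulmxBr E mul_mx_scalar subrr eqxx.
have [|f1 [f1u f1D]] := @avoid_row1 K n [:: D] u _ u0; first by move=> C [<-|[]//].
have {}f1D := f1D _ (or_introl erefl).
have [d d0 du] := @ex_kerl1 K n u (ltnW n3).
have once t t' : (f1 + t *: d) *m D = 0 -> (f1 + t' *: d) *m D = 0 -> t = t'.
  move=> E1 E2; apply: contrapT => /eqP tt'.
  have t't0 : t' - t != 0 by rewrite subr_eq0 eq_sym.
  case/eqP: f1D; have -> : f1 = (t' / (t' - t)) *: (f1 + t *: d) + (- t / (t' - t)) *: (f1 + t' *: d).
    by mxl; field.
  by rewrite mulmxDl -!scalemxAl E1 E2 !scaler0 addr0.
have [|t1 [t10 Ht1]] := @good_scalar K [:: (fun t => (f1 + t *: d) *m D = 0)].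
  by move=> Q [<-|[]//]; apply: once.
have [|t2 [t20 Ht2]] := @good_scalar K [:: (fun t => (f1 + t *: d) *m D = 0); (fun t => t = t1)].
  by move=> Q [<-|[<-|[]//]] t t'; [exact: once|move=> -> ->].
have {}Ht1 := Ht1 _ (or_introl erefl).
have t12 : t1 <> t2 by move=> e12; apply: (Ht2 (fun t => t = t1)); [right; left|].
have {}Ht2 := Ht2 _ (or_introl erefl).
(* The whole pencil f1 + t d kills w, which supplies the three passing points; f4 is chosen not to
   kill w. *)
have [w w0 [f1w dw]] := @ex_ker2 K n f1 d n3.
have [|f4 [f4u Hf4]] := @avoid_row1 K n [:: D; w *m f1] u _ u0.
  by move=> C [<-|[<-|[]//]] //; rewrite out_neq0 // (dt1_neq0l f1u).
have f4D := Hf4 _ (or_introl erefl).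
have f4w : dt f4 w != 0.
  have := Hf4 _ (or_intror (or_introl erefl)); rewrite outg.
  by apply: contra => /eqP ->; rewrite scale0r.
have [|h [hu hw]] := @ex_dual2 K n u w 0 1 u0.
  case=> c wE; move: f1w; rewrite wE dtL f1u mulr1 => c0.
  by move: w0; rewrite wE c0 scale0r eqxx.
pose B := T 1 w h.
have jB f' : dt f' u = 1 -> jo B (T e u f') <-> dt f' w = 0.
  move=> f'u; rewrite jo_T // (rep_th H sgn1 hw) scale1r outv hu scale0r outg.
  split=> [[/esym/eqP|[E|[_ /eqP]]]|->].
  - by rewrite scaler_eq0 (negPf u0) (negPf (sgn_neq0 ee)).
  - have := congr1 (fun z => dt z u) E; rewrite /= !dtL hu f'u mulr0 mulr1 => /esym/eqP.
    by rewrite (negPf (sgn_neq0 ee)).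
  - by rewrite scaler_eq0 (negPf (dt1_neq0l hw)) orbF => /eqP.
  by right; right; rewrite scale0r.
pose A1 := T e u f1.
have S1 : jo A1 A1 by apply: jo_TT.
have form f' : dt f' u = 1 -> f' *m D != 0 -> exists x : K, T e u f' = cub A1 + x *: nilpart A1.
  move=> f'u f'D; set A' := T e u f'.
  have [|c [x [cc x0 AE]]] := @perp_structure K n A1 A' S1 (jo_TT ee f'u).
    by move=> Z; rewrite (gen _ f1u f1D) (gen _ f'u f'D).
  exists x; rewrite AE; congr (_ + _).
  (* The idempotents share the column u, so their preimages are related; this rules out the sign -1
     in [perp_structure]. *)
  have : jo A1 A'.
    by apply/jo_T => //; left; rewrite (rep_th H) // -scalemxAl outv f1u scale1r.
  rewrite AE /jo jpDr !jpZr.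
  have -> : jp A1 (nilpart A1) = 0 by apply/perp_jp/perp_N.
  have -> : jp A1 (cub A1) = A1 *m A1.
    rewrite /jp (S_AA1 S1) (S_A1A S1) -mulr2n -scaler_nat scalerA mulVf ?scale1r //.
    exact: two0.
  rewrite scaler0 addr0; case/sqr1P: cc => ->; first by rewrite !scale1r.
  rewrite scaleN1r /idempotent_mx mulNmx mulmxN opprK (S_EE S1) => E0.
  have {}E0 : A1 *m A1 = 0.
    move/eqP: E0; rewrite -subr_eq0 opprK -mulr2n -scaler_nat scaler_eq0 (negPf (two0 K)) /=.
    by move/eqP.
  by rewrite -(S_AE A1) E0 mulmx0 scaler0.
have u1 t : dt (f1 + t *: d) u = 1 by rewrite !dtL du f1u; ring.
have w1 t : dt (f1 + t *: d) w = 0 by rewrite !dtL dw f1w; ring.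
have f1E : f1 = f1 + 0 *: d by rewrite scale0r addr0.
have [x2 E2] := form _ (u1 t1) (introN eqP Ht1).
have [x3 E3] := form _ (u1 t2) (introN eqP Ht2).
have [x4 E4] := form _ f4u f4D.
have E1 : A1 = cub A1 + 1 *: nilpart A1 by rewrite /nilpart scale1r addrC subrK.
have inj t t' : T e u (f1 + t *: d) = T e u (f1 + t' *: d) -> t = t'.
  move=> /(th_injf ee (u1 t) (u1 t')) /addrI /eqP; rewrite -subr_eq0 -scalerBl scaler_eq0 (negPf d0) orbF subr_eq0.
  by move/eqP.
have j1 := (jB _ f1u).2 f1w; have j2 := (jB _ (u1 t1)).2 (w1 t1); have j3 := (jB _ (u1 t2)).2 (w1 t2).
rewrite -/A1 E1 /jo jpDr jpZr in j1.
rewrite E2 /jo jpDr jpZr in j2.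
rewrite E3 /jo jpDr jpZr in j3.
have : jo B (T e u f4).
  rewrite E4 /jo jpDr jpZr; apply: (pencil _ _ _ _ j1 j2 j3).
  - apply/eqP => E; case/eqP: t10; apply: inj; rewrite E2 -f1E -E -E1 //.
  - apply/eqP => E; case/eqP: t20; apply: inj; rewrite E3 -f1E -E -E1 //.
  by apply/eqP => E; apply: t12; apply: inj; rewrite E2 E3 E.
by rewrite jB // => /eqP; rewrite (negPf f4w).
Qed.
End Vcase.
End Rep1.

(** * Row and column types of eigenvectors *)

Section Types.
Variables (K : numClosedFieldType) (n : nat).
Implicit Types (X Y Z A B C D : 'M[K]_n) (u v w x y : 'cV[K]_n) (f g h k : 'rV[K]_n) (e c : K)
  (psi th : 'M[K]_n -> 'M[K]_n).
Hypothesis n3 : (2 < n)%N.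

(** [Vcase_excl] treats the row alternative of [tri_perp], and its transpose treats the column
    alternative. *)
Lemma perp_opp psi th e u f Y : rep psi th -> e * e = 1 -> dt f u = 1 ->
  perp (th (e *: (u *m f))) Y -> perp (th (- e *: (u *m f))) Y.
Proof.
move=> H ee fu pY; case: (tri_perp H ee fu) => h; first exact: h.
  exact: (Vcase_excl n3 H ee fu h).
have := @Vcase_excl K n n3 _ _ (rep_tr H) e f^T u^T ee.
rewrite dtT => /(_ fu).
have trE c x k : th (c *: (k^T *m x^T))^T = th (c *: (x *m k)).
  by rewrite linearZ /= trmx_mul !trmxK.
rewrite !trE; apply=> // Z pZ f' f'u.
by rewrite -[f']trmxK trE; apply: h => //; rewrite -dtT trmxK.
Qed.

Lemma perp_oppE psi th e u f Y : rep psi th -> e * e = 1 -> dt f u = 1 ->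
  perp (th (e *: (u *m f))) Y <-> perp (th (- e *: (u *m f))) Y.
Proof.
move=> H ee fu; split; first exact: (perp_opp H).
by rewrite -[X in th (X *: _)]opprK => /(perp_opp H (sgnN ee) fu); rewrite !opprK.
Qed.

Lemma eig_sgn_uniq m (x : 'M[K]_(m, 1)) a b : x != 0 -> a *: x = b *: x -> a = b.
Proof.
move=> x0 /eqP; rewrite -subr_eq0 -scalerBl scaler_eq0 (negPf x0) orbF subr_eq0.
by move/eqP.
Qed.

Lemma eig_sgn_uniql m (x : 'M[K]_(1, m)) a b : x != 0 -> a *: x = b *: x -> a = b.
Proof.
move=> x0 /eqP; rewrite -subr_eq0 -scalerBl scaler_eq0 (negPf x0) orbF subr_eq0.
by move/eqP.
Qed.

(** The anticommutants agree, so [perp_structure] applies. P and -P are not related, since their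
    Jordan product -P is not idempotent; this excludes the sign +1 and A^2 = 0. *)
Lemma opp_structure psi th e u f : rep psi th -> e * e = 1 -> dt f u = 1 ->
  let A := th (e *: (u *m f)) in
  A *m A != 0 /\ exists2 c, c != 0 & th (- e *: (u *m f)) = - cub A + c *: nilpart A.
Proof.
move=> H ee fu A; set A' := th (- e *: _).
have SA : jo A A := jo_TT H ee fu; have SA' : jo A' A' := jo_TT H (sgnN ee) fu.
have [d [x [dd x0 AE]]] := @perp_structure K n A A' SA SA' (fun D => perp_oppE D H ee fu).
have nj : ~ jo A A'.
  rewrite (jo_T H) ?sgnN // (rep_th H ee fu : psi A = _) -scalemxAl -scalemxAr outv outg fu !scale1r.
  have e0 := sgn_neq0 ee; have u0 := dt1_neq0r fu; have f0 := dt1_neq0l fu.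
  have nz : e - - e != 0 by rewrite subr_eq0 sgn_neqN.
  case=> [E|[E|[/eqP + _]]].
  - by move: nz; rewrite subr_eq0 => /eqP; case; exact: eig_sgn_uniq u0 E.
  - by move: nz; rewrite subr_eq0 => /eqP; case; exact: eig_sgn_uniql f0 E.
  by rewrite scaler_eq0 (negPf e0) (negPf u0).
have jAA : jp A A' = d *: (A *m A).
  rewrite AE jpDr !jpZr.
  have -> : jp A (nilpart A) = 0 by apply/perp_jp/perp_N.
  have -> : jp A (cub A) = A *m A.
    rewrite /jp (S_AA1 SA) (S_A1A SA) -mulr2n -scaler_nat scalerA mulVf ?scale1r //.
    exact: two0.
  by rewrite scaler0 addr0.
have A20 : A *m A != 0.
  by apply/eqP => A0; apply: nj; rewrite /jo jAA A0 scaler0 /idempotent_mx mul0mx.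
split=> //; exists x => //; case/sqr1P: dd => d1.
  by case: nj; rewrite /jo jAA d1 scale1r; apply: (S_EE SA).
by rewrite AE d1 scaleN1r.
Qed.

Lemma cub_eig A v e : e * e = 1 -> A *m v = e *: v -> cub A *m v = e *: v.
Proof.
by move=> ee Av; rewrite /cub -!mulmxA Av -!scalemxAr Av -scalemxAr Av !scalerA ee mul1r.
Qed.

Lemma opp_eig psi th e a u f v : rep psi th -> e * e = 1 -> a * a = 1 -> dt f u = 1 ->
  th (e *: (u *m f)) *m v = a *: v -> th (- e *: (u *m f)) *m v = - a *: v.
Proof.
move=> H ee aa fu Av; have [_ [c c0 ->]] := opp_structure H ee fu.
rewrite mulmxDl mulNmx -scalemxAl /nilpart mulmxBl (cub_eig aa Av) Av subrr scaler0 addr0.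
by rewrite scaleNr.
Qed.

Lemma T_eig psi th e a u f v : rep psi th -> e * e = 1 -> a * a = 1 -> dt f u = 1 ->
  th (e *: (u *m f)) *m v = a *: v <-> th (u *m f) *m v = (e * a) *: v.
Proof.
move=> H ee aa fu; case/sqr1P: (ee) => ->; first by rewrite mul1r scale1r.
split=> h.
  have := opp_eig H (sgnN (sgn1 _)) aa fu h.
  by rewrite opprK scale1r mulN1r.
have := @opp_eig psi th 1 (-1 * a) u f v H (sgn1 K) _ fu; rewrite scale1r mulN1r opprK.
by apply; rewrite ?mulrNN // -mulN1r.
Qed.

(* The preimages of all idempotents with column line [u] (R), resp. row line [f] (C),
   share the eigenvector [v] on the right (r) or [g] on the left (l). *)
Definition Rr th e v u := forall f, dt f u = 1 -> th (u *m f) *m v = e *: v.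
Definition Cr th e v f := forall u, dt f u = 1 -> th (u *m f) *m v = e *: v.
Definition Rl th e g u := forall f, dt f u = 1 -> g *m th (u *m f) = e *: g.
Definition Cl th e g f := forall u, dt f u = 1 -> g *m th (u *m f) = e *: g.

(** [ttr] exchanges R with C, and [tdr] exchanges right with left; the dictionary that follows
    transports each lemma to its dual forms. *)
Definition ttr th := fun P : 'M[K]_n => th P^T.
Definition tdr th := fun P : 'M[K]_n => (th P)^T.

Lemma Rr_ttr th e v f : Rr (ttr th) e v f^T <-> Cr th e v f.
Proof.
rewrite /Rr /Cr /ttr; split=> h u fu.
  by have := h u^T; rewrite dtT trmx_mul !trmxK; apply.
by rewrite trmx_mul trmxK; apply: h; rewrite -dtT trmxK.
Qed.
Lemma Cr_ttr th e v u : Cr (ttr th) e v u^T <-> Rr th e v u.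
Proof.
rewrite /Rr /Cr /ttr; split=> h f fu.
  by have := h f^T; rewrite dtT trmx_mul !trmxK; apply.
by rewrite trmx_mul trmxK; apply: h; rewrite -dtT trmxK.
Qed.
Lemma Rl_ttr th e g f : Rl (ttr th) e g f^T <-> Cl th e g f.
Proof.
rewrite /Rl /Cl /ttr; split=> h u fu.
  by have := h u^T; rewrite dtT trmx_mul !trmxK; apply.
by rewrite trmx_mul trmxK; apply: h; rewrite -dtT trmxK.
Qed.
Lemma Cl_ttr th e g u : Cl (ttr th) e g u^T <-> Rl th e g u.
Proof.
rewrite /Rl /Cl /ttr; split=> h f fu.
  by have := h f^T; rewrite dtT trmx_mul !trmxK; apply.
by rewrite trmx_mul trmxK; apply: h; rewrite -dtT trmxK.
Qed.
Lemma Rr_tdr th e g u : Rr (tdr th) e g^T u <-> Rl th e g u.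
Proof.
rewrite /Rr /Rl /tdr; split=> h f fu; last by rewrite -trmx_mul h // linearZ.
by apply: trmx_inj; rewrite trmx_mul h // linearZ.
Qed.
Lemma Cr_tdr th e g f : Cr (tdr th) e g^T f <-> Cl th e g f.
Proof.
rewrite /Cr /Cl /tdr; split=> h u fu; last by rewrite -trmx_mul h // linearZ.
by apply: trmx_inj; rewrite trmx_mul h // linearZ.
Qed.
Lemma Rl_tdr th e v u : Rl (tdr th) e v^T u <-> Rr th e v u.
Proof.
rewrite /Rr /Rl /tdr; split=> h f fu; last by rewrite -trmx_mul h // linearZ.
by apply: trmx_inj; rewrite trmx_mul h // linearZ.
Qed.
Lemma Cl_tdr th e v f : Cl (tdr th) e v^T f <-> Cr th e v f.
Proof.
rewrite /Cr /Cl /tdr; split=> h u fu; last by rewrite -trmx_mul h // linearZ.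
by apply: trmx_inj; rewrite trmx_mul h // linearZ.
Qed.

Lemma rep_ttr psi th : rep psi th -> rep (fun X => (psi X)^T) (ttr th).
Proof. exact: rep_tr. Qed.
Lemma rep_tdr psi th : rep psi th -> rep (fun X => psi X^T) (tdr th).
Proof. exact: rep_trd. Qed.

Lemma T_eigl psi th e a u f g : rep psi th -> e * e = 1 -> a * a = 1 -> dt f u = 1 ->
  g *m th (e *: (u *m f)) = a *: g <-> g *m th (u *m f) = (e * a) *: g.
Proof.
move=> H ee aa fu; have := @T_eig _ _ e a u f g^T (rep_tdr H) ee aa fu.
rewrite /tdr -!trmx_mul -!linearZ /= => h.
by split=> [E|E]; apply: trmx_inj; apply/h; rewrite E.
Qed.

Lemma T1E th u f : th (1 *: (u *m f)) = th (u *m f).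
Proof. by rewrite scale1r. Qed.

Lemma th_neq0 psi th u f : rep psi th -> dt f u = 1 -> th (u *m f) != 0.
Proof.
move=> H fu; have [] := opp_structure H (sgn1 K) fu; rewrite T1E => h _.
by apply: contra h => /eqP ->; rewrite mul0mx.
Qed.

(** Suppose f1 and u1 are counterexamples, with preimages C and D. For each g with g v = 1, e v g
    passes the test with [th (u *m f)]; by [jo_T3] it passes with C or with D, as the opposite sign
    is impossible. So every such g is killed by one of C, C - e, D, D - e, none of which is zero. *)
Lemma typeR psi th e v u f : rep psi th -> e * e = 1 -> v != 0 -> dt f u = 1 ->
  th (u *m f) *m v = e *: v -> Rr th e v u \/ Cr th e v f.
Proof.
move=> H ee v0 fu Av; apply: contrapT => N.
have [f1 [f1u nf1]] : exists f1, dt f1 u = 1 /\ th (u *m f1) *m v <> e *: v.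
  apply: contrapT => N'; apply: N; left => f1 f1u; apply: contrapT => nE.
  by apply: N'; exists f1.
have [u1 [fu1 nu1]] : exists u1, dt f u1 = 1 /\ th (u1 *m f) *m v <> e *: v.
  apply: contrapT => N'; apply: N; right => f2 f2u; apply: contrapT => nE.
  by apply: N'; exists f2.
set C := th (u *m f1) in nf1; set D := th (u1 *m f) in nu1.
have A'v : th (-1 *: (u *m f)) *m v = - e *: v.
  by apply: (opp_eig H (sgn1 K) ee fu); rewrite T1E.
have side Z g : dt g v = 1 -> Z *m v <> e *: v -> jo (e *: (v *m g)) Z ->
    g *m Z = 0 \/ g *m (Z - e%:M) = 0.
  move=> gv nZ /joC; rewrite jo_oute // => -[//|[E|[_ ->]]]; last by left.
  by right; rewrite mulmxBr E mul_mx_scalar subrr.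
have e0 := sgn_neq0 ee.
have [|B [<-|[<-|[<-|[<-|[]//]]]] B0] := @cover_row K n [:: C; C - e%:M; D; D - e%:M] v v0.
- move=> g gv; have : jo (e *: (v *m g)) (th (1 *: (u *m f))).
    by apply/joC; apply/jo_oute => //; left; rewrite T1E.
  case/(jo_T3 H (sgn1 K) fu) => [|h|h].
  + move=> /joC; rewrite jo_oute // A'v => -[/eqP|[E|[/eqP + _]]].
    * rewrite -subr_eq0 -scalerBl scaler_eq0 (negPf v0) orbF subr_eq0 eq_sym.
      by rewrite (negPf (sgn_neqN ee)).
    * have := congr1 (fun z => dt z v) E; rewrite /= dtA A'v !dtL gv !mulr1 => /eqP.
      by rewrite eq_sym (negPf (sgn_neqN ee)).
    by rewrite scaler_eq0 (negPf v0) oppr_eq0 (negPf e0).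
  + have := h _ f1u; rewrite T1E => /(side _ _ gv nf1)[E|E].
      by exists C => //; left.
    by exists (C - e%:M) => //; right; left.
  have := h _ fu1; rewrite T1E => /(side _ _ gv nu1)[E|E].
    by exists D => //; right; right; left.
  by exists (D - e%:M) => //; right; right; right; left.
- by have := th_neq0 H f1u; rewrite -/C B0 eqxx.
- by apply: nf1; move/eqP: B0; rewrite subr_eq0 => /eqP ->; rewrite mul_scalar_mx.
- by have := th_neq0 H fu1; rewrite -/D B0 eqxx.
by apply: nu1; move/eqP: B0; rewrite subr_eq0 => /eqP ->; rewrite mul_scalar_mx.
Qed.

Lemma typeL psi th e g u f : rep psi th -> e * e = 1 -> g != 0 -> dt f u = 1 ->
  g *m th (u *m f) = e *: g -> Rl th e g u \/ Cl th e g f.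
Proof.
move=> H ee g0 fu E; have := @typeR _ _ e g^T u f (rep_tdr H) ee.
rewrite trmx_neq0 Rr_tdr Cr_tdr; apply=> //.
by rewrite /tdr -trmx_mul E linearZ.
Qed.

(** Orthogonal idempotents are related whatever their signs. The sign s is chosen so that the second
    preimage has eigenvalue -e on v; the Jordan product then has eigenvalue -1, impossible for an
    idempotent. *)
Lemma orthR psi th e e' v u f u' f' : rep psi th -> e * e = 1 -> e' * e' = 1 ->
  dt f u = 1 -> dt f' u' = 1 -> dt f u' = 0 -> dt f' u = 0 ->
  th (u *m f) *m v = e *: v -> th (u' *m f') *m v = e' *: v -> v = 0.
Proof.
move=> H ee ee' fu fu' f0 f'0 Av Bv; pose s := - (e * e').
have ss : s * s = 1 by rewrite /s mulrNN mulrACA ee ee' mulr1.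
have Cv : th (s *: (u' *m f')) *m v = - e *: v.
  apply/(T_eig v H ss (sgnN ee) fu'); rewrite Bv; congr (_ *: _).
  by rewrite /s mulrNN mulrAC ee mul1r.
have : jo (th (u *m f)) (th (s *: (u' *m f'))).
  apply/(jo_T H _ ss fu'); right; right.
  by rewrite -T1E (rep_th H (sgn1 K) fu) scale1r outv f0 outg f'0 !scale0r.
rewrite /jo /idempotent_mx; set M := jp _ _ => MM.
have Mv : M *m v = - v.
  rewrite /M /jp -scalemxAl mulmxDl -!mulmxA Av Cv -!scalemxAr Av Cv !scalerA.
  by rewrite mulNr mulrN ee; mxl; field.
have : v = - v by rewrite -[RHS]Mv -MM -mulmxA Mv mulmxN Mv opprK.
move/eqP; rewrite -subr_eq0 opprK -mulr2n -scaler_nat scaler_eq0 (negPf (two0 K)) /=.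
by move/eqP.
Qed.

Lemma RrZ th e v u c : c != 0 -> Rr th e v u -> Rr th e v (c *: u).
Proof.
move=> c0 h f; rewrite dtZr => fu; have := h (c *: f); rewrite dtZl => /(_ fu).
by rewrite -scalemxAr scalemxAl.
Qed.
Lemma RrZv th e v u c : Rr th e v u -> Rr th e (c *: v) u.
Proof. by move=> h f fu; rewrite -scalemxAr h // !scalerA mulrC. Qed.
Lemma RlZ th e g u c : c != 0 -> Rl th e g u -> Rl th e g (c *: u).
Proof. by move=> c0 /Rr_tdr h; apply/Rr_tdr/RrZ. Qed.
Lemma RlZv th e g u c : Rl th e g u -> Rl th e (c *: g) u.
Proof. by move=> /Rr_tdr h; apply/Rr_tdr; rewrite linearZ; apply: RrZv. Qed.
Lemma CrZ th e v f c : c != 0 -> Cr th e v f -> Cr th e v (c *: f).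
Proof. by move=> c0 /Rr_ttr h; apply/Rr_ttr; rewrite linearZ; apply: RrZ. Qed.
Lemma ClZ th e g f c : c != 0 -> Cl th e g f -> Cl th e g (c *: f).
Proof. by move=> c0 /Cr_tdr h; apply/Cr_tdr/CrZ. Qed.
Lemma CrZv th e v f c : Cr th e v f -> Cr th e (c *: v) f.
Proof. by move=> /Rr_ttr h; apply/Rr_ttr; apply: RrZv. Qed.
Lemma ClZv th e g f c : Cl th e g f -> Cl th e (c *: g) f.
Proof. by move=> /Cr_tdr h; apply/Cr_tdr; rewrite linearZ; apply: CrZv. Qed.

(** Two different column lines extend to orthogonal idempotents, against [orthR]. *)
Lemma Rr_uniq psi th e e' v u u' : rep psi th -> e * e = 1 -> e' * e' = 1 -> v != 0 ->
  u != 0 -> u' != 0 -> Rr th e v u -> Rr th e' v u' -> e = e' /\ exists c, u' = c *: u.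
Proof.
move=> H ee ee' v0 u0 u'0 h h'.
have [c cE] : exists c, u' = c *: u.
  apply: contrapT => N; have [f [fu fu']] := ex_dual2 1 0 u0 N.
  have [f' [f'u f'u']] := ex_dual2 0 1 u0 N.
  by move/eqP: v0; apply; apply: (orthR H ee ee' fu f'u' fu' f'u (h _ fu) (h' _ f'u')).
split; last by exists c.
have c0 : c != 0 by apply: contra u'0 => /eqP c0; rewrite cE c0 scale0r.
have [f fu] := ex_dual u0; apply: (eig_sgn_uniq v0); rewrite -(h _ fu).
have fu' : dt (c^-1 *: f) u' = 1 by rewrite cE dtZl dtZr fu mulr1 mulVf.
by rewrite -(h' _ fu') cE -scalemxAl -scalemxAr scalerA mulfV // scale1r.
Qed.

Lemma Cr_uniq psi th e e' v f f' : rep psi th -> e * e = 1 -> e' * e' = 1 -> v != 0 ->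
  f != 0 -> f' != 0 -> Cr th e v f -> Cr th e' v f' -> e = e' /\ exists c, f' = c *: f.
Proof.
move=> H ee ee' v0 u0 u'0 h h'.
have [||||p [c E]] := @Rr_uniq _ _ e e' v f^T f'^T (rep_ttr H) ee ee' v0; rewrite ?trmx_neq0 //.
- exact/Rr_ttr.
- exact/Rr_ttr.
by split=> //; exists c; apply: trmx_inj; rewrite E linearZ.
Qed.

Lemma RC psi th e e' v u f : rep psi th -> e * e = 1 -> e' * e' = 1 -> v != 0 ->
  u != 0 -> f != 0 -> Rr th e v u -> Cr th e' v f -> dt f u != 0 /\ e = e'.
Proof.
move=> H ee ee' v0 u0 f0 h h'.
have fu0 : dt f u != 0.
  apply/eqP => fu; have [u' fu'] := ex_dualr f0.
  have [|f' [f'u f'u']] := @ex_dual2 K n u u' 1 0 u0.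
    by case=> c E; move: fu'; rewrite E dtL fu mulr0 => /esym/eqP; rewrite oner_eq0.
  by move/eqP: v0; apply; apply: (orthR H ee ee' f'u fu' f'u' fu (h _ f'u) (h' _ fu')).
split=> //; apply: (eig_sgn_uniq v0).
have fu1 : dt ((dt f u)^-1 *: f) u = 1 by rewrite dtL mulVf.
rewrite -(h _ fu1); apply: (@CrZ _ _ _ _ (dt f u)^-1 _ h') => //.
by rewrite invr_eq0.
Qed.

Lemma out1_neq0 g v : dt g v = 1 -> v *m g != 0.
Proof. by move=> gv; rewrite out_neq0 ?(dt1_neq0r gv) ?(dt1_neq0l gv). Qed.

Lemma convR psi th e v u g : rep psi th -> e * e = 1 -> u != 0 -> dt g v = 1 ->
  Rr th e v u -> psi (v *m g) *m u = e *: u.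
Proof.
move=> H ee u0 gv h; apply/(row_jo H ee u0 (out1_neq0 gv)) => f fu.
apply/joC/jo_out1 => //; left; rewrite -[RHS]scale1r; apply/(T_eig v H ee (sgn1 K) fu).
by rewrite mulr1 h.
Qed.

Lemma convL psi th e v u g : rep psi th -> e * e = 1 -> u != 0 -> dt g v = 1 ->
  Rl th e g u -> psi (v *m g) *m u = e *: u.
Proof.
move=> H ee u0 gv h; apply/(row_jo H ee u0 (out1_neq0 gv)) => f fu.
apply/joC/jo_out1 => //; right; left; rewrite -[RHS]scale1r; apply/(T_eigl g H ee (sgn1 K) fu).
by rewrite mulr1 h.
Qed.

(** For each h with h w = 1, v or g is an eigenvector of [th (w *m h)]: joint annihilation would
    carry over to the opposite sign by [perp_opp]. If w is of neither R type, every such h is a C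
    type of v or g, but these lines are unique while h varies in a pencil. *)
Lemma eig_type psi th e v g w : rep psi th -> e * e = 1 -> dt g v = 1 -> w != 0 ->
  psi (v *m g) *m w = e *: w -> Rr th e v w \/ Rl th e g w.
Proof.
move=> H ee gv w0 Zw; have v0 := dt1_neq0r gv; have g0 := dt1_neq0l gv.
have e0 := sgn_neq0 ee.
have dich h : dt h w = 1 -> th (w *m h) *m v = e *: v \/ g *m th (w *m h) = e *: g.
  move=> hw; have : jo (v *m g) (th (e *: (w *m h))) by apply/(jo_T H) => //; left.
  move=> /joC; rewrite jo_out1 // => -[E|[E|[E1 E2]]].
  - by left; rewrite -[e]mulr1; apply/(T_eig v H ee (sgn1 K) hw); rewrite scale1r.
  - by right; rewrite -[e]mulr1; apply/(T_eigl g H ee (sgn1 K) hw); rewrite scale1r.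
  have : perp (th (e *: (w *m h))) (v *m g).
    by rewrite /perp mulmxA E1 -mulmxA E2 mul0mx mulmx0 addr0.
  move=> /(perp_opp H ee hw)/perp_jo/joC; rewrite (jo_T H) ?sgnN // Zw => -[/eqP|[E|[/eqP + _]]].
  - rewrite -subr_eq0 -scalerBl scaler_eq0 (negPf w0) orbF subr_eq0.
    by rewrite (negPf (sgn_neqN ee)).
  - have := congr1 (fun z => dt z w) E; rewrite /= dtA Zw !dtL hw !mulr1 => /eqP.
    by rewrite (negPf (sgn_neqN ee)).
  by rewrite scaler_eq0 (negPf w0) (negPf e0).
apply: contrapT => N.
have toC h : dt h w = 1 -> Cr th e v h \/ Cl th e g h.
  move=> hw; case: (dich h hw) => E.
    by case: (typeR H ee v0 hw E) => [R|]; [case: N; left|left].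
  by case: (typeL H ee g0 hw E) => [R|]; [case: N; right|right].
have [h0 h0w] := ex_dual w0; have [d d0 dw] := ex_kerl1 w (ltnW n3).
have hw t : dt (h0 + t *: d) w = 1 by rewrite !dtL h0w dw mulr0 addr0.
have par t t' c : (h0 + t' *: d) = c *: (h0 + t *: d) -> t = t'.
  move=> E; have := congr1 (fun z => dt z w) E; rewrite /= hw dtZl hw mulr1 => c1.
  move: E; rewrite -c1 scale1r => /addrI/eqP; rewrite -subr_eq0 -scalerBl scaler_eq0 (negPf d0) orbF subr_eq0.
  by move/eqP.
have [|t [t0 Ht]] := @good_scalar K [:: (fun t => Cr th e v (h0 + t *: d)); (fun t => Cl th e g (h0 + t *: d))].
  move=> Q [<-|[<-|[]//]] t t' Q1 Q2.
    by have [_ [c /par]] := Cr_uniq H ee ee v0 (dt1_neq0l (hw t)) (dt1_neq0l (hw t')) Q1 Q2.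
  move/Cr_tdr: Q1 => Q1; move/Cr_tdr: Q2 => Q2.
  have g0' : g^T != 0 by rewrite trmx_neq0.
  by have [_ [c /par]] := Cr_uniq (rep_tdr H) ee ee g0' (dt1_neq0l (hw t)) (dt1_neq0l (hw t')) Q1 Q2.
case: (toC _ (hw t)) => Q.
  by apply: (Ht (fun t => Cr th e v (h0 + t *: d))) => //; left.
by apply: (Ht (fun t => Cl th e g (h0 + t *: d))) => //; right; left.
Qed.

Lemma eig_typeC psi th e v g f : rep psi th -> e * e = 1 -> dt g v = 1 -> f != 0 ->
  f *m psi (v *m g) = e *: f -> Cr th e v f \/ Cl th e g f.
Proof.
move=> H ee gv f0 E; have [||R|R] := @eig_type _ _ e v g f^T (rep_ttr H) ee gv.
- by rewrite trmx_neq0.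
- by rewrite -trmx_mul E linearZ.
- by left; apply/Rr_ttr.
by right; apply/Rl_ttr.
Qed.

(* The spectral projection of [Z] for the eigenvalue [e] when [e * e = 1] and [jo Z Z]. *)
Definition pe Z e := 2^-1 *: (Z *m Z + e *: cub Z).
Lemma peZ Z e : e * e = 1 -> jo Z Z -> pe Z e *m Z = e *: pe Z e.
Proof.
move=> ee SZ; rewrite /pe -scalemxAl mulmxDl -scalemxAl (S_A1A SZ) -/(cub Z).
by rewrite [RHS]scalerA [e * _]mulrC -[RHS]scalerA [e *: (_ + _)]scalerDr scalerA ee scale1r addrC.
Qed.
Lemma Zpe Z e : e * e = 1 -> jo Z Z -> Z *m pe Z e = e *: pe Z e.
Proof.
move=> ee SZ; rewrite /pe -scalemxAr mulmxDr -scalemxAr (S_AA1 SZ) mulmxA -/(cub Z).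
by rewrite [RHS]scalerA [e * _]mulrC -[RHS]scalerA [e *: (_ + _)]scalerDr scalerA ee scale1r addrC.
Qed.
Lemma peu Z e v : e * e = 1 -> Z *m v = e *: v -> pe Z e *m v = v.
Proof.
move=> ee Zv; rewrite /pe -scalemxAl mulmxDl -scalemxAl (cub_eig ee Zv) -mulmxA Zv -scalemxAr Zv.
by rewrite !scalerA ee; mxl; field.
Qed.
Lemma gpe Z e g : e * e = 1 -> g *m Z = e *: g -> g *m pe Z e = g.
Proof.
move=> ee gZ; have gZ2 : g *m (Z *m Z) = g by rewrite mulmxA gZ -scalemxAl gZ scalerA ee scale1r.
rewrite /pe -scalemxAr mulmxDr gZ2 -scalemxAr /cub mulmxA gZ2 gZ scalerA ee.
by mxl; field.
Qed.

(** Compose a dual functional of u with the spectral projection, which fixes u. *)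
Lemma left_partner Z e u : e * e = 1 -> jo Z Z -> u != 0 -> Z *m u = e *: u ->
  exists2 f, dt f u = 1 & f *m Z = e *: f.
Proof.
move=> ee SZ u0 Zu; have [k ku] := ex_dual u0; exists (k *m pe Z e).
  by rewrite dtA (peu ee Zu).
by rewrite -mulmxA (peZ ee SZ) -scalemxAr.
Qed.

Lemma jo_psi_out psi th v g : rep psi th -> dt g v = 1 -> jo (psi (v *m g)) (psi (v *m g)).
Proof. by move=> H gv; apply/(rep_jo H (v *m g) (v *m g)); apply/(jo_out1 _ gv); left; rewrite outv gv scale1r. Qed.

Lemma partner psi th e v u g : rep psi th -> e * e = 1 -> u != 0 -> dt g v = 1 ->
  Rr th e v u \/ Rl th e g u -> exists2 f, dt f u = 1 & Cr th e v f \/ Cl th e g f.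
Proof.
move=> H ee u0 gv h; have Zu : psi (v *m g) *m u = e *: u.
  by case: h => h; [apply: (convR H)|apply: (convL H)].
have [f fu fZ] := left_partner ee (jo_psi_out H gv) u0 Zu.
by exists f => //; apply: (eig_typeC H ee gv (dt1_neq0l fu) fZ).
Qed.

(** Both u and u' are eigenvectors of [psi (v *m g)] (g rescaled), hence so is u + u'. By [eig_type]
    that sum is a type of v or of g, against uniqueness if the lines differ. *)
Lemma R_same psi th e v u g u' : rep psi th -> e * e = 1 -> u != 0 -> u' != 0 -> dt g v != 0 ->
  Rr th e v u -> Rl th e g u' -> exists c, u' = c *: u.
Proof.
move=> H ee u0 u'0 gv0 h h'; apply: contrapT => N.
set g1 := (dt g v)^-1 *: g; have gv : dt g1 v = 1 by rewrite dtL mulVf.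
have h1 : Rl th e g1 u' by apply: RlZv.
have v0 := dt1_neq0r gv; have g0 := dt1_neq0l gv.
have w0 : u + u' != 0.
  by apply/eqP => /eqP; rewrite addrC addr_eq0 => /eqP E; apply: N; exists (-1); rewrite scaleN1r.
have [|R|R] := @eig_type _ _ e v g1 (u + u') H ee gv w0.
- by rewrite mulmxDr (convR H ee u0 gv h) (convL H ee u'0 gv h1) scalerDr.
- have [_ [c E]] := Rr_uniq H ee ee v0 u0 w0 h R; apply: N; exists (c - 1).
  by rewrite scalerBl scale1r -E addrAC subrr add0r.
move/Rr_tdr: R => R; move/Rr_tdr: h1 => h1.
have g0T : g1^T != 0 by rewrite trmx_neq0.
have [_ [c E]] := Rr_uniq (rep_tdr H) ee ee g0T u'0 w0 h1 R.
have c1 : c - 1 != 0.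
  apply/eqP => c1; case/eqP: u0; apply: (addIr u'); rewrite E add0r.
  by rewrite -[c](subrK 1) c1 add0r scale1r.
apply: N; exists (c - 1)^-1; have -> : u = (c - 1) *: u' by rewrite scalerBl scale1r -E addrK.
by rewrite scalerA mulVf // scale1r.
Qed.

Lemma C_same psi th e v f g f' : rep psi th -> e * e = 1 -> f != 0 -> f' != 0 -> dt g v != 0 ->
  Cr th e v f -> Cl th e g f' -> exists c, f' = c *: f.
Proof.
move=> H ee f0 f'0 gv h h'.
have [||||c E] := @R_same _ _ e v f^T g f'^T (rep_ttr H) ee _ _ gv; rewrite ?trmx_neq0 //.
- exact/Rr_ttr.
- exact/Rl_ttr.
by exists c; apply: trmx_inj; rewrite E linearZ.
Qed.

Lemma eigvec psi th u f : rep psi th -> dt f u = 1 ->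
  exists e v, [/\ e * e = 1, v != 0 & th (u *m f) *m v = e *: v].
Proof.
move=> H fu; have [] := opp_structure H (sgn1 K) fu; have SA := jo_TT H (sgn1 K) fu.
rewrite !T1E in SA *; set A := th _ in SA * => E0 _.
have [v Ev] := mx_neq0v E0.
have ex e : e * e = 1 -> pe A e *m v != 0 -> exists e v, [/\ e * e = 1, v != 0 & A *m v = e *: v].
  by move=> ee p0; exists e, (pe A e *m v); split=> //; rewrite mulmxA Zpe // -scalemxAl.
have [p1|/ex] := eqVneq (pe A 1 *m v) 0; last by apply; apply: sgn1.
have [p2|/ex] := eqVneq (pe A (-1) *m v) 0; last by apply; rewrite mulrNN mulr1.
case/eqP: Ev; transitivity (pe A 1 *m v + pe A (-1) *m v); last by rewrite p1 p2 addr0.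
by rewrite -mulmxDl /pe; congr (_ *m v); mxl; field.
Qed.

End Types.

(** * Uniformity of the types: one alternative for all columns and rows *)

Section World.
Variables (K : numClosedFieldType) (n : nat).
Implicit Types (X Y Z A B C D : 'M[K]_n) (u v w x y : 'cV[K]_n) (f g h k : 'rV[K]_n) (a b c e : K)
  (psi th : 'M[K]_n -> 'M[K]_n).
Hypothesis n3 : (2 < n)%N.

Lemma n_gt0 : (0 < n)%N. Proof. exact: leq_trans n3. Qed.

Lemma ex_cV : exists v, v != 0.
Proof. by have [v v0 _] := @ex_ker1 K n 0 (ltnW n3); exists v. Qed.
Lemma ex_rV : exists g, g != 0.
Proof. by have [g g0 _] := @ex_kerl1 K n 0 (ltnW n3); exists g. Qed.

Lemma avoid_rowm (s : seq 'cV[K]_n) (t : seq 'M[K]_n) : (forall v, List.In v s -> v != 0) ->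
  (forall Z, List.In Z t -> Z != 0) ->
  exists g, (forall v, List.In v s -> dt g v != 0) /\ (forall Z, List.In Z t -> g *m Z != 0).
Proof.
move=> Hs Ht; have [h h0] := ex_rV.
have [|Z /List.in_app_iff[/Ht//|/List.in_map_iff[v [<- /Hs v0]]]|g Hg] :=
  @avoid_row K n (t ++ [seq v *m h | v <- s]).
- exact: n_gt0.
- exact: out_neq0.
exists g; split=> [v vs|Z Zt]; last by apply: Hg; apply: List.in_or_app; left.
have : g *m (v *m h) != 0.
  by apply: Hg; apply: List.in_or_app; right; apply: (List.in_map (fun v => v *m h)).
by rewrite outg scaler_eq0 negb_or => /andP[].
Qed.

Lemma avoid_colm (s : seq 'rV[K]_n) (t : seq 'M[K]_n) : (forall g, List.In g s -> g != 0) ->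
  (forall Z, List.In Z t -> Z != 0) ->
  exists v, (forall g, List.In g s -> dt g v != 0) /\ (forall Z, List.In Z t -> Z *m v != 0).
Proof.
move=> Hs Ht.
have [v /List.in_map_iff[g [<- gs]]|Z /List.in_map_iff[Y [<- Yt]]|h [h1 h2]] :=
  @avoid_rowm [seq g^T | g <- s] [seq Z^T | Z <- t].
- by rewrite trmx_neq0 Hs.
- by rewrite trmx_neq0 Ht.
exists h^T; split=> [g gs|Z Zt].
  by rewrite -dtT trmxK; apply: h1; apply: (List.in_map trmx).
by rewrite -trmx_neq0 trmx_mul trmxK; apply: h2; apply: (List.in_map trmx).
Qed.

Lemma scal_row (s : seq 'cV[K]_n) Z a : (forall v, List.In v s -> v != 0) ->
  (forall g, (forall v, List.In v s -> dt g v != 0) -> g *m Z = a *: g) -> Z = a%:M.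
Proof.
move=> s0 h; apply/eqP; rewrite -subr_eq0; apply: contraT => Z0.
have [//|Y [<-|[]]//|g [gs gZ]] := @avoid_rowm s [:: Z - a%:M].
have := gZ _ (or_introl erefl).
by rewrite mulmxBr h // mul_mx_scalar subrr eqxx.
Qed.

Lemma scal_col (s : seq 'rV[K]_n) Z a : (forall g, List.In g s -> g != 0) ->
  (forall v, (forall g, List.In g s -> dt g v != 0) -> Z *m v = a *: v) -> Z = a%:M.
Proof.
move=> s0 h; apply/eqP; rewrite -subr_eq0; apply: contraT => Z0.
have [//|Y [<-|[]]//|g [gs gZ]] := @avoid_colm s [:: Z - a%:M].
have := gZ _ (or_introl erefl).
by rewrite mulmxBl h // mul_scalar_mx subrr eqxx.
Qed.

(** [th] is injective on signed rank-one idempotents, so it cannot be constant while f varies. *)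
Lemma th_scalR psi th a u : rep psi th -> u != 0 ->
  (forall f, dt f u = 1 -> th (u *m f) = a%:M) -> False.
Proof.
move=> H u0 h; have [f fu] := ex_dual u0; have [d d0 du] := ex_kerl1 u (ltnW n3).
have fu' : dt (f + d) u = 1 by rewrite dtDl du addr0.
have := @th_injf K n psi th H 1 u f (f + d) (sgn1 K) fu fu'.
rewrite !T1E !h // => /(_ erefl)/eqP; rewrite -subr_eq0 opprD addNKr oppr_eq0.
by rewrite (negPf d0).
Qed.

Lemma th_scalC psi th a f : rep psi th -> f != 0 ->
  (forall u, dt f u = 1 -> th (u *m f) = a%:M) -> False.
Proof.
move=> H f0 h; apply: (@th_scalR _ _ a f^T (rep_ttr H)); rewrite ?trmx_neq0 // => u fu.
rewrite /ttr trmx_mul trmxK; apply: h.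
by rewrite -dtT trmxK.
Qed.

Section Half.
Variables (psi th : 'M[K]_n -> 'M[K]_n) (a : K).
Hypotheses (H : rep psi th) (aa : a * a = 1).

(** The [partner] of u must be a type of g, as v has no column type. Then [RC] fixes the sign of any
    R type of g and [R_same] fixes its line. *)
Lemma half1 v u g : v != 0 -> u != 0 -> Rr th a v u ->
  (forall b f, b * b = 1 -> f != 0 -> ~ Cr th b v f) -> dt g v != 0 ->
  (exists2 f, f != 0 & Cl th a g f) /\
  (forall b u', b * b = 1 -> u' != 0 -> Rl th b g u' -> b = a /\ exists c, u' = c *: u).
Proof.
move=> v0 u0 R nC gv; have g0 : g != 0 by apply: contra gv => /eqP ->; rewrite dt0l.
have [f f0 Cf] : exists2 f, f != 0 & Cl th a g f.
  have gv1 : dt ((dt g v)^-1 *: g) v = 1 by rewrite dtZl mulVf.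
  have [f fu [Cf|Cf]] := partner n3 H aa u0 gv1 (or_introl R).
    by case: (nC a f aa (dt1_neq0l fu) Cf).
  exists f; first exact: dt1_neq0l fu.
  have -> : g = dt g v *: ((dt g v)^-1 *: g) by rewrite scalerA mulfV // scale1r.
  exact: ClZv.
split=> [|b u' bb u'0 Ru']; first by exists f.
have g0T : g^T != 0 by rewrite trmx_neq0.
have [_ ba] : dt f u' != 0 /\ b = a.
  by apply: (RC n3 (rep_tdr H) bb aa g0T u'0 f0); [apply/Rr_tdr|apply/Cr_tdr].
by split=> //; subst b; apply: (R_same n3 H aa u0 u'0 gv R Ru').
Qed.

(** Otherwise, by [half1], every g not killing v is a left eigenvector of all [th (u *m f)], making
    them scalar. *)
Lemma half2 v u : v != 0 -> u != 0 -> Rr th a v u ->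
  (forall b f, b * b = 1 -> f != 0 -> ~ Cr th b v f) ->
  exists2 g, dt g v != 0 & forall b u', b * b = 1 -> u' != 0 -> ~ Rl th b g u'.
Proof.
move=> v0 u0 R nC; apply: contrapT => N.
have Ra g : dt g v != 0 -> Rl th a g u.
  move=> gv; apply: contrapT => nR; apply: N; exists g => // b u' bb u'0 Ru'.
  have [_ /(_ b u' bb u'0 Ru')[ba [c E]]] := half1 v0 u0 R nC gv.
  have c0 : c != 0 by apply: contra u'0 => /eqP c0; rewrite E c0 scale0r.
  apply: nR; subst b; move/(RlZ (c := c^-1)): Ru'; rewrite invr_eq0 E scalerA mulVf //.
  by rewrite scale1r; apply.
apply: (th_scalR (a := a) H u0) => f fu; apply: (@scal_row [:: v]) => [? [<-|[]]//|g gv].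
by apply: Ra => //; apply: gv; left.
Qed.
End Half.

Lemma rep_tt psi th : rep psi th -> rep (fun X => (psi X^T)^T) (ttr (tdr th)).
Proof. by move=> H; apply: rep_ttr (rep_tdr H). Qed.
Lemma Rr_tt th e g f : Rr (ttr (tdr th)) e g^T f^T <-> Cl th e g f.
Proof. by rewrite Rr_ttr Cr_tdr. Qed.
Lemma Cr_tt th e g u : Cr (ttr (tdr th)) e g^T u^T <-> Rl th e g u.
Proof. by rewrite Cr_ttr Rr_tdr. Qed.
Lemma Rl_tt th e v f : Rl (ttr (tdr th)) e v^T f^T <-> Cr th e v f.
Proof. by rewrite Rl_ttr Cl_tdr. Qed.
Lemma Cl_tt th e v u : Cl (ttr (tdr th)) e v^T u^T <-> Rr th e v u.
Proof. by rewrite Cl_ttr Rl_tdr. Qed.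

Lemma half1d psi th a g f v : rep psi th -> a * a = 1 -> g != 0 -> f != 0 -> Cl th a g f ->
  (forall b u, b * b = 1 -> u != 0 -> ~ Rl th b g u) -> dt g v != 0 ->
  (exists2 u, u != 0 & Rr th a v u) /\
  (forall b f', b * b = 1 -> f' != 0 -> Cr th b v f' -> b = a /\ exists c, f' = c *: f).
Proof.
move=> H aa g0 f0 Cf nR gv.
have [|||||[u u0 Ru] h2] := @half1 _ _ a (rep_tt H) aa g^T f^T v^T; rewrite ?trmx_neq0 ?dtT //.
- exact/Rr_tt.
- by move=> b u bb u0; rewrite -[u]trmxK => /Cr_tt; apply: nR; rewrite // trmx_neq0.
split=> [|b f' bb f'0 Cf'].
  by exists u^T; rewrite ?trmx_neq0 //; apply/Cl_tt; rewrite trmxK.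
have [||-> [c E]] := h2 b f'^T bb; rewrite ?trmx_neq0 //.
  by apply/Rl_tt.
by split=> //; exists c; apply: trmx_inj; rewrite E linearZ.
Qed.

(** Purity spreads from v1 to one functional g0, from g0 to every v it does not kill, and from a v
    generic for g0 and g to an arbitrary g. A vector or functional of mixed type would make [th]
    scalar along a column or a row. *)
Lemma half psi th a v1 u1 : rep psi th -> a * a = 1 -> v1 != 0 -> u1 != 0 -> Rr th a v1 u1 ->
  (forall b f, b * b = 1 -> f != 0 -> ~ Cr th b v1 f) ->
  forall g, g != 0 -> (exists2 f, f != 0 & Cl th a g f) /\
     (forall b u, b * b = 1 -> u != 0 -> ~ Rl th b g u).
Proof.
move=> H aa v10 u10 R1 nC1.
have [g0 g0v1 nR0] := half2 H aa v10 u10 R1 nC1.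
have [[f0 f00 C0] _] := half1 H aa v10 u10 R1 nC1 g0v1.
have g00 : g0 != 0 by apply: contra g0v1 => /eqP ->; rewrite dt0l.
have s3 v : dt g0 v != 0 -> _ := @half1d _ _ a g0 f0 v H aa g00 f00 C0 nR0.
have s4 v : dt g0 v != 0 -> forall b f, b * b = 1 -> f != 0 -> ~ Cr th b v f.
  move=> g0v b f bb f'0 Cf; have [_ /(_ b f bb f'0 Cf)[ba [c E]]] := s3 v g0v.
  have v0 : v != 0 by apply: contra g0v => /eqP ->; rewrite dt0r.
  subst b; apply: (th_scalC (a := a) H f'0) => u fu.
  apply: (@scal_row [:: v1; v]) => [? [<-|[<-|[]]]//|g gs].
  have gv1 : dt g v1 != 0 by apply: gs; left.
  have gv : dt g v != 0 by apply: gs; right; left.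
  have [[f2 f20 C2] _] := half1 H aa v10 u10 R1 nC1 gv1.
  have [d E2] := C_same n3 H aa f'0 f20 gv Cf C2.
  have d0 : d != 0 by apply: contra f20 => /eqP d0; rewrite E2 d0 scale0r.
  have : Cl th a g f.
    move/(ClZ (c := d^-1)): C2; rewrite invr_eq0 E2 scalerA mulVf //.
    by rewrite scale1r; apply.
  exact.
move=> g g'0; split.
  have [|//|v [vs _]] := @avoid_colm [:: g0; g] [::]; first by move=> ? [<-|[<-|[]]].
  have g0v : dt g0 v != 0 by apply: vs; left.
  have gv : dt g v != 0 by apply: vs; right; left.
  have v0 : v != 0 by apply: contra g0v => /eqP ->; rewrite dt0r.
  have [[u u0 Ru] _] := s3 v g0v.
  by have [] := half1 H aa v0 u0 Ru (s4 v g0v) gv.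
move=> b u' bb u'0 Ru'; apply: (th_scalR (a := a) H u'0) => f fu.
apply: (@scal_col [:: g0; g]) => [? [<-|[<-|[]]]//|v vs].
have g0v : dt g0 v != 0 by apply: vs; left.
have gv : dt g v != 0 by apply: vs; right; left.
have v0 : v != 0 by apply: contra g0v => /eqP ->; rewrite dt0r.
have [[u u0 Ru] _] := s3 v g0v.
have [_ /(_ _ _ bb u'0 Ru')[_ [c E]]] := half1 H aa v0 u0 Ru (s4 v g0v) gv.
have c0 : c != 0 by apply: contra u'0 => /eqP c0; rewrite E c0 scale0r.
have : Rr th a v u' by rewrite E; apply: RrZ.
exact.
Qed.

(** The normal situation: right eigenvectors arise from columns only and left eigenvectors from rows
    only. The identity map is a model with a = 1. *)
Record world th a : Prop := World {
  wR : forall v, v != 0 -> exists2 u, u != 0 & Rr th a v u;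
  wL : forall g, g != 0 -> exists2 f, f != 0 & Cl th a g f;
  wnC : forall b v f, b * b = 1 -> v != 0 -> f != 0 -> ~ Cr th b v f;
  wnR : forall b g u, b * b = 1 -> g != 0 -> u != 0 -> ~ Rl th b g u }.

Lemma worldP psi th a v1 u1 : rep psi th -> a * a = 1 -> v1 != 0 -> u1 != 0 -> Rr th a v1 u1 ->
  (forall b f, b * b = 1 -> f != 0 -> ~ Cr th b v1 f) -> world th a.
Proof.
move=> H aa v10 u10 R1 nC1; have hg := half H aa v10 u10 R1 nC1.
have [g g0] := ex_rV; have [[f f0 Cf] nR] := hg g g0.
have hv v : v != 0 -> (exists2 u, u != 0 & Rr th a v u) /\
     (forall b f, b * b = 1 -> f != 0 -> ~ Cr th b v f).
  move=> v0.
  have [|||b u bb u0||[u u0 Ru] h2] := @half _ _ a g^T f^T (rep_tt H) aa _ _ _ _ v^T; rewrite ?trmx_neq0 //.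
  - exact/Rr_tt.
  - by rewrite -[u]trmxK => /Cr_tt; apply: nR; rewrite // trmx_neq0.
  split; first by exists u^T; rewrite ?trmx_neq0 //; apply/Cl_tt; rewrite trmxK.
  by move=> b f' bb f'0 /Rl_tt; apply: h2; rewrite // trmx_neq0.
split.
- by move=> v /hv[].
- by move=> ? /hg[].
- by move=> b v f' bb /hv[_ h] f'0; apply: h.
by move=> b ? u bb /hg[_ h] u0; apply: h.
Qed.

(* The remaining case: every typed vector carries both a row line and a column line,
   and then three idempotents in general position would have eigenvectors with
   pairwise distinct signs. *)
Section BothTypes.
Variables (psi th : 'M[K]_n -> 'M[K]_n).
Hypothesis H : rep psi th.
Hypothesis hRC : forall v, v != 0 ->
  (exists a u, [/\ a * a = 1, u != 0 & Rr th a v u]) <-> (exists a f, [/\ a * a = 1, f != 0 & Cr th a v f]).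
Hypothesis hLC : forall g, g != 0 ->
  (exists a u, [/\ a * a = 1, u != 0 & Rl th a g u]) <-> (exists a f, [/\ a * a = 1, f != 0 & Cl th a g f]).

Lemma bothV a v u f : a * a = 1 -> v != 0 -> dt f u = 1 -> th (u *m f) *m v = a *: v ->
  exists u1 f1, [/\ u1 != 0, f1 != 0, Rr th a v u1, Cr th a v f1 &
     (exists c, u1 = c *: u) \/ (exists c, f1 = c *: f)].
Proof.
move=> aa v0 fu Av; have u0 := dt1_neq0r fu; have f0 := dt1_neq0l fu.
case: (typeR n3 H aa v0 fu Av) => T.
  have [|b [f1 [bb f10 C1]]] := (hRC v0).1; first by exists a, u.
  have [_ ba] := RC n3 H aa bb v0 u0 f10 T C1; subst b.
  by exists u, f1; split=> //; left; exists 1; rewrite scale1r.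
have [|b [u1 [bb u10 C1]]] := (hRC v0).2; first by exists a, f.
have [_ ba] := RC n3 H bb aa v0 u10 f0 C1 T; subst b.
by exists u1, f; split=> //; right; exists 1; rewrite scale1r.
Qed.

Lemma bothG a g u f : a * a = 1 -> g != 0 -> dt f u = 1 -> g *m th (u *m f) = a *: g ->
  exists u1 f1, [/\ u1 != 0, f1 != 0, Rl th a g u1 & Cl th a g f1].
Proof.
move=> aa v0 fu Av; have u0 := dt1_neq0r fu; have f0 := dt1_neq0l fu.
have g0T : g^T != 0 by rewrite trmx_neq0.
case: (typeL n3 H aa v0 fu Av) => T.
  have [|b [f1 [bb f10 C1]]] := (hLC v0).1; first by exists a, u.
  have [_ ba] : dt f1 u != 0 /\ a = b.
    by apply: (RC n3 (rep_tdr H) aa bb g0T u0 f10); [apply/Rr_tdr|apply/Cr_tdr].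
  by subst b; exists u, f1.
have [|b [u1 [bb u10 C1]]] := (hLC v0).2; first by exists a, f.
have [_ ba] : dt f u1 != 0 /\ b = a.
  by apply: (RC n3 (rep_tdr H) bb aa g0T u10 f0); [apply/Rr_tdr|apply/Cr_tdr].
by subst b; exists u1, f.
Qed.

(** A left eigenvector g of the same matrix, not killing v1 or v2, carries both a row and a column
    line; by [R_same] and [C_same] these are the lines of v1 and of v2. *)
Lemma same_lines a u f v1 v2 u1 f1 u2 f2 : a * a = 1 -> dt f u = 1 ->
  v1 != 0 -> v2 != 0 -> u1 != 0 -> f1 != 0 -> u2 != 0 -> f2 != 0 ->
  th (u *m f) *m v1 = a *: v1 -> th (u *m f) *m v2 = a *: v2 ->
  Rr th a v1 u1 -> Cr th a v1 f1 -> Rr th a v2 u2 -> Cr th a v2 f2 ->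
  (exists2 c, c != 0 & u2 = c *: u1) /\ (exists2 c, c != 0 & f2 = c *: f1).
Proof.
move=> aa fu v10 v20 u10 f10 u20 f20 A1 A2 R1 C1 R2 C2.
have SA : jo (th (u *m f)) (th (u *m f)) by have := jo_TT H (sgn1 K) fu; rewrite T1E.
have [|//|k [ks _]] := @avoid_rowm [:: v1; v2] [::]; first by move=> ? [<-|[<-|[]]].
set A := th (u *m f) in SA A1 A2; pose g := k *m pe A a.
have gv1 : dt g v1 != 0 by rewrite /g dtA (peu aa A1); apply: ks; left.
have gv2 : dt g v2 != 0 by rewrite /g dtA (peu aa A2); apply: ks; right; left.
have g0 : g != 0 by apply: contra gv1 => /eqP ->; rewrite dt0l.
have gA : g *m A = a *: g by rewrite /g -mulmxA (peZ aa SA) -scalemxAr.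
have [u' [f' [u'0 f'0 R' C']]] := bothG aa g0 fu gA.
have par m p (x y z : 'M[K]_(m, p)) : y != 0 -> z != 0 ->
    (exists c, z = c *: x) -> (exists c, z = c *: y) -> exists2 c, c != 0 & y = c *: x.
  move=> y0 z0 [c E] [d E'].
  have d0 : d != 0 by apply: contra z0 => /eqP d0; rewrite E' d0 scale0r.
  have c0 : c != 0 by apply: contra z0 => /eqP d0'; rewrite E d0' scale0r.
  exists (d^-1 * c); first by rewrite mulf_neq0 // invr_eq0.
  by rewrite -scalerA -E E' scalerA mulVf // scale1r.
split.
  apply: (par _ _ u1 u2 u') => //.
    exact: (R_same n3 H aa u10 u'0 gv1 R1 R').
  exact: (R_same n3 H aa u20 u'0 gv2 R2 R').
apply: (par _ _ f1 f2 f') => //.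
  exact: (C_same n3 H aa f10 f'0 gv1 C1 C').
exact: (C_same n3 H aa f20 f'0 gv2 C2 C').
Qed.

Definition generic u f u1 f1 :=
  [/\ dt f1 u != 0, dt f u1 != 0, ~ (exists c, u = c *: u1) & ~ (exists c, f = c *: f1)].

(** If the signs agree and v2 has the line of u, then v1 and v2 are eigenvectors over the idempotent
    built from u and f1, so [same_lines] makes u parallel to u1. The case of f is dual. *)
Lemma gen_sign a b u f v1 u1 f1 v2 : a * a = 1 -> b * b = 1 -> dt f u = 1 -> generic u f u1 f1 ->
  v1 != 0 -> u1 != 0 -> f1 != 0 -> Rr th a v1 u1 -> Cr th a v1 f1 ->
  v2 != 0 -> th (u *m f) *m v2 = b *: v2 -> b <> a.
Proof.
move=> aa bb fu [f1u fu1 nu nf] v10 u10 f10 R1 C1 v20 A2 ba; subst b.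
have [u2 [f2 [u20 f20 R2 C2 par]]] := bothV aa v20 fu A2.
have inv m p (x y : 'M[K]_(m, p)) : x != 0 -> (exists c, x = c *: y) ->
    exists2 d, d != 0 & y = d *: x.
  move=> x0 [c E]; have c0 : c != 0 by apply: contra x0 => /eqP c0; rewrite E c0 scale0r.
  by exists c^-1; rewrite ?invr_eq0 // E scalerA mulVf // scale1r.
case: par => [/(inv _ _ _ _ u20)|/(inv _ _ _ _ f20)] [c c0 E].
  have f1u2 : dt f1 u2 != 0 by move: f1u; rewrite E dtZr mulf_eq0 (negPf c0).
  pose u3 := (dt f1 u2)^-1 *: u2.
  have fu3 : dt f1 u3 = 1 by rewrite dtZr mulVf.
  have R3 : Rr th a v2 u3 by apply: RrZ => //; rewrite invr_eq0.
  have [[d d0 E2] _] := same_lines aa fu3 v10 v20 u10 f10 u20 f20 (C1 _ fu3) (R3 _ fu3) R1 C1 R2 C2.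
  by apply: nu; exists (c * d); rewrite E E2 scalerA.
have fu2 : dt f2 u1 != 0 by move: fu1; rewrite E dtZl mulf_eq0 (negPf c0).
pose f3 := (dt f2 u1)^-1 *: f2.
have fu3 : dt f3 u1 = 1 by rewrite dtZl mulVf.
have C3 : Cr th a v2 f3 by apply: CrZ => //; rewrite invr_eq0.
have [_ [d d0 E2]] := same_lines aa fu3 v10 v20 u10 f10 u20 f20 (R1 _ fu3) (C3 _ fu3) R1 C1 R2 C2.
by apply: nf; exists (c * d); rewrite E E2 scalerA.
Qed.

Lemma ex_generic u1 f1 u2 f2 : u1 != 0 -> f1 != 0 -> u2 != 0 -> f2 != 0 ->
  exists u f, [/\ dt f u = 1, generic u f u1 f1 & generic u f u2 f2].
Proof.
move=> u10 f10 u20 f20.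
have [k1 k10 k1u] := ex_kerl1 u1 (ltnW n3); have [k2 k20 k2u] := ex_kerl1 u2 (ltnW n3).
have [w1 w10 fw1] := ex_ker1 f1 (ltnW n3); have [w2 w20 fw2] := ex_ker1 f2 (ltnW n3).
have [|//|u [us _]] := @avoid_colm [:: f1; f2; k1; k2] [::].
  by move=> ? [<-|[<-|[<-|[<-|[]]]]].
have f1u : dt f1 u != 0 by apply: us; left.
have f2u : dt f2 u != 0 by apply: us; right; left.
have k1u' : dt k1 u != 0 by apply: us; right; right; left.
have k2u' : dt k2 u != 0 by apply: us; right; right; right; left.
have u0 : u != 0 by apply: contra f1u => /eqP ->; rewrite dt0r.
have [|//|f [fs _]] := @avoid_rowm [:: u; u1; u2; w1; w2] [::].
  by move=> ? [<-|[<-|[<-|[<-|[<-|[]]]]]].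
have fu : dt f u != 0 by apply: fs; left.
have fu1 : dt f u1 != 0 by apply: fs; right; left.
have fu2 : dt f u2 != 0 by apply: fs; right; right; left.
have fw1' : dt f w1 != 0 by apply: fs; right; right; right; left.
have fw2' : dt f w2 != 0 by apply: fs; right; right; right; right; left.
have i0 : (dt f u)^-1 != 0 by rewrite invr_eq0.
exists u, ((dt f u)^-1 *: f); split.
- by rewrite dtZl mulVf.
- split; rewrite // ?dtZl ?mulf_neq0 //.
    by case=> c E; move: k1u'; rewrite E dtZr k1u mulr0 eqxx.
  case=> c E; have := congr1 (fun z => dt z w1) E.
  by move/eqP; rewrite /= !dtZl fw1 mulr0 mulf_eq0 (negPf i0) (negPf fw1').
split; rewrite // ?dtZl ?mulf_neq0 //.
  by case=> c E; move: k2u'; rewrite E dtZr k2u mulr0 eqxx.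
case=> c E; have := congr1 (fun z => dt z w2) E.
by move/eqP; rewrite /= !dtZl fw2 mulr0 mulf_eq0 (negPf i0) (negPf fw2').
Qed.

Lemma both_absurd : False.
Proof.
have [w0 w00] := ex_cV; have [k0 k0w] := ex_dual w00.
have [a [v1 [aa v10 A1]]] := eigvec n3 H k0w.
have [u1 [f1 [u10 f10 R1 C1 _]]] := bothV aa v10 k0w A1.
have [u [f [fu g1 _]]] := ex_generic u10 f10 u10 f10.
have [b [v2 [bb v20 A2]]] := eigvec n3 H fu.
have ba := gen_sign aa bb fu g1 v10 u10 f10 R1 C1 v20 A2.
have [u2 [f2 [u20 f20 R2 C2 _]]] := bothV bb v20 fu A2.
have [u' [f' [fu' g1' g2']]] := ex_generic u10 f10 u20 f20.
have [c [v3 [cc v30 A3]]] := eigvec n3 H fu'.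
have ca := gen_sign aa cc fu' g1' v10 u10 f10 R1 C1 v30 A3.
have cb := gen_sign bb cc fu' g2' v20 u20 f20 R2 C2 v30 A3.
by case/sqr1P: aa ba ca => ->; case/sqr1P: bb cb => ->; case/sqr1P: cc => ->.
Qed.
End BothTypes.

(** A vector or functional with only one of the two types generates a world for [th] or for its
    transpose; if there is none, [both_absurd] applies. *)
Lemma world_or psi th : rep psi th -> exists2 a, a * a = 1 & world th a \/ world (ttr th) a.
Proof.
move=> H.
have tv v a f : a * a = 1 -> v != 0 -> f != 0 -> Cr th a v f ->
    ~ (exists b u, [/\ b * b = 1, u != 0 & Rr th b v u]) ->
    exists2 a, a * a = 1 & world th a \/ world (ttr th) a.
  move=> aa v0 f0 C N; exists a => //; right.
  apply: (@worldP _ _ a v f^T (rep_ttr H)); rewrite ?trmx_neq0 //; first exact/Rr_ttr.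
  move=> b u bb u0; rewrite -[u]trmxK => /Cr_ttr R; apply: N; exists b, u^T.
  by rewrite trmx_neq0.
apply: contrapT => NW; apply: (both_absurd H) => [v v0|g g0]; split=> -[a [x [aa x0 T]]].
- apply: contrapT => N; apply: NW; exists a => //; left.
  apply: (worldP H aa v0 x0 T) => b f bb f0 C; apply: N; exists b, f; split=> //.
- by apply: contrapT => N; apply: NW; apply: (tv v a x).
- apply: contrapT => N; apply: NW.
  have [v v0] := ex_cV.
  have [|||||[f f0 Cf] nR] := @half _ _ a g^T x (rep_tdr H) aa _ _ _ _ v^T; rewrite ?trmx_neq0 //.
  - exact/Rr_tdr.
  - by move=> b f bb f0 /Cr_tdr C; apply: N; exists b, f.
  move/Cl_tdr: Cf => Cf; apply: (tv v a f) => // -[b [u [bb u0 R]]].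
  by apply: (nR b u bb u0); apply/Rl_tdr.
apply: contrapT => N; apply: NW; have [v v0] := ex_cV.
have nR : forall b u, b * b = 1 -> u != 0 -> ~ Rl th b g u.
  by move=> b u bb u0 R; apply: N; exists b, u.
have [|||||[u u0 Ru] nC] := @half _ _ a g^T x^T (rep_tt H) aa _ _ _ _ v^T; rewrite ?trmx_neq0 //.
- exact/Rr_tt.
- by move=> b u bb u0; rewrite -[u]trmxK => /Cr_tt; apply: nR; rewrite // trmx_neq0.
exists a => //; left; apply: (@worldP _ _ a v u^T H); rewrite ?trmx_neq0 //.
  by apply/Cl_tt; rewrite trmxK.
by move=> b f bb f0 /Rl_tt; apply: nC; rewrite // trmx_neq0.
Qed.
End World.

Section Alg.
Variables (K : numClosedFieldType) (n : nat).
Implicit Types (X Y Z A B C D : 'M[K]_n) (u v w x y : 'cV[K]_n) (f g h k : 'rV[K]_n) (a b c e : K).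

(** Expand the idempotency identity as a polynomial in the two signs; averaging over the four
    choices isolates the coefficient of s. *)
Lemma four_signs (P r d : 'M[K]_n) :
  (forall s t, s * s = 1 -> t * t = 1 -> idempotent_mx (s *: P + t *: r + d)) ->
  P *m d + d *m P = P.
Proof.
move=> h; have N1 : -1 * -1 = 1 :> K by rewrite mulrNN mulr1.
have E s t : s * s = 1 -> t * t = 1 ->
    s *: (P *m d + d *m P) + t *: (r *m d + d *m r) + (s * t) *: (P *m r + r *m P)
    + (P *m P + r *m r + d *m d) = s *: P + t *: r + d.
  move=> ss tt; rewrite -(h s t ss tt) !mulmxDl !mulmxDr -!scalemxAl -!scalemxAr !scalerA ss tt.
  by mxl; ring.
apply/matrixP => i j.
have e1 := congr1 (fun Z : 'M_n => Z i j) (E 1 1 (mulr1 1) (mulr1 1)).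
have e2 := congr1 (fun Z : 'M_n => Z i j) (E 1 (-1) (mulr1 1) N1).
have e3 := congr1 (fun Z : 'M_n => Z i j) (E (-1) 1 N1 (mulr1 1)).
have e4 := congr1 (fun Z : 'M_n => Z i j) (E (-1) (-1) N1 N1).
move: e1 e2 e3 e4; rewrite /= !mxDE !mxZE !mxDE.
set a1 := (P *m d) i j; set a2 := (d *m P) i j; set a3 := (r *m d) i j; set a4 := (d *m r) i j.
set a5 := (P *m r) i j; set a6 := (r *m P) i j; set a7 := _ + _ + (d *m d) i j.
set p := P i j; set q := r i j; set z := d i j => e1 e2 e3 e4.
have : 4 * (a1 + a2) = 4 * p.
  apply: etrans (_ : _ = (1 * p + 1 * q + z) + (1 * p + -1 * q + z) - (-1 * p + 1 * q + z)
    - (-1 * p + -1 * q + z)) _; last by ring.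
  by rewrite -e1 -e2 -e3 -e4; ring.
by apply: mulfI; rewrite pnatr_eq0.
Qed.

Lemma out_jp v g Z x : jp (v *m g) Z *m x = 2^-1 *: (dt g (Z *m x) *: v + dt g x *: (Z *m v)).
Proof. by rewrite /jp -scalemxAl mulmxDl -!mulmxA !dtE !mul_mx_scalar -scalemxAr. Qed.

(** The algebra behind [shape_N0], for the preimages of two orthogonal idempotents, which are
    related for all four sign choices. Apply the identity of [four_signs] to v, then multiply by g
    and by M. *)
Lemma kill_alg v g w h (N M : 'M[K]_n) : dt g v = 1 -> N *m v = 0 -> g *m N = 0 -> N *m N = 0 ->
  M *m w = 0 -> h *m M = 0 -> M *m M = 0 -> dt g w = 0 -> dt h v = 0 ->
  (forall s t, s * s = 1 -> t * t = 1 -> jo (s *: (v *m g) + N) (t *: (w *m h) + M)) ->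
  dt g (M *m v) = 0 /\ M *m (N *m (M *m v)) = 2 *: (M *m v).
Proof.
move=> gv Nv gN NN Mw hM MM gw hv J.
pose P := jp (v *m g) M; pose r := jp N (w *m h); pose d := jp N M.
have pq : jp (v *m g) (w *m h) = 0.
  by rewrite jp_out outv gw outg hv !scale0r mul0mx mulmx0 addr0 scaler0.
have key : P *m d + d *m P = P.
  apply: (@four_signs P r d) => s t ss tt; have := J s t ss tt.
  rewrite /jo !jpDl !jpDr !jpZl !jpZr pq !scaler0 add0r.
  by rewrite -/P -/r -/d addrA.
set y := M *m v; set m := dt g y.
have My : M *m y = 0 by rewrite /y mulmxA MM mul0mx.
have gN0 z : dt g (N *m z) = 0 by rewrite -dtA gN dt0l.
have dE (z : 'cV_n) : d *m z = 2^-1 *: (N *m (M *m z) + M *m (N *m z)).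
  by rewrite /d /jp -scalemxAl mulmxDl -!mulmxA.
have PE z : P *m z = 2^-1 *: (dt g (M *m z) *: v + dt g z *: (M *m v)) := out_jp v g M z.
have Pv : P *m v = 2^-1 *: (m *: v + y) by rewrite PE gv scale1r.
set l := dt g (M *m (N *m y)).
have main : l *: v + m *: (N *m y) + M *m (N *m y) = 2 *: (m *: v + y).
  have := congr1 (mulmx^~ v) key; rewrite /= mulmxDl -!mulmxA Pv.
  rewrite (dE v) Nv mulmx0 addr0 -/y -scalemxAr PE gN0 scale0r addr0 -/l.
  have -> : d *m (2^-1 *: (m *: v + y)) = 4^-1 *: (m *: (N *m y) + M *m (N *m y)).
    have M1 : M *m (2^-1 *: (m *: v + y)) = 2^-1 *: (m *: y).
      by rewrite -scalemxAr mulmxDr -scalemxAr My addr0.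
    have N1 : N *m (2^-1 *: (m *: v + y)) = 2^-1 *: (N *m y).
      by rewrite -scalemxAr mulmxDr -scalemxAr Nv scaler0 add0r.
    by rewrite dE M1 N1 -!scalemxAr; mxl; field.
  by move=> e; apply: (lcombm (k := 4) e); mxl; field.
have lE : l = 2 * m.
  have := congr1 (dt g) main; rewrite !dtL gv gN0 -/l -/m => e.
  by apply: (@mulfI _ 2); [exact: two0|apply: (lcomb (k := 1) e); ring].
have main2 : m *: (N *m y) + M *m (N *m y) = 2 *: y.
  by apply: (lcombm (k := 1) main); rewrite lE; mxl; ring.
have mMN : m *: (M *m (N *m y)) = 0.
  have := congr1 (mulmx M) main2.
  by rewrite mulmxDr -!scalemxAr My scaler0 (mulmxA M M) MM mul0mx addr0.
have m0 : m = 0.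
  apply/eqP; apply: contraT => m0.
  move/eqP: mMN; rewrite scaler_eq0 (negPf m0) /= => /eqP MNy.
  move: main2; rewrite MNy addr0 => Ny.
  have : y = 0.
    have := congr1 (mulmx N) Ny; rewrite -!scalemxAr (mulmxA N N) NN mul0mx scaler0 => /eqP.
    rewrite eq_sym scaler_eq0 (negPf (two0 K)) /= => /eqP Ny0.
    by move: Ny; rewrite Ny0 scaler0 => /esym/eqP; rewrite scaler_eq0 (negPf (two0 K)) => /eqP.
  by move=> y0; move: m0; rewrite /m y0 dt0r eqxx.
by move: main2; rewrite m0 scale0r add0r.
Qed.
End Alg.

(** * Vanishing of the nilpotent part *)

Section WorldI.
Variables (K : numClosedFieldType) (n : nat).
Implicit Types (X Y Z A B C D : 'M[K]_n) (u v w x y : 'cV[K]_n) (f g h k : 'rV[K]_n) (a b c e : K).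
Hypothesis n3 : (2 < n)%N.
Variables (psi th : 'M[K]_n -> 'M[K]_n).
Hypotheses (H : rep psi th) (W : world th 1).
Notation T e u f := (th (e *: (u *m f))).
Let s1 : 1 * 1 = 1 :> K := sgn1 K.

Lemma W_eig e v u f : e * e = 1 -> v != 0 -> dt f u = 1 -> th (u *m f) *m v = e *: v ->
  e = 1 /\ Rr th 1 v u.
Proof.
move=> ee v0 fu Av; case: (typeR n3 H ee v0 fu Av) => h.
  have [u' u'0 R'] := wR W v0.
  by have [e1 _] := Rr_uniq n3 H s1 ee v0 u'0 (dt1_neq0r fu) R' h; subst e.
by case: (wnC W ee v0 (dt1_neq0l fu) h).
Qed.

Lemma W_eigl e g u f : e * e = 1 -> g != 0 -> dt f u = 1 -> g *m th (u *m f) = e *: g ->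
  e = 1 /\ Cl th 1 g f.
Proof.
move=> ee g0 fu Ag; case: (typeL n3 H ee g0 fu Ag) => h.
  by case: (wnR W ee g0 (dt1_neq0r fu) h).
have [f' f'0 /Cr_tdr R'] := wL W g0; move/Cr_tdr: h => h.
have g0' : g^T != 0 by rewrite trmx_neq0.
have [e1 _] := Cr_uniq n3 (rep_tdr H) s1 ee g0' f'0 (dt1_neq0l fu) R' h.
by subst e; split=> //; apply/Cr_tdr.
Qed.

(** A nonzero vector in the image of A^3 - A^2 would be an eigenvector for -1, a sign that the world
    excludes. *)
Lemma W_cub u f : dt f u = 1 -> cub (th (u *m f)) = th (u *m f) *m th (u *m f).
Proof.
move=> fu; set A := th _; have SA : jo A A by have := jo_TT H s1 fu; rewrite T1E.
apply: mx_eqv => v; apply/eqP; rewrite -subr_eq0 -mulmxBl; apply: contraT => w0.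
have Aw : A *m ((cub A - A *m A) *m v) = - 1 *: ((cub A - A *m A) *m v).
  by rewrite mulmxA mulmxBr (S_AA1 SA) (mulmxA A A A) -/(cub A) scaleN1r -[RHS]mulNmx [- (cub A - _)]opprB.
have [+ _] := W_eig (sgnN s1) w0 fu Aw.
by move/eqP; rewrite eq_sym (negPf (sgn_neqN s1)).
Qed.

Lemma W_surj u : u != 0 -> exists2 v, v != 0 & Rr th 1 v u.
Proof.
move=> u0; have [f fu] := ex_dual u0; have [e [v [ee v0 Av]]] := eigvec n3 H fu.
by exists v => //; have [] := W_eig ee v0 fu Av.
Qed.

Lemma W_Cl_uniq g f f' : g != 0 -> f != 0 -> f' != 0 -> Cl th 1 g f -> Cl th 1 g f' ->
  exists c, f' = c *: f.
Proof.
rewrite -(trmx_neq0 g) => g0 f0 f'0 /Cr_tdr C /Cr_tdr C'.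
by have [] := Cr_uniq n3 (rep_tdr H) s1 s1 g0 f0 f'0 C C'.
Qed.

Lemma W_pair v u g f : v != 0 -> u != 0 -> f != 0 -> Rr th 1 v u -> Cl th 1 g f -> dt g v != 0 ->
  dt f u != 0.
Proof.
move=> v0 u0 f0 R C gv; have g0 : g != 0 by apply: contra gv => /eqP ->; rewrite dt0l.
have gv1 : dt ((dt g v)^-1 *: g) v = 1 by rewrite dtZl mulVf.
have [f1 f1u [C1|C1]] := partner n3 H s1 u0 gv1 (or_introl R).
  by case: (wnC W s1 v0 (dt1_neq0l f1u) C1).
have C1' : Cl th 1 g f1.
  have -> : g = dt g v *: ((dt g v)^-1 *: g) by rewrite scalerA mulfV // scale1r.
  exact: ClZv.
have [c E] := W_Cl_uniq g0 f0 (dt1_neq0l f1u) C C1'.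
apply/eqP => fu; move: f1u; rewrite E dtZl fu mulr0 => /esym/eqP.
by rewrite oner_eq0.
Qed.

Lemma W_partner u f v : dt f u = 1 -> v != 0 -> Rr th 1 v u ->
  exists g, [/\ dt g v = 1, Cl th 1 g f & g *m th (u *m f) = g].
Proof.
move=> fu v0 R; have SA : jo (th (u *m f)) (th (u *m f)).
  by have := jo_TT H s1 fu; rewrite T1E.
have [g gv gA] := left_partner s1 SA v0 (R f fu).
exists g; split=> //; last by rewrite gA scale1r.
by have [] := W_eigl s1 (dt1_neq0l gv) fu gA.
Qed.

Lemma frame u : u != 0 -> exists (i0 : 'I_n) (us : 'I_n -> 'cV[K]_n) (fs : 'I_n -> 'rV[K]_n),
  us i0 = u /\ forall i j, dt (fs i) (us j) = (i == j)%:R.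
Proof.
move=> u0; have [i0 ui] : exists i0, u i0 0 != 0.
  apply: contrapT => N; move/eqP: u0; apply; apply/colP => i; rewrite mxE.
  by apply: contrapT => ne; apply: N; exists i; apply/eqP.
pose dl i : 'rV[K]_n := delta_mx 0 i.
have dlE i w : dt (dl i) w = w i 0 by rewrite /dt -rowE mxE.
exists i0, (fun j => if j == i0 then u else delta_mx j 0),
  (fun i => if i == i0 then (u i0 0)^-1 *: dl i0 else dl i - (u i 0 / u i0 0) *: dl i0).
split=> [|i j]; first by rewrite eqxx.
case: (boolP (i == i0)) => ii; case: (boolP (j == i0)) => ji; rewrite ?(eqP ii) ?(eqP ji).
- by rewrite dtZl dlE eqxx mulVf.
- by rewrite dtZl dlE mxE eq_sym (negPf ji) mulr0.
- by rewrite !dtL !dlE (negPf ii) mulfVK // subrr.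
by rewrite !dtL !dlE !mxE !eqxx !andbT (eq_sym i0) (negPf ji) mulr0 subr0.
Qed.

(** Extend u to a basis with dual basis and choose eigenvectors v_i, g_i over it. By [W_pair] they
    are biorthogonal, so they too are dual bases; any vector of type u is killed by all g_i but one,
    hence lies on one line. *)
Lemma W_inj v v' u : v != 0 -> v' != 0 -> u != 0 -> Rr th 1 v u -> Rr th 1 v' u ->
  exists2 c, c != 0 & v' = c *: v.
Proof.
move=> v0 v'0 u0 R R'.
have [i0 [us [fs [ui d]]]] := frame u0.
have us0 i : us i != 0 by apply: (@dt1_neq0r _ _ (fs i)); rewrite d eqxx.
have fs0 i : fs i != 0 by apply: (@dt1_neq0l _ _ _ (us i)); rewrite d eqxx.
have ex i : exists vg : 'cV[K]_n * 'rV[K]_n, [/\ dt vg.2 vg.1 = 1, Rr th 1 vg.1 (us i) & Cl th 1 vg.2 (fs i)].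
  have [w w0 Rw] := W_surj (us0 i); have [|g [gw Cg _]] := @W_partner (us i) (fs i) w _ w0 Rw.
    by rewrite d eqxx.
  by exists (w, g).
have [vg Hvg] := choice ex.
have gv i w j : w != 0 -> Rr th 1 w (us j) -> i != j -> dt (vg i).2 w = 0.
  move=> w0 Rw ij; apply/eqP; apply: contraT => ne; have [_ _ C] := Hvg i.
  by have := W_pair w0 (us0 j) (fs0 i) Rw C ne; rewrite d (negPf ij) eqxx.
pose V : 'M[K]_n := \matrix_(i, j) (vg j).1 i 0.
pose G : 'M[K]_n := \matrix_(i, j) (vg i).2 0 j.
have GV : G *m V = 1%:M.
  apply/matrixP => i j; have -> : (G *m V) i j = dt (vg i).2 (vg j).1.
    by rewrite /dt !mxE; apply: eq_bigr => k _; rewrite !mxE.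
  rewrite mxE; have [->|ij] := eqVneq i j; first by have [] := Hvg j.
  have [g1 R1 _] := Hvg j.
  exact: (gv _ _ j (dt1_neq0r g1) R1 ij).
have VG := mulmx1C GV.
have lin w : w != 0 -> Rr th 1 w u -> w = dt (vg i0).2 w *: (vg i0).1.
  move=> w0 Rw; rewrite -{1}[w]mul1mx -VG -mulmxA; apply/colP => i.
  rewrite !mxE (bigD1 i0) //= big1 ?addr0; last first.
    move=> j ji; have -> : (G *m w) j 0 = dt (vg j).2 w.
      by rewrite /dt !mxE; apply: eq_bigr => k _; rewrite !mxE.
    by rewrite (gv _ _ i0) ?mulr0 // ui.
  rewrite !mxE mulrC /dt mxE; congr (_ * _); apply: eq_bigr => j _.
  by rewrite !mxE.
have lv := lin v v0 R; have lv' := lin v' v'0 R'; rewrite lv lv'.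
have c0 : dt (vg i0).2 v != 0.
  by apply: contra v0 => /eqP e; rewrite lv e scale0r.
exists (dt (vg i0).2 v' / dt (vg i0).2 v); last by rewrite scalerA mulfVK.
rewrite mulf_neq0 ?invr_eq0 //.
by apply: contra v'0 => /eqP e; rewrite lv' e scale0r.
Qed.
End WorldI.

Section WorldI2.
Variables (K : numClosedFieldType) (n : nat).
Implicit Types (X Y Z A B C D : 'M[K]_n) (u v w x y : 'cV[K]_n) (f g h k : 'rV[K]_n) (a b c e : K).
Hypothesis n3 : (2 < n)%N.

Lemma world_tt (th : 'M[K]_n -> 'M[K]_n) : world th 1 -> world (ttr (tdr th)) 1.
Proof.
case=> hR hL hC hR'; split.
- move=> v v0; have [|f f0 C] := hL v^T; rewrite ?trmx_neq0 //.
  by exists f^T; rewrite ?trmx_neq0 //; rewrite -[v]trmxK; apply/Rr_tt.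
- move=> v v0; have [|f f0 C] := hR v^T; rewrite ?trmx_neq0 //.
  by exists f^T; rewrite ?trmx_neq0 //; rewrite -[v]trmxK; apply/Cl_tt.
- move=> b v f bb v0 f0; rewrite -[v]trmxK -[f]trmxK => /Cr_tt.
  by apply: hR'; rewrite ?trmx_neq0.
move=> b v f bb v0 f0; rewrite -[v]trmxK -[f]trmxK => /Rl_tt.
by apply: hC; rewrite ?trmx_neq0.
Qed.

Variables (psi th : 'M[K]_n -> 'M[K]_n).
Hypotheses (H : rep psi th) (W : world th 1).
Let s1 : 1 * 1 = 1 :> K := sgn1 K.

Lemma W_injl g g' f : g != 0 -> g' != 0 -> f != 0 -> Cl th 1 g f -> Cl th 1 g' f ->
  exists2 c, c != 0 & g' = c *: g.
Proof.
move=> g0 g'0 f0 C C'.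
have [|||||c c0 E] := @W_inj _ _ n3 _ _ (rep_tt H) (world_tt W) g^T g'^T f^T; rewrite ?trmx_neq0 //.
- exact/Rr_tt.
- exact/Rr_tt.
by exists c => //; apply: trmx_inj; rewrite E linearZ.
Qed.

Lemma W_pair1 v u g f : v != 0 -> u != 0 -> g != 0 -> f != 0 -> Rr th 1 v u -> Cl th 1 g f ->
  (dt g v == 0) = (dt f u == 0).
Proof.
move=> v0 u0 g0 f0 R C; apply/idP/idP; apply: contraLR => h; last first.
  exact: (W_pair n3 H W v0 u0 f0 R C h).
have fu1 : dt ((dt f u)^-1 *: f) u = 1 by rewrite dtZl mulVf.
have [g1 [g1v C1 _]] := W_partner n3 H W fu1 v0 R.
have C' : Cl th 1 g ((dt f u)^-1 *: f) by apply: ClZ; rewrite // invr_eq0.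
have [c c0 ->] := W_injl (dt1_neq0l g1v) g0 (dt1_neq0l fu1) C1 C'.
by rewrite dtZl g1v mulr1.
Qed.

(** The preimages of uf and -uf, with the possible nilpotent part N still present. [shape_c1] and
    [shape_N0] remove c and N in turn. *)
Record shape u f v g (N : 'M[K]_n) c : Prop := Shape {
  sh_gv : dt g v = 1;
  sh_R : Rr th 1 v u;
  sh_C : Cl th 1 g f;
  sh_Nv : N *m v = 0;
  sh_gN : g *m N = 0;
  sh_NN : N *m N = 0;
  sh_c : c != 0;
  sh_p : th (1 *: (u *m f)) = v *m g + N;
  sh_m : th (- 1 *: (u *m f)) = - (v *m g) + c *: N }.

Lemma shape_ex u f v : dt f u = 1 -> v != 0 -> Rr th 1 v u -> exists g (N : 'M_n) c, shape u f v g N c.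
Proof.
move=> fu v0 R; have [g [gv C gA]] := W_partner n3 H W fu v0 R.
have := opp_structure n3 H s1 fu; rewrite !T1E /=.
have SA : jo (th (u *m f)) (th (u *m f)) by have := jo_TT H s1 fu; rewrite T1E.
have cE := W_cub n3 H W fu.
set A := th _ in cE SA gA * => -[_ [c c0 mE]].
have Av : A *m v = v by rewrite R // scale1r.
(* The image of the projection A^2 consists of eigenvectors for 1, which by [W_inj] all lie on the
   line of v. *)
have E1 : A *m A = v *m g.
  have col z : exists c, (A *m A) *m z = c *: v.
    have [->|z0] := eqVneq ((A *m A) *m z) 0; first by exists 0; rewrite scale0r.
    have AA : A *m (A *m A *m z) = 1 *: (A *m A *m z) by rewrite mulmxA mulmxA -/(cub A) cE scale1r.
    have [_ R'] := W_eig n3 H W s1 z0 fu AA.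
    by have [d _ ->] := W_inj n3 H W v0 z0 (dt1_neq0r fu) R R'; exists d.
  apply: mx_eqv => z; have [d E] := col z; rewrite E outv; congr (_ *: _).
  have := congr1 (dt g) E; rewrite -!dtA mulmxA !gA dtZr gv mulr1 => <-.
  by [].
exists g, (nilpart A), c; split=> //.
- by rewrite /nilpart cE mulmxBl -mulmxA !Av subrr.
- by rewrite /nilpart cE mulmxBr mulmxA !gA subrr.
- exact: S_NN.
- by rewrite T1E -/A /nilpart cE E1 addrC subrK.
by rewrite mE cE E1.
Qed.

Lemma shape_e u f v g N c e : shape u f v g N c -> e * e = 1 ->
  exists2 d, d != 0 & th (e *: (u *m f)) = e *: (v *m g) + d *: N.
Proof.
case=> _ _ _ _ _ _ c0 p m /sqr1P[->|->]; first by exists 1; rewrite ?oner_eq0 // p !scale1r.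
by exists c => //; rewrite m scaleN1r.
Qed.

Lemma nil_self x k : dt k x = 0 -> jo (psi (x *m k)) (psi (x *m k)).
Proof.
move=> kx; apply/(rep_jo H (x *m k) (x *m k)).
by rewrite /jo jpAA outo kx scale0r /idempotent_mx mul0mx.
Qed.

(** If Y = x k had such an image, Y would be related to all [T e u f], so [jo_nil] makes k kill the
    square of each preimage applied to x; a generic f yields k v = 0. The calibration value 2 must
    then come from the nilpotent part, and a multiple lam Y passes with the opposite idempotent.
    Since Y and lam Y are related, the image of lam Y can only annihilate u and h0; testing it with
    the original sign forces lam = 1, a contradiction. *)
Lemma nil_noeig x k e u : dt k x = 0 -> x != 0 -> k != 0 -> e * e = 1 -> u != 0 ->
  psi (x *m k) *m u = e *: u -> False.
Proof.
move=> kx x0 k0 ee u0 Tu; set Y := x *m k in Tu.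
have e0 := sgn_neq0 ee.
have [h0 h0u h0T] := left_partner ee (nil_self kx) u0 Tu.
have [v v0 R] := W_surj n3 H W u0.
have noperp f : dt f u = 1 -> ~ perp Y (th (e *: (u *m f))).
  move=> fu /perpC/(perp_opp n3 H ee fu)/perpC/perp_jo/(jo_T H _ (sgnN ee) fu).
  rewrite Tu => -[E|[E|[/eqP + _]]].
  - by have /eqP := eig_sgn_uniq u0 E; rewrite (negPf (sgn_neqN ee)).
  - have := congr1 (fun z => dt z u) E; rewrite /= dtA Tu !dtL fu !mulr1 => /eqP.
    by rewrite (negPf (sgn_neqN ee)).
  by rewrite scaler_eq0 (negPf e0) (negPf u0).
have joY f : dt f u = 1 -> jo Y (th (e *: (u *m f))).
  by move=> fu; apply/(jo_T H _ ee fu); left.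
have kCCx f : dt f u = 1 -> dt k (th (e *: (u *m f)) *m (th (e *: (u *m f)) *m x)) = 0 /\
    ((exists c, [/\ c != 0, th (e *: (u *m f)) *m x = c *: x & k *m th (e *: (u *m f)) = - c *: k])
     \/ dt k (th (e *: (u *m f)) *m x) = 2).
  move=> fu; have := joY f fu => /joC/(jo_nil _ kx x0 k0)[[c [c1 c2]]|[c1 c2]]; last by split=> //; right.
  split; first by rewrite c1 -scalemxAr c1 !dtL kx !mulr0.
  left; exists c; split=> //; apply/eqP => c00; apply: (noperp f fu).
  by rewrite /perp /Y mulmxA c1 -mulmxA c2 c00 oppr0 !scale0r mul0mx mulmx0 addr0.
(* The square is v' g whatever the sign and the multiple of N. *)
have CC e' u' f v' g (N : 'M_n) c (sh : shape u' f v' g N c) z d : e' * e' = 1 -> (e' *: (v' *m g) + d *: N) *m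
    ((e' *: (v' *m g) + d *: N) *m z) = dt g z *: v'.
  move=> ee'; have [gv _ _ Nv gN NN _ _ _] := sh.
  have gNz : dt g (N *m z) = 0 by rewrite -dtA gN dt0l.
  have I : (e' *: (v' *m g) + d *: N) *m z = (e' * dt g z) *: v' + d *: (N *m z).
    by rewrite mulmxDl -!scalemxAl outv scalerA.
  rewrite I mulmxDl -!scalemxAl outv !dtL gv gNz mulr0 addr0 mulr1 mulmxDr -!scalemxAr Nv.
  by rewrite (mulmxA N N) NN mul0mx !scaler0 !addr0 !scalerA mulrA ee' mul1r scaler0 addr0.
have kv : dt k v = 0.
  have [|//|g [gs _]] := @avoid_rowm K n n3 [:: x; v] [::]; first by move=> ? [<-|[<-|[]]].
  have gx : dt g x != 0 by apply: gs; left.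
  have gv : dt g v != 0 by apply: gs; right; left.
  have g0 : g != 0 by apply: contra gv => /eqP ->; rewrite dt0l.
  have [f f0 C] := wL W g0; have fu := W_pair n3 H W v0 u0 f0 R C gv.
  have fu1 : dt ((dt f u)^-1 *: f) u = 1 by rewrite dtZl mulVf.
  have C1 : Cl th 1 g ((dt f u)^-1 *: f) by apply: ClZ; rewrite // invr_eq0.
  have [g1 [N [c sh]]] := shape_ex fu1 v0 R.
  have [d d0 TE] := shape_e sh ee; have [g1v _ C2 _ _ _ _ _ _] := sh.
  have [b b0 E] := W_injl (dt1_neq0l g1v) g0 (dt1_neq0l fu1) C2 C1.
  have [+ _] := kCCx _ fu1; rewrite TE (CC _ _ _ _ _ _ _ sh _ _ ee) dtZr => /eqP.
  have g1x : dt g1 x != 0 by apply: contra gx => /eqP e1; rewrite E dtZl e1 mulr0.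
  by rewrite mulf_eq0 (negPf g1x) /= => /eqP.
have [g [N [c sh]]] := shape_ex h0u v0 R.
have [d d0 TE] := shape_e sh ee; have [d' d'0 TE'] := shape_e sh (sgnN ee).
have [gv _ _ Nv gN NN _ _ _] := sh.
have kNx : d * dt k (N *m x) = 2.
  have [_ [[b [b0 b1 b2]]|]] := kCCx _ h0u; last first.
    by rewrite TE mulmxDl -!scalemxAl outv !dtL kv !mulr0 add0r.
  have kTT : k *m th (e *: (u *m h0)) *m th (e *: (u *m h0)) = (b * b) *: k.
    by rewrite b2 -scalemxAl b2 scalerA mulrNN.
  have [y ky] := ex_dualr k0.
  have := congr1 (fun z => dt z y) kTT; rewrite /= !dtA TE (CC _ _ _ _ _ _ _ sh _ _ ee) !dtL kv ky mulr0 mulr1.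
  by move=> /esym/eqP; rewrite mulf_eq0 (negPf b0).
(* Compensates the different coefficients of N in the preimages of the two signs. *)
pose lam := d / d'.
have lam0 : lam != 0 by rewrite mulf_neq0 // invr_eq0.
have klx : dt (lam *: k) x = 0 by rewrite dtZl kx mulr0.
have lk0 : lam *: k != 0 by rewrite scaler_eq0 negb_or lam0.
have YL : lam *: Y = x *m (lam *: k) by rewrite -scalemxAr.
have : jo (lam *: Y) (th (- e *: (u *m h0))).
  rewrite YL; apply/joC/(jo_nil _ klx x0 lk0); right; rewrite TE'; split.
    rewrite mulmxDl -!scalemxAl outv !dtL kv !mulr0 add0r -kNx /lam.
    by rewrite mulrA divfK.
  by rewrite (CC _ _ _ _ _ _ _ sh _ _ (sgnN ee)) !dtL kv; ring.
set T' := psi (lam *: Y); move=> /(jo_T H _ (sgnN ee) h0u); rewrite -/T'.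
have : jo (psi Y) T'.
  apply/(rep_jo H Y (lam *: Y)); rewrite /jo jpZr jpAA outo kx scale0r scaler0.
  by rewrite /idempotent_mx mul0mx.
rewrite /jo /idempotent_mx; set M := jp _ _ => MM.
have MEu z : M *m z = 2^-1 *: (psi Y *m (T' *m z) + T' *m (psi Y *m z)).
  by rewrite /M /jp -scalemxAl mulmxDl -!mulmxA.
case=> [E|[E|[E1 E2]]].
- have Mu : M *m u = - u.
    by rewrite MEu E Tu -!scalemxAr E Tu !scalerA !(mulrN, mulNr) ee; mxl; field.
  have : u = - u by rewrite -[RHS]Mu -MM -mulmxA Mu mulmxN Mu opprK.
  move/eqP; rewrite -subr_eq0 opprK -mulr2n -scaler_nat scaler_eq0 (negPf (two0 K)) /=.
  by rewrite (negPf u0).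
- have hM : h0 *m M = - h0.
    rewrite /M /jp -scalemxAr mulmxDr !mulmxA h0T E -!scalemxAl h0T E !scalerA.
    by rewrite !(mulrN, mulNr) ee; mxl; field.
  have h00 := dt1_neq0l h0u.
  have : h0 = - h0 by rewrite -[RHS]hM -MM mulmxA hM mulNmx hM opprK.
  move/eqP; rewrite -subr_eq0 opprK -mulr2n -scaler_nat scaler_eq0 (negPf (two0 K)) /=.
  by rewrite (negPf h00).
have : jo (lam *: Y) (th (e *: (u *m h0))).
  by apply/(jo_T H _ ee h0u); right; right.
rewrite YL => /joC/(jo_nil _ klx x0 lk0)[[b [b1 _]]|[b1 _]].
  have : dt k (th (e *: (u *m h0)) *m x) = 2.
    by rewrite TE mulmxDl -!scalemxAl outv !dtL kv !mulr0 add0r kNx.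
  by rewrite b1 dtZr kx mulr0 => /esym/eqP; rewrite (negPf (two0 K)).
have l1 : lam = 1.
  move: b1; rewrite TE mulmxDl -!scalemxAl outv !dtL kv !mulr0 add0r kNx => /eqP.
  by rewrite -subr_eq0 -{2}[2]mul1r -mulrBl mulf_eq0 (negPf (two0 K)) orbF subr_eq0 => /eqP.
move: E1; rewrite /T' l1 scale1r Tu => /eqP; rewrite scaler_eq0 (negPf e0).
by rewrite (negPf u0).
Qed.

Lemma nil_noeigl x k e f : dt k x = 0 -> x != 0 -> k != 0 -> e * e = 1 -> f != 0 ->
  f *m psi (x *m k) = e *: f -> False.
Proof.
move=> kx x0 k0 ee f0 fT; have ST := nil_self kx.
have fpe := gpe ee fT; have p0 : pe (psi (x *m k)) e != 0.
  by apply: contra f0 => /eqP p0; rewrite -fpe p0 mulmx0.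
have [y py] := mx_neq0v p0.
by apply: (nil_noeig kx x0 k0 ee py); rewrite mulmxA (Zpe ee ST) -scalemxAl.
Qed.

Lemma nil_zero x k e u f : dt k x = 0 -> x != 0 -> k != 0 -> e * e = 1 -> dt f u = 1 ->
  jo (x *m k) (th (e *: (u *m f))) -> psi (x *m k) *m u = 0 /\ f *m psi (x *m k) = 0.
Proof.
move=> kx x0 k0 ee fu /(jo_T H _ ee fu)[E|[E|//]].
  by case: (nil_noeig kx x0 k0 ee (dt1_neq0r fu) E).
by case: (nil_noeigl kx x0 k0 ee (dt1_neq0l fu) E).
Qed.


(** Choose x and k with gx = kv = kx = 0 and kNx = 2. Then x k passes with the preimage of uf, so by
    [nil_zero] its image annihilates u and f and it passes with the preimage of -uf too; there the
    calibration reads 2c = 2. *)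
Lemma shape_c1 u f v g N c : dt f u = 1 -> shape u f v g N c -> N != 0 -> c = 1.
Proof.
move=> fu sh N0; have [gv R C Nv gN NN c0 p m] := sh.
have [x gx Nx0] : exists2 x, dt g x = 0 & N *m x != 0.
  have [y Ny] := mx_neq0v N0; exists (y - dt g y *: v); first by rewrite !dtL gv mulr1 subrr.
  by rewrite mulmxBr -scalemxAr Nv scaler0 subr0.
have x0 : x != 0 by apply: contra Nx0 => /eqP ->; rewrite mulmx0.
have gNx : dt g (N *m x) = 0 by rewrite -dtA gN dt0l.
have ind : ~ exists t, N *m x = t *: x.
  case=> t E; have := congr1 (mulmx N) E; rewrite mulmxA NN mul0mx -scalemxAr => /esym/eqP.
  rewrite scaler_eq0 (negPf Nx0) orbF => /eqP t0.
  by move: Nx0; rewrite E t0 scale0r eqxx.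
have [k0 [k0x k0N]] := ex_dual2 0 2 x0 ind.
have [k [kv kx kNx]] : exists k, [/\ dt k v = 0, dt k x = 0 & dt k (N *m x) = 2].
  exists (k0 - dt k0 v *: g); rewrite !dtL gv gx gNx k0x k0N !mulr0 !subr0 mulr1 subrr.
  by split.
have knz : k != 0.
  by apply/eqP => k00; move: kNx; rewrite k00 dt0l => /esym/eqP; rewrite (negPf (two0 K)).
have Nk0 : N *m (N *m x) = 0 by rewrite mulmxA NN mul0mx.
have : jo (x *m k) (th (1 *: (u *m f))).
  apply/joC/(jo_nil _ kx x0 knz); right; rewrite p !(mulmxDl _ _ x) outv gx scale0r add0r.
  by rewrite mulmxDl outv gNx Nk0 scale0r addr0 dt0r.
move=> /(nil_zero kx x0 knz s1 fu) Z.
have : jo (x *m k) (th (- 1 *: (u *m f))).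
  by apply/(jo_T H _ (sgnN s1) fu); right; right.
have mx : th (- 1 *: (u *m f)) *m x = c *: (N *m x).
  by rewrite m mulmxDl mulNmx outv gx scale0r oppr0 add0r -scalemxAl.
move=> /joC/(jo_nil _ kx x0 knz)[[b [b1 _]]|[b1 _]].
  have := congr1 (dt k) b1; rewrite mx !dtL kx kNx mulr0 => /eqP.
  by rewrite mulf_eq0 (negPf (two0 K)) (negPf c0).
move: b1; rewrite mx dtZr kNx => /eqP.
by rewrite -subr_eq0 -{2}[2]mul1r -mulrBl mulf_eq0 (negPf (two0 K)) orbF subr_eq0 => /eqP.
Qed.

Lemma shape_s u f v g N c s : dt f u = 1 -> shape u f v g N c -> s * s = 1 ->
  th (s *: (u *m f)) = s *: (v *m g) + N.
Proof.
move=> fu sh; case: (sh) => _ _ _ _ _ _ _ p m /sqr1P[->|->]; first by rewrite p !scale1r.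
rewrite m scaleN1r; have [->|N0] := eqVneq N 0; first by rewrite scaler0.
by rewrite (shape_c1 fu sh N0) scale1r.
Qed.

(** If M is nonzero, take y = Mv nonzero and k = kap M. By [kill_alg], y k passes with every uf such
    that f w = 0, so the image T of y k is killed by all functionals vanishing at w, that is T = w
    (hT). But y k anticommutes with the preimage of wh, whence hT = 0 and y k = 0. *)
Lemma shape_N0 w h vw gh M c : dt h w = 1 -> shape w h vw gh M c -> M = 0.
Proof.
move=> hw shM; have [gv Rw Ch Mv gM MM c0 _ _] := shM.
apply/eqP; apply: contraT => M0.
have [v ghv y_nz] : exists2 v, dt gh v = 0 & M *m v != 0.
  have [y0 My0] := mx_neq0v M0; exists (y0 - dt gh y0 *: vw).
    by rewrite !dtL gv mulr1 subrr.
  by rewrite mulmxBr -scalemxAr Mv scaler0 subr0.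
have v0 : v != 0 by apply: contra y_nz => /eqP ->; rewrite mulmx0.
have [u u0 R] := wR W v0.
have hu : dt h u = 0.
  have := W_pair1 v0 u0 (dt1_neq0l gv) (dt1_neq0l hw) R Ch.
  by rewrite ghv eqxx => /esym/eqP.
set y := M *m v in y_nz *.
have [kap kapy] := ex_dual y_nz; pose k := kap *m M.
have ky : dt k y = 0 by rewrite /k /y dtA mulmxA MM mul0mx dt0r.
have step f : dt f u = 1 -> dt f w = 0 -> k != 0 /\ jo (y *m k) (th (1 *: (u *m f))).
  move=> fu fw; have [g [N [c' sh]]] := shape_ex fu v0 R.
  have [g1v _ Cg Nv gN NN _ _ _] := sh.
  have gvw : dt g vw = 0.
    have := W_pair1 (dt1_neq0r gv) (dt1_neq0r hw) (dt1_neq0l g1v) (dt1_neq0l fu) Rw Cg.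
    by rewrite fw eqxx => /eqP.
  have [gy MNy] : dt g y = 0 /\ M *m (N *m y) = 2 *: y.
    apply: (kill_alg g1v Nv gN NN Mv gM MM gvw ghv) => s t ss tt.
    rewrite -(shape_s fu sh ss) -(shape_s hw shM tt); apply/(jo_T H _ tt hw); right; right.
    by rewrite (rep_th H ss fu) -scalemxAl -scalemxAr outv outg fw hu !scale0r !scaler0.
  have kNy : dt k (N *m y) = 2 by rewrite /k dtA MNy dtZr kapy mulr1.
  have k0 : k != 0.
    by apply/eqP => k00; move: kNy; rewrite k00 dt0l => /esym/eqP; rewrite (negPf (two0 K)).
  have gNy : dt g (N *m y) = 0 by rewrite -dtA gN dt0l.
  split=> //; apply/joC/(jo_nil _ ky y_nz k0); right.
  rewrite (shape_s fu sh s1) scale1r !(mulmxDl _ _ y) outv gy scale0r add0r.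
  by rewrite mulmxDl outv gNy scale0r add0r mulmxA NN mul0mx dt0r.
have ind : ~ exists t, w = t *: u.
  by case=> t E; move: hw; rewrite E dtZr hu mulr0 => /esym/eqP; rewrite oner_eq0.
have [f0 [f0u f0w]] := ex_dual2 1 0 u0 ind.
have [k0 _] := step f0 f0u f0w.
set T := psi (y *m k).
have z1 f : dt f u = 1 -> dt f w = 0 -> f *m T = 0.
  by move=> fu fw; have [_ /(nil_zero ky y_nz k0 s1 fu)[]] := step f fu fw.
have z2 f : dt f w = 0 -> f *m T = 0.
  move=> fw; have [fu|fu] := eqVneq (dt f u) 0; last first.
    have := z1 ((dt f u)^-1 *: f); rewrite !dtZl mulVf // fw mulr0 -scalemxAl => /(_ erefl erefl)/eqP.
    by rewrite scaler_eq0 invr_eq0 (negPf fu) => /eqP.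
  rewrite -[f](addrK f0) mulmxBl (z1 f0) // z1 ?subr0 //.
    by rewrite dtDl fu f0u add0r.
  by rewrite dtDl fw f0w add0r.
have TE : T = w *m (h *m T).
  apply: mx_eqg => k'; have := z2 (k' - dt k' w *: h); rewrite !dtL hw mulr1 subrr => /(_ erefl)/eqP.
  by rewrite mulmxBl -scalemxAl subr_eq0 => /eqP ->; rewrite mulmxA dtE mul_scalar_mx.
have : jo (y *m k) (th (1 *: (w *m h))).
  apply: perp_jo; rewrite /perp (shape_s hw shM s1) scale1r mulmxDl mulmxDr.
  have kM : k *m M = 0 by rewrite /k -(mulmxA kap) MM mulmx0.
  have kvw : k *m vw = 0 by rewrite /k -(mulmxA kap) Mv mulmx0.
  have ghy : gh *m y = 0 by rewrite /y mulmxA gM mul0mx.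
  have My : M *m y = 0 by rewrite /y mulmxA MM mul0mx.
  rewrite -(mulmxA y k M) kM mulmx0 addr0 -(mulmxA y k) (mulmxA k vw) kvw mul0mx mulmx0 add0r.
  by rewrite (mulmxA M y) My mul0mx addr0 -(mulmxA vw gh) (mulmxA gh y) ghy mul0mx mulmx0.
move=> /(nil_zero ky y_nz k0 s1 hw)[_ hT].
have : T = 0 by rewrite TE hT mulmx0.
move/(psi0 H) => /out0[/eqP|/eqP]; first by rewrite (negPf y_nz).
by rewrite (negPf k0).
Qed.

Lemma world_psi : exists (U : 'cV[K]_n -> 'cV[K]_n) (F : 'rV[K]_n -> 'rV[K]_n),
  [/\ forall v, v != 0 -> U v != 0, forall g, g != 0 -> F g != 0,
      forall g v, g != 0 -> v != 0 -> (dt g v == 0) = (dt (F g) (U v) == 0),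
      forall u, u != 0 -> exists v c, [/\ v != 0, c != 0 & u = c *: U v]
    & forall e v g, e * e = 1 -> dt g v = 1 ->
        psi (e *: (v *m g)) = (e / dt (F g) (U v)) *: (U v *m F g)].
Proof.
have exU v : exists u, v != 0 -> u != 0 /\ Rr th 1 v u.
  have [->|v0] := eqVneq v 0; first by exists 0.
  by have [u u0 R] := wR W v0; exists u.
have exF g : exists f, g != 0 -> f != 0 /\ Cl th 1 g f.
  have [->|v0] := eqVneq g 0; first by exists 0.
  by have [u u0 R] := wL W v0; exists u.
have [U HU] := choice exU; have [F HF] := choice exF.
exists U, F; split.
- by move=> v /HU[].
- by move=> g /HF[].
- move=> g v g0 v0; have [u0 R] := HU v v0; have [f0 C] := HF g g0.
  exact: W_pair1.
- move=> u u0; have [v v0 R] := W_surj n3 H W u0; have [Uv0 R'] := HU v v0.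
  have [_ [c E]] := Rr_uniq n3 H s1 s1 v0 Uv0 u0 R' R; exists v, c; split=> //.
  by apply: contra u0 => /eqP c0; rewrite E c0 scale0r.
move=> e v g ee gv; have v0 := dt1_neq0r gv; have g0 := dt1_neq0l gv.
have [u0 R] := HU v v0; have [f0 C] := HF g g0.
have fu : dt (F g) (U v) != 0.
  by rewrite -(W_pair1 v0 u0 g0 f0 R C) gv oner_eq0.
set f1 := (dt (F g) (U v))^-1 *: F g.
have fu1 : dt f1 (U v) = 1 by rewrite dtZl mulVf.
have C1 : Cl th 1 g f1 by apply: ClZ; rewrite // invr_eq0.
have [g' [N [c sh]]] := shape_ex fu1 v0 R.
have N0 := shape_N0 fu1 sh; have [g'v _ C' _ _ _ _ _ _] := sh.
have [d d0 E] := W_injl (dt1_neq0l g'v) g0 (dt1_neq0l fu1) C' C1.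
have d1 : d = 1 by move: gv; rewrite E dtZl g'v mulr1.
have -> : e *: (v *m g) = th (e *: (U v *m f1)).
  by rewrite (shape_s fu1 sh ee) N0 addr0 E d1 scale1r.
by rewrite (rep_th H ee fu1) /f1 -scalemxAr scalerA.
Qed.

End WorldI2.

(** * The fundamental theorem of projective geometry *)

Section Coord.
Variables (K : numClosedFieldType) (n : nat).
Implicit Types (u v w : 'cV[K]_n) (f g : 'rV[K]_n) (i j k l : 'I_n).

Definition ecol i : 'cV[K]_n := delta_mx i 0.
Definition erow i : 'rV[K]_n := delta_mx 0 i.
Definition ones : 'cV[K]_n := const_mx 1.

Lemma dt_erow i v : dt (erow i) v = v i 0.
Proof. by rewrite /dt -rowE mxE. Qed.
Lemma dt_ecol g i : dt g (ecol i) = g 0 i.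
Proof. by rewrite /dt -colE mxE. Qed.
Lemma ecolE i j : ecol i j 0 = (j == i)%:R.
Proof. by rewrite mxE eqxx andbT. Qed.
Lemma erowE i j : erow i 0 j = (j == i)%:R.
Proof. by rewrite mxE. Qed.
Lemma onesE i : ones i 0 = 1. Proof. by rewrite mxE. Qed.
Lemma dt_sum g v : dt g v = \sum_i g 0 i * v i 0.
Proof. by rewrite /dt mxE. Qed.

Lemma dt_supp2 i j g v : i != j -> (forall k, k != i -> k != j -> g 0 k = 0) ->
  dt g v = g 0 i * v i 0 + g 0 j * v j 0.
Proof.
move=> ij h; rewrite dt_sum (bigD1 i) //= (bigD1 j) ?(eq_sym j) //= big1 ?addr0 //.
by move=> k /andP[ki kj]; rewrite h // mul0r.
Qed.

Lemma dt_supp3 i j l g v : i != j -> i != l -> j != l ->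
  (forall k, k != i -> k != j -> k != l -> g 0 k = 0) ->
  dt g v = g 0 i * v i 0 + g 0 j * v j 0 + g 0 l * v l 0.
Proof.
move=> ij il jl h; rewrite dt_sum (bigD1 i) //= (bigD1 j) ?(eq_sym j) //= (bigD1 l) /=.
  rewrite big1 ?addr0 ?addrA // => k /andP[/andP[ki kj] kl].
  by rewrite h // mul0r.
by rewrite !(eq_sym l) il.
Qed.
End Coord.

Section FT.
Variables (K : numClosedFieldType) (n : nat).
Implicit Types (u v w : 'cV[K]_n) (f g h : 'rV[K]_n) (x y s m : K) (i j k l : 'I_n).
Variables (U : 'cV[K]_n -> 'cV[K]_n) (F : 'rV[K]_n -> 'rV[K]_n).
Hypotheses (pU : forall v, v != 0 -> U v != 0) (pF : forall g, g != 0 -> F g != 0).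
Hypothesis pUF : forall g v, g != 0 -> v != 0 -> (dt g v == 0) = (dt (F g) (U v) == 0).
Hypothesis sU : forall u, u != 0 -> exists v c, [/\ v != 0, c != 0 & u = c *: U v].
Hypothesis Ue : forall i, exists c, U (ecol K i) = c *: ecol K i.
Hypothesis Fe : forall i, exists c, F (erow K i) = c *: erow K i.
Hypothesis U1 : U (ones K n) = ones K n.
Variables i0 i1 i2 : 'I_n.
Hypotheses (i01 : i0 != i1) (i02 : i0 != i2) (i12 : i1 != i2).
Notation e := (ecol K).
Notation r := (erow K).

Lemma ecol_neq0 i : e i != 0.
Proof. by apply/eqP => /matrixP/(_ i 0)/eqP; rewrite ecolE mxE eqxx oner_eq0. Qed.
Lemma erow_neq0 i : r i != 0.
Proof. by apply/eqP => /matrixP/(_ 0 i)/eqP; rewrite erowE mxE eqxx oner_eq0. Qed.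

Lemma cU v i : v != 0 -> (v i 0 == 0) = (U v i 0 == 0).
Proof.
move=> v0; rewrite -!dt_erow (pUF (erow_neq0 i) v0); have [c E] := Fe i.
have := pF (erow_neq0 i); rewrite E scaler_eq0 negb_or => /andP[c0 _].
by rewrite dtZl mulf_eq0 (negPf c0).
Qed.
Lemma cF g i : g != 0 -> (g 0 i == 0) = (F g 0 i == 0).
Proof.
move=> v0; rewrite -!dt_ecol (pUF v0 (ecol_neq0 i)); have [c E] := Ue i.
have := pU (ecol_neq0 i); rewrite E scaler_eq0 negb_or => /andP[c0 _].
by rewrite dtZr mulf_eq0 (negPf c0).
Qed.

Lemma cv0 v i : v i 0 != 0 -> v != 0.
Proof. by apply: contra => /eqP ->; rewrite mxE. Qed.
Lemma cg0 g i : g 0 i != 0 -> g != 0.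
Proof. by apply: contra => /eqP ->; rewrite mxE. Qed.

(* All the functionals below have support of size at most three, and so have their images. *)
Lemma F2 g v i j : i != j -> (forall k, k != i -> k != j -> g 0 k = 0) -> g 0 i != 0 -> v != 0 ->
  (dt g v == 0) = (F g 0 i * U v i 0 + F g 0 j * U v j 0 == 0).
Proof.
move=> ij h gi v0; have g0 := cg0 gi; rewrite (pUF g0 v0) (dt_supp2 _ ij) // => k ki kj.
by apply/eqP; rewrite -cF // h.
Qed.

Definition pt x y : 'cV[K]_n := e i0 + x *: e i1 + y *: e i2.
Lemma ptE x y i : pt x y i 0 = (i == i0)%:R + x * (i == i1)%:R + y * (i == i2)%:R.
Proof. by rewrite /pt mxDE mxDE !mxZE !ecolE. Qed.
Lemma pt0 x y : pt x y i0 0 = 1.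
Proof. by rewrite ptE eqxx (negPf i01) (negPf i02) !mulr0 !addr0. Qed.
Lemma pt1 x y : pt x y i1 0 = x.
Proof. by rewrite ptE eqxx (eq_sym i1) (negPf i01) (negPf i12) mulr0 mulr1 addr0 add0r. Qed.
Lemma pt2 x y : pt x y i2 0 = y.
Proof. by rewrite ptE eqxx !(eq_sym i2) (negPf i02) (negPf i12) mulr0 mulr1 !add0r. Qed.
Lemma pt_neq0 x y : pt x y != 0.
Proof. by apply: (@cv0 _ i0); rewrite pt0 oner_eq0. Qed.

Definition sg x := U (pt x 0) i1 0 / U (pt x 0) i0 0.

Lemma U0 v : v i0 0 != 0 -> U v i0 0 != 0.
Proof. by move=> v0; rewrite -cU // (cv0 v0). Qed.

(** The difference of two coordinates kills the all-ones vector, which U fixes, so F preserves it up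
    to a scalar. *)
Lemma Ueq v i j : i != j -> v != 0 -> (v i 0 == v j 0) = (U v i 0 == U v j 0).
Proof.
move=> ij v0; pose g := r i - r j.
have gk k : g 0 k = (k == i)%:R - (k == j)%:R by rewrite /g mxDE mxNE !erowE.
have gi : g 0 i = 1 by rewrite gk eqxx (negPf ij) subr0.
have gi0 : g 0 i != 0 by rewrite gi oner_eq0.
have gs k : k != i -> k != j -> g 0 k = 0.
  by move=> ki kj; rewrite gk (negPf ki) (negPf kj) subrr.
have dg w : dt g w = w i 0 - w j 0 by rewrite /g !dtL !dt_erow.
have o0 : ones K n != 0 by apply: (@cv0 _ i); rewrite onesE oner_eq0.
have := F2 ij gs gi0 o0; rewrite dg U1 !onesE subrr eqxx !mulr1 => /esym.
rewrite addr_eq0 => /eqP Fi; have := F2 ij gs gi0 v0.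
rewrite dg Fi subr_eq0 => ->; rewrite mulNr addrC -mulrBr mulf_eq0.
have -> : (F g 0 j == 0) = false by rewrite -oppr_eq0 -Fi -cF ?(cg0 gi0) ?(negPf gi0).
by rewrite /= subr_eq0 eq_sym.
Qed.

(* [sg] is read off the line of points [e0 + x e1], and the same [sg] governs every coordinate. *)
Lemma Usg v x j : j != i0 -> v != 0 -> (x * v i0 0 == v j 0) = (sg x * U v i0 0 == U v j 0).
Proof.
have body l w y : l != i0 -> w != 0 -> w i0 0 = 1 -> w l 0 = y -> 
    forall v, v != 0 -> (y * v i0 0 == v l 0) = (U w l 0 / U w i0 0 * U v i0 0 == U v l 0).
  move=> l0 w0 wi wl z z0; pose g := y *: r i0 - r l.
  have gk k : g 0 k = y * (k == i0)%:R - (k == l)%:R by rewrite /g mxDE mxNE mxZE !erowE.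
  have gi : g 0 l = -1 by rewrite gk eqxx (negPf l0) mulr0 sub0r.
  have gi0 : g 0 l != 0 by rewrite gi oppr_eq0 oner_eq0.
  have gs k : k != l -> k != i0 -> g 0 k = 0.
    by move=> ki kj; rewrite gk (negPf ki) (negPf kj) mulr0 subrr.
  have dg w' : dt g w' = y * w' i0 0 - w' l 0 by rewrite /g !dtL !dt_erow.
  have Fl0 : F g 0 l != 0 by rewrite -cF ?(cg0 gi0).
  have Uw0 : U w i0 0 != 0 by apply: U0; rewrite wi oner_eq0.
  have := F2 l0 gs gi0 w0; rewrite dg wi wl mulr1 subrr eqxx => /esym.
  rewrite addrC addr_eq0 => /eqP E.
  have F0 : F g 0 i0 = - (F g 0 l * (U w l 0 / U w i0 0)).
    by apply: (mulIf Uw0); rewrite E; field.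
  have := F2 l0 gs gi0 z0; rewrite dg subr_eq0 F0 => ->.
  set q := U w l 0 / U w i0 0.
  have -> : F g 0 l * U z l 0 + - (F g 0 l * q) * U z i0 0 = F g 0 l * (U z l 0 - q * U z i0 0) by ring.
  by rewrite mulf_eq0 (negPf Fl0) subr_eq0 eq_sym.
have case1 := body i1 (pt x 0) x; rewrite eq_sym i01 pt_neq0 pt0 pt1 -/(sg x) in case1.
move/(_ isT isT erefl erefl): case1 => case1 j0 v0.
have [->|j1] := eqVneq j i1; first exact: case1.
(* Coordinates i1 and j of w agree, so [Ueq] carries the value [sg x] from i1 to j. *)
pose w : 'cV[K]_n := e i0 + x *: e i1 + x *: e j.
have wE i : w i 0 = (i == i0)%:R + x * (i == i1)%:R + x * (i == j)%:R.
  by rewrite /w mxDE mxDE !mxZE !ecolE.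
have w_0 : w i0 0 = 1 by rewrite wE eqxx (negPf i01) (eq_sym i0) (negPf j0) !mulr0 !addr0.
have w_1 : w i1 0 = x.
  by rewrite wE eqxx (eq_sym i1) (negPf i01) (eq_sym i1) (negPf j1) mulr0 mulr1 addr0 add0r.
have w_j : w j 0 = x by rewrite wE eqxx (negPf j0) (negPf j1) mulr0 mulr1 !add0r.
have w0 : w != 0 by apply: (@cv0 _ i0); rewrite w_0 oner_eq0.
have Uw0 : U w i0 0 != 0 by apply: U0; rewrite w_0 oner_eq0.
rewrite (body j w x j0 w0 w_0 w_j v v0); congr (_ * _ == _).
have := case1 w w0; rewrite w_0 w_1 mulr1 eqxx => /esym/eqP E.
have := Ueq j1 w0; rewrite w_1 w_j eqxx => /esym/eqP ->.
by rewrite -E mulfK.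
Qed.

Lemma UsgE v j : v i0 0 != 0 -> U v j 0 = sg (v j 0 / v i0 0) * U v i0 0.
Proof.
move=> v00; have v0 := cv0 v00; have Uv0 := U0 v00.
have [->|j0] := eqVneq j i0; last first.
  by have := Usg (v j 0 / v i0 0) j0 v0; rewrite divfK // eqxx => /esym/eqP.
rewrite divff // -[LHS]mul1r; congr (_ * _); apply: esym.
have := Ueq i01 (pt_neq0 1 0); rewrite pt0 pt1 eqxx => /esym/eqP E.
by rewrite /sg -E divff // U0 // pt0 oner_eq0.
Qed.

Lemma Upt1 x y : U (pt x y) i1 0 = sg x * U (pt x y) i0 0.
Proof. by rewrite UsgE ?pt0 ?pt1 ?divr1 ?oner_eq0. Qed.
Lemma Upt2 x y : U (pt x y) i2 0 = sg y * U (pt x y) i0 0.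
Proof. by rewrite UsgE ?pt0 ?pt2 ?divr1 ?oner_eq0. Qed.
Lemma Upt0 x y : U (pt x y) i0 0 != 0.
Proof. by apply: U0; rewrite pt0 oner_eq0. Qed.

Lemma sg1 : sg 1 = 1.
Proof.
have := @UsgE (pt 1 0) i0; rewrite pt0 divr1 oner_eq0 => /(_ isT) E.
by apply: (mulIf (Upt0 1 0)); rewrite mul1r -E.
Qed.
Lemma sg0 : sg 0 = 0.
Proof.
by apply/eqP; rewrite /sg mulf_eq0 -cU ?pt_neq0 // pt1 eqxx.
Qed.

Lemma sg_inj : injective sg.
Proof.
move=> x y E; have := Usg y (_ : i1 != i0) (pt_neq0 x 0); rewrite eq_sym => /(_ i01).
by rewrite pt0 pt1 mulr1 Upt1 E eqxx => /eqP.
Qed.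

(** The functional r1 + r2 - s r0 vanishes at (1,s,0), (1,0,s) and (1,x,y). The images of the first
    two points make the coefficients of F g at i1 and i2 equal (here s must be nonzero); the third
    gives additivity. *)
Lemma sgD_aux x y : x + y != 0 -> sg (x + y) = sg x + sg y.
Proof.
set s := x + y => s0; pose g := r i1 + r i2 - s *: r i0.
have gE w : dt g w = w i1 0 + w i2 0 - s * w i0 0 by rewrite /g !dtL !dt_erow.
have gk k : g 0 k = (k == i1)%:R + (k == i2)%:R - s * (k == i0)%:R.
  by rewrite /g mxDE mxDE mxNE mxZE !erowE.
have g1 : g 0 i1 != 0.
  by rewrite gk eqxx (negPf i12) (eq_sym i1) (negPf i01) mulr0 subr0 addr0 oner_eq0.
have g0 := cg0 g1; have F1 : F g 0 i1 != 0 by rewrite -cF.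
have key a b : a + b = s -> F g 0 i0 + F g 0 i1 * sg a + F g 0 i2 * sg b = 0.
  move=> ab; have := pUF g0 (pt_neq0 a b); rewrite gE pt0 pt1 pt2 mulr1 ab subrr eqxx => /esym/eqP.
  rewrite (@dt_supp3 K n i0 i1 i2) //; last first.
    move=> k k0 k1 k2; apply/eqP; rewrite -cF // gk (negPf k0) (negPf k1) (negPf k2).
    by rewrite mulr0 subr0 addr0.
  rewrite Upt1 Upt2 => E; apply: (mulIf (Upt0 a b)); rewrite mul0r -{1}E; ring.
have k1 := key s 0 (addr0 s); have k2 := key 0 s (add0r s); have k3 := key x y erefl.
rewrite sg0 in k1 k2.
have ss : sg s != 0 by rewrite -sg0; apply: contra s0 => /eqP/sg_inj ->.
have F12 : F g 0 i2 = F g 0 i1.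
  by apply: (mulIf ss); apply: (lcomb (k := 1) (etrans k2 (esym k1))); ring.
apply: (mulfI F1); rewrite F12 in k1 k3.
by apply: (lcomb (k := 1) (etrans k1 (esym k3))); ring.
Qed.

Lemma sgD x y : sg (x + y) = sg x + sg y.
Proof.
have [xy|] := eqVneq (x + y) 0; last exact: sgD_aux.
have [->|x0] := eqVneq x 0; first by rewrite sg0 !add0r.
have -> : y = - x by apply/eqP; rewrite -addr_eq0 addrC xy.
(* Oppositeness follows from (x + x) + (-x) = x, where all sums involved are nonzero. *)
rewrite subrr sg0; have e2 := @sgD_aux x x.
have e1 := @sgD_aux (x + x) (- x); rewrite addrK in e1.
have xx0 : x + x != 0 by rewrite -mulr2n -mulr_natr mulf_neq0 // (two0 K).
move: (e1 x0); rewrite (e2 xx0) => /eqP; rewrite -addrA -subr_eq0 opprD addNKr oppr_eq0.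
by move=> /eqP ->.
Qed.

(** The functional r2 - m r1 vanishes at (1,1,m) and (1,x,mx). *)
Lemma sgM m x : sg (m * x) = sg m * sg x.
Proof.
pose g := r i2 - m *: r i1.
have gk k : g 0 k = (k == i2)%:R - m * (k == i1)%:R by rewrite /g mxDE mxNE mxZE !erowE.
have g2 : g 0 i2 != 0 by rewrite gk eqxx (eq_sym i2) (negPf i12) mulr0 subr0 oner_eq0.
have g0 := cg0 g2; have Fg2 : F g 0 i2 != 0 by rewrite -cF.
have i21 : i2 != i1 by rewrite eq_sym.
have gs k : k != i2 -> k != i1 -> g 0 k = 0.
  by move=> k2 k1; rewrite gk (negPf k2) (negPf k1) mulr0 subrr.
have dg w : dt g w = w i2 0 - m * w i1 0 by rewrite /g !dtL !dt_erow.
have key a b : b = m * a -> F g 0 i2 * sg b + F g 0 i1 * sg a = 0.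
  move=> ab; have := F2 i21 gs g2 (pt_neq0 a b).
  rewrite dg pt1 pt2 ab subrr eqxx -ab Upt1 Upt2 => /esym/eqP E.
  by apply: (mulIf (Upt0 a b)); rewrite mul0r -[RHS]E; ring.
have k1 := key 1 m (esym (mulr1 m)); have k2 := key x (m * x) erefl.
rewrite sg1 mulr1 in k1; apply: (mulfI Fg2).
have -> : F g 0 i2 * (sg m * sg x) = (F g 0 i2 * sg m) * sg x by rewrite mulrA.
move/eqP: k1; rewrite addr_eq0 => /eqP ->; move/eqP: k2; rewrite addr_eq0 => /eqP ->.
by rewrite mulNr.
Qed.

Lemma sg_surj y : exists x, sg x = y.
Proof.
have [v [c [v0 c0 E]]] := sU (pt_neq0 y 0).
have Ec i : pt y 0 i 0 = c * U v i 0 by rewrite E mxZE.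
have U00 : U v i0 0 != 0.
  by apply/eqP => z; have := Ec i0; rewrite pt0 z mulr0 => /eqP; rewrite oner_eq0.
have v00 : v i0 0 != 0 by rewrite cU.
exists (v i1 0 / v i0 0); have := UsgE i1 v00 => E1.
have := Ec i1; rewrite pt1 E1 mulrCA -Ec pt0 mulr1 => ->.
by [].
Qed.

Definition sgf : K -> K := sg.
Lemma sg_zmod : zmod_morphism sgf.
Proof.
move=> x y; rewrite /sgf; apply: (addIr (sg y)); rewrite -sgD subrK subrK //.
Qed.
Lemma sg_monoid : monoid_morphism sgf.
Proof. by split; [exact: sg1|exact: sgM]. Qed.
HB.instance Definition _ := GRing.isZmodMorphism.Build K K sgf sg_zmod.
HB.instance Definition _ := GRing.isMonoidMorphism.Build K K sgf sg_monoid.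

Lemma FT_norm : exists sigma : {rmorphism K -> K}, [/\ bijective sigma,
  forall v, v != 0 -> exists2 c, c != 0 & U v = c *: map_mx sigma v &
  forall g, g != 0 -> exists2 c, c != 0 & F g = c *: map_mx sigma g].
Proof.
exists sgf.
have inv y : {x | sgf x = y} by apply: cid; apply: sg_surj.
have bij : bijective sgf.
  exists (fun y => sval (inv y)) => [x|y]; last exact: (svalP (inv y)).
  by apply: sg_inj; apply: (svalP (inv (sgf x))).
have colU v : v != 0 -> exists2 c, c != 0 & U v = c *: map_mx sgf v.
  move=> v0; suff [c E] : exists c, U v = c *: map_mx sgf v.
    by exists c => //; apply: contra (pU v0) => /eqP c0; rewrite E c0 scale0r.
  have [v00|v00] := eqVneq (v i0 0) 0; last first.
    exists (U v i0 0 / sgf (v i0 0)); apply/colP => j; rewrite !mxE UsgE //.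
    by rewrite -/sgf fmorph_div /=; field; rewrite fmorph_eq0.
  have [k vk] : exists k, v k 0 != 0.
    apply: contrapT => N; move/eqP: v0; apply; apply/colP => i; rewrite mxE.
    by apply: contrapT => ne; apply: N; exists i; apply/eqP.
  have k0 : k != i0 by apply: contraNneq vk => ->; rewrite v00.
  have svk : sgf (v k 0) != 0 by rewrite fmorph_eq0.
  exists (U v k 0 / sgf (v k 0)); apply/colP => j; rewrite !mxE.
  have [->|j0] := eqVneq j i0.
    by rewrite v00 rmorph0 mulr0; apply/eqP; rewrite -cU // v00.
  have [->|jk] := eqVneq j k; first by rewrite divfK.
  pose g := v k 0 *: r j - v j 0 *: r k.
  have gE l : g 0 l = v k 0 * (l == j)%:R - v j 0 * (l == k)%:R by rewrite /g mxDE mxNE !mxZE !erowE.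
  have dg w : dt g w = v k 0 * w j 0 - v j 0 * w k 0 by rewrite /g !dtL !dt_erow.
  have gj : g 0 j != 0 by rewrite gE eqxx (negPf jk) mulr0 mulr1 subr0.
  have gs l : l != j -> l != k -> g 0 l = 0.
    by move=> lj lk; rewrite gE (negPf lj) (negPf lk) !mulr0 subrr.
  (* Since v vanishes at i0, [UsgE] is applied to w instead; g kills both v and w, so the ratio of
     coordinates j and k is the same for their images. *)
  pose w := v + e i0.
  have wE i : w i 0 = v i 0 + (i == i0)%:R by rewrite /w mxDE ecolE.
  have w_0 : w i0 0 = 1 by rewrite wE v00 eqxx add0r.
  have w_00 : w i0 0 != 0 by rewrite w_0 oner_eq0.
  have wj : w j 0 = v j 0 by rewrite wE (negPf j0) addr0.
  have wk : w k 0 = v k 0 by rewrite wE (negPf k0) addr0.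
  have := F2 jk gs gj (cv0 w_00).
  rewrite dg wj wk mulrC subrr eqxx (UsgE j w_00) (UsgE k w_00) wj wk w_0 !divr1 -/sgf => /esym/eqP E1.
  have := F2 jk gs gj v0; rewrite dg mulrC subrr eqxx => /esym/eqP E2.
  have Fj : F g 0 j != 0 by rewrite -cF ?(cg0 gj).
  apply: (mulfI Fj); apply: (mulIf svk); apply: (mulIf (U0 w_00)).
  have -> : F g 0 j * (U v k 0 / sgf (v k 0) * sgf (v j 0)) * sgf (v k 0) * U w i0 0 =
     U v k 0 * (F g 0 j * (sgf (v j 0) * U w i0 0)) by field.
  move/eqP: E1; rewrite addr_eq0 => /eqP ->; move/eqP: E2; rewrite addr_eq0 => /eqP ->.
  by rewrite /sgf; ring.
split=> // g g0.
have [k gk] : exists k, g 0 k != 0.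
  apply: contrapT => N; move/eqP: g0; apply; apply/rowP => i; rewrite mxE.
  by apply: contrapT => ne; apply: N; exists i; apply/eqP.
have sgk : sgf (g 0 k) != 0 by rewrite fmorph_eq0.
suff E : F g = (F g 0 k / sgf (g 0 k)) *: map_mx sgf g.
  exists (F g 0 k / sgf (g 0 k)) => //; rewrite mulf_neq0 ?invr_eq0 //.
  by rewrite -cF.
apply/rowP => j; rewrite !mxE; have [->|jk] := eqVneq j k; first by rewrite divfK.
(* g kills v, so F g kills U v, which is already known; this gives the ratio of two coordinates of F
   g. *)
pose v := g 0 k *: e j - g 0 j *: e k.
have vj : v j 0 != 0 by rewrite /v mxDE mxNE !mxZE !ecolE eqxx (negPf jk) mulr0 mulr1 subr0.
have v0 := cv0 vj; have [c c0 E] := colU v v0.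
have := pUF g0 v0; rewrite {1}/v !dtL !dt_ecol mulrC subrr eqxx => /esym.
rewrite E dtZr mulf_eq0 (negPf c0) /=.
have -> : map_mx sgf v = sgf (g 0 k) *: e j - sgf (g 0 j) *: e k.
  apply/colP => i; rewrite mxE /v mxDE mxNE !mxZE !ecolE mxDE mxNE !mxZE !ecolE.
  by rewrite rmorphB !rmorphM !rmorph_nat.
rewrite !dtL !dt_ecol subr_eq0 => /eqP E2.
by apply: (mulfI sgk); rewrite E2; field.
Qed.
End FT.

Section FT2.
Variables (K : numClosedFieldType) (n : nat).
Implicit Types (u v w : 'cV[K]_n) (f g h : 'rV[K]_n) (i j k l : 'I_n).

(** T is the projective frame change: its columns are the images of the basis vectors, scaled so
    that T maps the all-ones vector to its image. The scalings d are nonzero because the images of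
    the coordinate functionals do not kill that vector. *)
Lemma FT (U : 'cV[K]_n -> 'cV[K]_n) (F : 'rV[K]_n -> 'rV[K]_n) : (2 < n)%N ->
  (forall v, v != 0 -> U v != 0) -> (forall g, g != 0 -> F g != 0) ->
  (forall g v, g != 0 -> v != 0 -> (dt g v == 0) = (dt (F g) (U v) == 0)) ->
  (forall u, u != 0 -> exists v c, [/\ v != 0, c != 0 & u = c *: U v]) ->
  exists (sigma : {rmorphism K -> K}) (T : 'M[K]_n), [/\ bijective sigma, T \in unitmx,
    forall v, v != 0 -> exists2 c, c != 0 & U v = c *: (T *m map_mx sigma v) &
    forall g, g != 0 -> exists2 c, c != 0 & F g = c *: (map_mx sigma g *m invmx T)].
Proof.
move=> n3 pU pF pUF sU; pose e := @ecol K n; pose r := @erow K n.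
have e0 i : e i != 0 := ecol_neq0 K i.
have r0 i : r i != 0 := erow_neq0 K i.
have dre i j : dt (r i) (e j) = (i == j)%:R by rewrite dt_erow ecolE.
pose P : 'M[K]_n := \matrix_(i, j) U (e j) i 0.
pose Q : 'M[K]_n := \matrix_(i, j) F (r i) 0 j.
pose t i := dt (F (r i)) (U (e i)).
have t0 i : t i != 0 by rewrite -pUF // dre eqxx oner_eq0.
have QP : Q *m P = diag_mx (\row_i t i).
  apply/matrixP => i j; have -> : (Q *m P) i j = dt (F (r i)) (U (e j)).
    by rewrite dt_sum !mxE; apply: eq_bigr => k _; rewrite !mxE.
  rewrite !mxE; have [->|ij] := eqVneq i j; first by rewrite mulr1n.
  by rewrite mulr0n; apply/eqP; rewrite -pUF // dre (negPf ij).
have Pu : P \in unitmx.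
  have : Q *m P \in unitmx.
    rewrite QP unitmxE det_diag unitfE; apply/prodf_neq0 => i _.
    by rewrite mxE.
  by rewrite unitmx_mul => /andP[].
have [d Pd] : exists d, P *m d = U (ones K n).
  by exists (invmx P *m U (ones K n)); rewrite mulKVmx.
have d0 i : d i 0 != 0.
  have o0 : ones K n != 0.
    by apply/eqP => /matrixP/(_ i 0)/eqP; rewrite !mxE oner_eq0.
  have := pUF (r i) _ (r0 i) o0; rewrite dt_erow onesE oner_eq0 -Pd => /esym; apply: contraFneq => z.
  have -> : dt (F (r i)) (P *m d) = (Q *m P *m d) i 0.
    rewrite -mulmxA dt_sum !mxE; apply: eq_bigr => k _.
    by rewrite [Q _ _]mxE.
  by rewrite QP mul_diag_mx !mxE z mulr0.
pose T := P *m diag_mx d^T.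
have Tu : T \in unitmx.
  rewrite unitmx_mul Pu unitmxE det_diag unitfE; apply/prodf_neq0 => i _.
  by rewrite mxE.
have Te i : T *m e i = d i 0 *: U (e i).
  apply/colP => k; rewrite -colE !mxE (bigD1 i) //= big1 ?addr0; last first.
    by move=> j ji; rewrite !mxE (negPf ji) mulr0n mulr0.
  by rewrite !mxE eqxx mulr1n mulrC.
have T1 : T *m ones K n = U (ones K n).
  rewrite -Pd /T -mulmxA; congr (_ *m _); apply/colP => i.
  by rewrite mul_diag_mx !mxE mulr1.
have lt0 : (0 < n)%N by apply: leq_trans n3.
have lt1 : (1 < n)%N by apply: leq_trans n3.
have [||||||||||sigma [bs sU' sF]] := @FT_norm K n (fun v => invmx T *m U v) (fun g => F g *m T)
    _ _ _ _ _ _ _ (Ordinal lt0) (Ordinal lt1) (Ordinal n3) => //.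
- move=> v /pU; apply: contra => /eqP E.
  by rewrite -(mulKVmx Tu (U v)) E mulmx0.
- move=> g /pF; apply: contra => /eqP E.
  by rewrite -(mulmxK Tu (F g)) E mul0mx.
- by move=> g v g0 v0; rewrite pUF // dtA mulKVmx.
- move=> u u0; have Tu0 : T *m u != 0.
    by apply: contra u0 => /eqP E; rewrite -(mulKmx Tu u) E mulmx0.
  have [v [c [v0 c0 E]]] := sU _ Tu0; exists v, c; split=> //.
  by rewrite scalemxAr -E mulKmx.
- move=> i; exists (d i 0)^-1; apply: (can_inj (mulKmx Tu)).
  by rewrite mulKVmx // -scalemxAr Te scalerA mulVf // scale1r.
- move=> i; exists (d i 0 * t i); apply/rowP => k.
  have -> : (F (r i) *m T) 0 k = dt (F (r i)) (T *m e k).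
    by rewrite -dtA dt_ecol.
  rewrite Te dtZr !mxE /=; have [->|ki] := eqVneq k i; first by rewrite ?eqxx mulr1.
  rewrite mulr0; apply/eqP; rewrite mulf_eq0 -pUF // dre ?(eq_sym i) (negPf ki) eqxx orbT.
- by [].
- by rewrite -T1 mulKmx.
exists sigma, T; split=> // [v /sU'[c c0 E]|g /sF[c c0 E]]; exists c => //.
  by rewrite scalemxAr -E mulKVmx.
by rewrite scalemxAl -E mulmxK.
Qed.
End FT2.

(** * Maps fixing the signed rank-one idempotents *)

Section Gen.
Variables (K : numClosedFieldType) (n : nat).
Implicit Types (X Y Z D : 'M[K]_n) (u v w x y : 'cV[K]_n) (f g h k : 'rV[K]_n) (a b c e : K).

Lemma perp_out1 Z x k : dt k x = 1 -> perp Z (x *m k) -> Z *m x = 0 /\ k *m Z = 0.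
Proof.
move=> kx; rewrite /perp mulmxA => P.
have Px : Z *m x + dt k (Z *m x) *: x = 0.
  have := congr1 (mulmx^~ x) P; rewrite /= mulmxDl mul0mx outv kx scale1r.
  by rewrite -[x *m k *m Z *m x]mulmxA outv.
have z0 : dt k (Z *m x) = 0.
  have := congr1 (dt k) Px; rewrite !dtL kx mulr1 => /eqP.
  by rewrite -mulr2n -mulr_natr mulf_eq0 (negPf (two0 K)) orbF => /eqP.
have Zx : Z *m x = 0 by rewrite -Px z0 scale0r addr0.
split=> //; have := congr1 (mulmx k) P.
by rewrite Zx mul0mx add0r mulmx0 -(mulmxA x) outg kx scale1r.
Qed.

Lemma jo_out1N Z x k : dt k x = 1 -> jo Z (x *m k) -> jo Z (- (x *m k)) -> Z *m x = 0 /\ k *m Z = 0.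
Proof. by move=> kx h1 h2; apply: perp_out1 kx (jo_perpN h1 h2). Qed.

Lemma zero_jo_out Z x k a : Z *m x = 0 -> k *m Z = 0 -> jo Z (a *: (x *m k)).
Proof.
move=> Zx kZ; apply: perp_joZ; rewrite /perp mulmxA Zx mul0mx -mulmxA kZ mulmx0 addr0.
by [].
Qed.

Lemma ex_lker Z x : x != 0 -> Z *m x = 0 -> exists2 k : 'rV_n, k != 0 & k *m Z = 0.
Proof.
move=> x0 Zx; have : Z \notin unitmx.
  by apply: contra x0 => Zu; rewrite -(mulKmx Zu x) Zx mulmx0.
rewrite -row_free_unit -kermx_eq0 => k0; have [g gk] := mx_neq0g k0.
by exists (g *m kermx Z) => //; rewrite -mulmxA mulmx_ker mulmx0.
Qed.
End Gen.

Section Ext.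
Variables (K : numClosedFieldType) (n : nat).
Implicit Types (X Y Z D : 'M[K]_n) (u v w x y : 'cV[K]_n) (f g h k : 'rV[K]_n) (a b c e : K).
Hypothesis n3 : (2 < n)%N.
Variable chi : 'M[K]_n -> 'M[K]_n.
Hypothesis hjo : forall X Y, jo X Y <-> jo (chi X) (chi Y).
Hypothesis hfix : forall e v g, e * e = 1 -> dt g v = 1 -> chi (e *: (v *m g)) = e *: (v *m g).

(* [X] and [Z] pass the same tests against the fixed points of [chi]. *)
Definition sim X Z := forall Y, chi Y = Y -> (jo X Y <-> jo Z Y).

Lemma sim_chi X : sim X (chi X).
Proof. by move=> Y EY; rewrite -{2}EY; apply: hjo. Qed.
Lemma simC X Z : sim X Z -> sim Z X.
Proof. by move=> h Y /h[]. Qed.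

Lemma sim_out X Z e v g : sim X Z -> e * e = 1 -> dt g v = 1 ->
  jo X (e *: (v *m g)) <-> jo Z (e *: (v *m g)).
Proof. by move=> h ee gv; apply: h; apply: hfix. Qed.

Lemma sim_ker X Z x k : sim X Z -> dt k x = 1 -> X *m x = 0 -> k *m X = 0 ->
  Z *m x = 0 /\ k *m Z = 0.
Proof.
move=> h kx Xx kX; apply: jo_out1N => //.
  by rewrite -[x *m k]scale1r; apply/(sim_out h) => //; [exact: sgn1|apply: zero_jo_out].
by rewrite -scaleN1r; apply/(sim_out h) => //; [exact: sgnN (sgn1 _)|apply: zero_jo_out].
Qed.

Lemma sim0 Z : sim 0 Z -> Z = 0.
Proof.
move=> h; apply: mx_eqv => x; rewrite mul0mx; have [->|x0] := eqVneq x 0; first by rewrite mulmx0.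
have [k kx] := ex_dual x0.
by have [] := sim_ker h kx (mul0mx _ _) (mulmx0 _ _).
Qed.

Lemma sim_eq0 X Z : sim X Z -> X != 0 -> Z != 0.
Proof. by move=> h; apply: contra => /eqP Z0; apply/eqP/sim0/simC; rewrite -Z0. Qed.

(** The fixed-point assumption is available at first only for a = 1 and a = -1; after [scale_fix] it
    holds for every nonzero a. *)
Lemma sim_eig X Z x a : (forall k, dt k x = 1 -> chi (a^-1 *: (x *m k)) = a^-1 *: (x *m k)) ->
  sim X Z -> a != 0 -> x != 0 -> X *m x = a *: x -> Z *m x = a *: x.
Proof.
move=> hP h a0 x0 Xx; apply: row_all => // [|k kx].
  apply: (sim_eq0 h); apply/eqP => X0; move: Xx; rewrite X0 mul0mx => /esym/eqP.
  by rewrite scaler_eq0 (negPf a0) (negPf x0).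
have ai : a^-1 != 0 by rewrite invr_eq0.
have : jo Z (a^-1 *: (x *m k)).
  by apply/(h _ (hP k kx))/(jo_outc _ ai kx); left; rewrite Xx scalerA mulVf // scale1r.
have inv m p (A B : 'M[K]_(m, p)) : a^-1 *: A = B -> A = a *: B.
  by move=> <-; rewrite scalerA mulfV // scale1r.
by move=> /(jo_outc _ ai kx)[/inv ->|[/inv ->|E]]; [left|right; left|right; right].
Qed.

Lemma sim_eigl X Z g a : (forall x, dt g x = 1 -> chi (a^-1 *: (x *m g)) = a^-1 *: (x *m g)) ->
  sim X Z -> a != 0 -> g != 0 -> g *m X = a *: g -> g *m Z = a *: g.
Proof.
move=> hP h a0 x0 Xx; apply: col_all => // [|k kx].
  apply: (sim_eq0 h); apply/eqP => X0; move: Xx; rewrite X0 mulmx0 => /esym/eqP.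
  by rewrite scaler_eq0 (negPf a0) (negPf x0).
have ai : a^-1 != 0 by rewrite invr_eq0.
have : jo Z (a^-1 *: (k *m g)).
  by apply/(h _ (hP k kx))/(jo_outc _ ai kx); right; left; rewrite Xx scalerA mulVf // scale1r.
have inv m p (A B : 'M[K]_(m, p)) : a^-1 *: A = B -> A = a *: B.
  by move=> <-; rewrite scalerA mulfV // scale1r.
by move=> /(jo_outc _ ai kx)[/inv ->|[/inv ->|E]]; [left|right; left|right; right].
Qed.

(** A tripotent splits the space into eigenspaces for 1, -1 and 0, each visible to signed rank-one
    idempotents. *)
Lemma fix_tripotent X : X *m X *m X = X -> chi X = X.
Proof.
move=> XXX; have S := sim_chi X; set Z := chi X in S *.
have eig e x : e * e = 1 -> X *m x = e *: x -> Z *m x = e *: x.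
  move=> ee Xx; have [->|x0] := eqVneq x 0; first by rewrite mulmx0 scaler0.
  have ei : e^-1 = e by apply: (mulfI (sgn_neq0 ee)); rewrite mulfV ?sgn_neq0.
  apply: (sim_eig _ S (sgn_neq0 ee) x0 Xx) => k kx.
  by rewrite ei; apply: hfix.
have ker x : X *m x = 0 -> Z *m x = 0.
  move=> Xx; have [->|x0] := eqVneq x 0; first by rewrite mulmx0.
  have [k0 k0x] := ex_dual x0; pose k := k0 - k0 *m X *m X.
  have kx : dt k x = 1 by rewrite /k !dtL k0x dtA Xx dt0r subr0.
  have kX : k *m X = 0 by rewrite /k mulmxBl -!mulmxA (mulmxA X X X) XXX subrr.
  by have [] := sim_ker S kx Xx kX.
apply: mx_eqv => y.
have X3 : X *m (X *m (X *m y)) = X *m y by rewrite !mulmxA XXX.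
have [y1 [y2 [y3 [-> e1 e2 e3]]]] : exists y1 y2 y3,
    [/\ y = y1 + y2 + y3, X *m y1 = 1 *: y1, X *m y2 = -1 *: y2 & X *m y3 = 0].
  exists (2^-1 *: (X *m (X *m y) + X *m y)), (2^-1 *: (X *m (X *m y) - X *m y)), (y - X *m (X *m y)).
  split; first by mxl; field.
  - by rewrite -scalemxAr mulmxDr X3 scale1r addrC.
  - by rewrite -scalemxAr mulmxBr X3 scaleN1r -scalerN opprB.
  by rewrite mulmxBr X3 subrr.
by rewrite !mulmxDr e1 e2 e3 (eig _ _ (sgn1 K) e1) (eig _ _ (sgnN (sgn1 K)) e2) (ker _ e3).
Qed.

Lemma nil_scale v g : dt g v = 0 -> v != 0 -> g != 0 -> exists c, chi (v *m g) = c *: (v *m g).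
Proof.
move=> gv v0 g0; set X := v *m g; have S : sim X (chi X) := sim_chi X; set Z := chi X in S *.
have Xx x : dt g x = 0 -> X *m x = 0 by move=> gx; rewrite outv gx scale0r.
have kX k : dt k v = 0 -> k *m X = 0 by move=> kv; rewrite outg kv scale0r.
have rker x : dt g x = 0 -> Z *m x = 0.
  have ind x' : dt g x' = 0 -> ~ (exists c, x' = c *: v) -> Z *m x' = 0.
    move=> gx N; have [k [kv kx]] := ex_dual2 0 1 v0 N.
    by have [] := sim_ker S kx (Xx _ gx) (kX _ kv).
  (* Multiples of v are not reached by [ind] directly and are written as a difference of two vectors
     that are. *)
  have [w gw Nw] : exists2 w, dt g w = 0 & ~ (exists c, w = c *: v).
    have [f fv] := ex_dual v0; have [w w00 [gw fw]] := ex_ker2 g f n3; exists w => // -[c' E].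
    by move: fw w00; rewrite E dtZr fv mulr1 => ->; rewrite scale0r eqxx.
  move=> gx; have [[c xE]|] := pselect (exists c, x = c *: v); last exact: ind.
  rewrite -[x](addrK w) mulmxBr (ind w) // ind ?subr0 //; first by rewrite dtDr gx gw addr0.
  case=> c' E; apply: Nw; exists (c' - c).
  by rewrite scalerBl -E xE addrAC subrr add0r.
have lker k : dt k v = 0 -> k *m Z = 0.
  have ind k' : dt k' v = 0 -> ~ (exists c, k' = c *: g) -> k' *m Z = 0.
    move=> kv N; have [x [gx kx]] := ex_dual2r 0 1 g0 N.
    by have [] := sim_ker S kx (Xx _ gx) (kX _ kv).
  have [f2 [N2 f2v]] : exists f2, ~ (exists c, f2 = c *: g) /\ dt f2 v = 0.
    have [w gw] := ex_dualr g0; have [f2 f20 [f2v f2w]] := ex_kerl2 v w n3.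
    exists f2; split=> // -[c E]; move: f2w f20; rewrite E dtZl gw mulr1 => ->.
    by rewrite scale0r eqxx.
  move=> kv; have [[c kE]|] := pselect (exists c, k = c *: g); last exact: ind.
  rewrite -[k](addrK f2) mulmxBl (ind f2) // ind ?subr0 //; first by rewrite dtDl kv f2v addr0.
  case=> c' E; apply: N2; exists (c' - c).
  by rewrite scalerBl -E kE addrAC subrr add0r.
have [w gw] := ex_dualr g0; have [h hv] := ex_dual v0.
exists (dt h (Z *m w)); apply: mx_eqv => x; rewrite -scalemxAl outv.
have E1 : Z *m x = dt g x *: (Z *m w).
  apply/eqP; rewrite -subr_eq0 scalemxAr -mulmxBr; apply/eqP/rker.
  by rewrite !dtL gw mulr1 subrr.
rewrite E1 scalerA mulrC -scalerA; congr (_ *: _).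
apply/eqP; rewrite -subr_eq0; apply/eqP/col_eq0 => k.
rewrite !dtL -dtA; have := lker (k - dt k v *: h).
rewrite !dtL hv mulr1 subrr => /(_ erefl)/eqP; rewrite mulmxBl -scalemxAl subr_eq0 => /eqP ->.
by rewrite dtZl dtA mulrC subrr.
Qed.

(** The scalar left by [nil_scale] is calibrated by a tripotent J with Jv = 2w and Jw = v/2, so that
    gJv = 2 and gJJv = 0. *)
Lemma nil_fix v g : dt g v = 0 -> v != 0 -> g != 0 -> chi (v *m g) = v *m g.
Proof.
move=> gv v0 g0; have S : sim (v *m g) (chi (v *m g)) := sim_chi _.
have [c cE] := nil_scale gv v0 g0; rewrite cE in S *.
have [w gw] := ex_dualr g0.
have Nw : ~ exists t, w = t *: v.
  by case=> t E; move: gw; rewrite E dtZr gv mulr0 => /esym/eqP; rewrite oner_eq0.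
have [h [hv hw]] := ex_dual2 1 0 v0 Nw.
pose J := 2^-1 *: (v *m g) + 2 *: (w *m h).
have JJ : J *m J = v *m h + w *m g.
  rewrite /J mulmxDl !mulmxDr -!scalemxAl -!scalemxAr !outo gv hv gw hw.
  by mxl; field.
have JF : chi J = J.
  apply: fix_tripotent; rewrite JJ /J mulmxDl !mulmxDr -!scalemxAr !outo gv hv gw hw.
  by mxl; ring.
have Jv : J *m v = 2 *: w by rewrite /J mulmxDl -!scalemxAl !outv gv hv; mxl; ring.
have Jw : J *m w = 2^-1 *: v by rewrite /J mulmxDl -!scalemxAl !outv gw hw; mxl; ring.
have : jo (v *m g) J.
  apply/joC/(jo_nil _ gv v0 g0); right; rewrite Jv -scalemxAr Jw !dtL gw gv.
  by split; ring.
move/(S _ JF) => Hc; have c0 : c != 0.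
  apply/eqP => c0; move: cE; rewrite c0 scale0r => cE.
  have := sim_chi (v *m g); rewrite cE => /simC/sim0 /out0[/eqP|/eqP].
    by rewrite (negPf v0).
  by rewrite (negPf g0).
have cv0 : c *: v != 0 by rewrite scaler_eq0 negb_or c0.
have gcv : dt g (c *: v) = 0 by rewrite dtZr gv mulr0.
move: Hc; rewrite scalemxAl => /joC/(jo_nil _ gcv cv0 g0)[[d [E _]]|[E _]].
  have := congr1 (dt g) E; rewrite -scalemxAr Jv !dtL gw gv mulr1 !mulr0 => /eqP.
  by rewrite mulf_eq0 (negPf c0) (negPf (two0 K)).
move: E; rewrite -scalemxAr Jv !dtL gw mulr1 => /eqP.
by rewrite -subr_eq0 -{2}[2]mul1r -mulrBl mulf_eq0 (negPf (two0 K)) orbF subr_eq0 => /eqP ->; rewrite scale1r.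
Qed.

Lemma sim_nil X Z v g : sim X Z -> dt g v = 0 -> v != 0 -> g != 0 -> jo X (v *m g) <-> jo Z (v *m g).
Proof. by move=> S gv v0 g0; apply: S; apply: nil_fix. Qed.

(** Testing both v g and 2 v g excludes the exceptional alternative of [jo_nil], whose value 2
    cannot hold for both. *)
Lemma sim_nil1 X Z v g c : sim X Z -> dt g v = 0 -> v != 0 -> g != 0 ->
  X *m v = c *: v -> g *m X = - c *: g -> exists c, Z *m v = c *: v /\ g *m Z = - c *: g.
Proof.
move=> S gv v0 g0 Xv gX.
have v20 : 2 *: v != 0 by rewrite scaler_eq0 negb_or (two0 K).
have gv2 : dt g (2 *: v) = 0 by rewrite dtZr gv mulr0.
have : jo Z (v *m g) by apply/(sim_nil S gv v0 g0)/(jo_nil _ gv v0 g0); left; exists c.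
have : jo Z ((2 *: v) *m g).
  apply/(sim_nil S gv2 v20 g0)/(jo_nil _ gv2 v20 g0); left; exists c.
  by rewrite -scalemxAr Xv !scalerA mulrC.
move=> /(jo_nil _ gv2 v20 g0)[[d [E1 E2]] _|[E1 _] /(jo_nil _ gv v0 g0)[//|[E2 _]]].
  exists d; split=> //; apply: (scalerI (two0 K)).
  by rewrite scalemxAr E1 !scalerA mulrC.
move: E1; rewrite -scalemxAr dtZr E2 -[RHS]mul1r => /eqP.
by rewrite -subr_eq0 -mulrBl mulf_eq0 (negPf (two0 K)) orbF -[2]/(1 + 1) addrK oner_eq0.
Qed.

(** The opposite eigenvalues s and -s are seen by the nilpotents v1 g2 and v2 g1, which fixes the
    shape up to a scalar; the nilpotent (v1 + v2)(g1 - g2)/s calibrates it. *)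
Lemma two_fix s v1 g1 v2 g2 : s != 0 -> dt g1 v1 = 1 -> dt g2 v2 = 1 -> dt g1 v2 = 0 -> dt g2 v1 = 0 ->
  chi (s *: (v1 *m g1 - v2 *m g2)) = s *: (v1 *m g1 - v2 *m g2).
Proof.
move=> s0 g11 g22 g12 g21; set X := s *: _; have S : sim X (chi X) := sim_chi X.
set Z := chi X in S *.
have v10 := dt1_neq0r g11; have v20 := dt1_neq0r g22.
have g10 := dt1_neq0l g11; have g20 := dt1_neq0l g22.
have XE x : X *m x = s *: (dt g1 x *: v1 - dt g2 x *: v2).
  by rewrite /X -scalemxAl mulmxBl !outv.
have gX k : k *m X = s *: (dt k v1 *: g1 - dt k v2 *: g2).
  by rewrite /X -scalemxAr mulmxBr !outg.
have X0 : X != 0.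
  apply/eqP => X0; have := XE v1; rewrite X0 mul0mx g11 g21 scale0r subr0 scale1r => /esym/eqP.
  by rewrite scaler_eq0 (negPf s0) (negPf v10).
have Xv1 : X *m v1 = s *: v1 by rewrite XE g11 g21 scale0r subr0 scale1r.
have Xv2 : X *m v2 = - s *: v2 by rewrite XE g12 g22 scale0r sub0r scale1r scalerN scaleNr.
have [|c [Zv1 g2Z]] := sim_nil1 S g21 v10 g20 Xv1.
  by rewrite gX g21 g22 scale0r sub0r scale1r scalerN scaleNr.
have [|c' [Zv2 g1Z]] := sim_nil1 S g12 v20 g10 Xv2.
  by rewrite gX g11 g12 scale0r subr0 scale1r opprK.
have cc : c' = - c.
  by have := congr1 (fun z => dt z v1) g1Z; rewrite /= dtA Zv1 !dtL g11 !mulr1 => ->; rewrite opprK.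
have ZE x : Z *m x = c *: (dt g1 x *: v1 - dt g2 x *: v2).
  have [x' [a [b [-> p1 p2]]]] : exists x' a b,
      [/\ x = x' + a *: v1 + b *: v2, dt g1 x' = 0 & dt g2 x' = 0].
    exists (x - dt g1 x *: v1 - dt g2 x *: v2), (dt g1 x), (dt g2 x).
    split; first by mxl; ring.
      by rewrite !dtL g11 g12; ring.
    by rewrite !dtL g21 g22; ring.
  have Zx' : Z *m x' = 0.
    have [->|x'0] := eqVneq x' 0; first by rewrite mulmx0.
    have [k0 k0x] := ex_dual x'0; pose k := k0 - dt k0 v1 *: g1 - dt k0 v2 *: g2.
    have kx : dt k x' = 1 by rewrite /k !dtL p1 p2 k0x; ring.
    have kv1 : dt k v1 = 0 by rewrite /k !dtL g11 g21; ring.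
    have kv2 : dt k v2 = 0 by rewrite /k !dtL g12 g22; ring.
    have [] := sim_ker S kx => //; first by rewrite XE p1 p2 !scale0r subrr scaler0.
    by rewrite gX kv1 kv2 !scale0r subrr scaler0.
  rewrite !mulmxDr -!scalemxAr Zx' Zv1 Zv2 cc !dtL p1 p2 g11 g12 g21 g22.
  by mxl; ring.
suff cs : c = s by apply: mx_eqv => x; rewrite ZE XE cs.
pose v := v1 + v2; pose g := s^-1 *: (g1 - g2).
have gv : dt g v = 0 by rewrite /g /v !dtL g11 g12 g21 g22; ring.
have v0 : v != 0.
  by apply/eqP => v0; have := dt0r g1; rewrite -v0 /v dtDr g11 g12 addr0 => /eqP; rewrite oner_eq0.
have g0 : g != 0.
  apply/eqP => g0; have := dt0l v1; rewrite -g0 /g !dtL g11 g21 subr0 mulr1 => /eqP.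
  by rewrite invr_eq0 (negPf s0).
have Zv : Z *m v = c *: (v1 - v2).
  by rewrite ZE /v !dtL g11 g12 g21 g22 !addr0 !add0r !scale1r.
have Xv : X *m v = s *: (v1 - v2).
  by rewrite XE /v !dtL g11 g12 g21 g22 !addr0 !add0r !scale1r.
have gd : dt g (v1 - v2) = 2 / s by rewrite /g !dtL g11 g12 g21 g22; field.
have : jo Z (v *m g).
  apply/(sim_nil S gv v0 g0)/(jo_nil _ gv v0 g0); right; rewrite Xv dtZr gd; split; first by field.
  have -> : X *m (s *: (v1 - v2)) = (s * s) *: v.
    by rewrite XE /v !dtL g11 g12 g21 g22; mxl; ring.
  by rewrite dtZr gv mulr0.
move=> /(jo_nil _ gv v0 g0)[[d [E _]]|[E _]]; last first.
  move: E; rewrite Zv dtZr gd mulrCA => /eqP.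
  rewrite -subr_eq0 -{2}[2]mulr1 -mulrBr mulf_eq0 (negPf (two0 K)) /= subr_eq0 => /eqP E.
  by rewrite -[c](divfK s0) E mul1r.
have c1 : c = d by have := congr1 (dt g1) E; rewrite Zv /v !dtL g11 g12 subr0 addr0 !mulr1.
have c2 : - c = d.
  have := congr1 (dt g2) E; rewrite Zv /v !dtL g21 g22 sub0r add0r mulr1 => <-.
  by rewrite mulrN mulr1.
have c0 : c = 0.
  by apply: (mulIf (two0 K)); apply: (lcomb (k := 1) (etrans c1 (esym c2))); ring.
have : Z = 0 by apply: mx_eqv => x; rewrite ZE c0 scale0r mul0mx.
by move/eqP; rewrite (negPf (sim_eq0 S X0)).
Qed.

(** Kernels determine the image up to a scalar m, and testing with the fixed matrix (v1 g1 - v2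
    g2)/l gives m = l. *)
Lemma scale_fix l v1 g1 : dt g1 v1 = 1 -> l != 0 -> chi (l *: (v1 *m g1)) = l *: (v1 *m g1).
Proof.
move=> g11 l0; set X := l *: _; have S : sim X (chi X) := sim_chi X; set Z := chi X in S *.
have v10 := dt1_neq0r g11; have g10 := dt1_neq0l g11.
have XE x : X *m x = (l * dt g1 x) *: v1 by rewrite /X -scalemxAl outv scalerA.
have gX k : k *m X = (l * dt k v1) *: g1 by rewrite /X -scalemxAr outg scalerA.
have ker x : dt g1 x = 0 -> Z *m x = 0.
  move=> gx; have [->|x0] := eqVneq x 0; first by rewrite mulmx0.
  have [k0 k0x] := ex_dual x0; pose k := k0 - dt k0 v1 *: g1.
  have kx : dt k x = 1 by rewrite /k !dtL gx k0x; ring.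
  have kv1 : dt k v1 = 0 by rewrite /k !dtL g11; ring.
  have [] := sim_ker S kx => //; first by rewrite XE gx mulr0 scale0r.
  by rewrite gX kv1 mulr0 scale0r.
have lker k : dt k v1 = 0 -> k *m Z = 0.
  move=> kv; have [->|k0] := eqVneq k 0; first by rewrite mul0mx.
  have [x0 k0x] := ex_dualr k0; pose x := x0 - dt g1 x0 *: v1.
  have kx : dt k x = 1 by rewrite /x !dtL kv k0x; ring.
  have gx : dt g1 x = 0 by rewrite /x !dtL g11; ring.
  have [] := sim_ker S kx => //; first by rewrite XE gx mulr0 scale0r.
  by rewrite gX kv mulr0 scale0r.
pose m := dt g1 (Z *m v1).
have Zv1 : Z *m v1 = m *: v1.
  apply/eqP; rewrite -subr_eq0; apply/eqP/col_eq0 => k.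
  have := lker (k - dt k v1 *: g1); rewrite !dtL g11 mulr1 subrr => /(_ erefl)/eqP.
  rewrite mulmxBl -scalemxAl subr_eq0 => /eqP E.
  by rewrite -dtA E dtZl dtA -/m mulrC subrr.
have ZE : Z = m *: (v1 *m g1).
  apply: mx_eqv => x; have := ker (x - dt g1 x *: v1); rewrite !dtL g11 mulr1 subrr => /(_ erefl)/eqP.
  rewrite mulmxBr subr_eq0 -scalemxAr Zv1 => /eqP ->.
  by rewrite -scalemxAl outv !scalerA mulrC.
have X0 : X != 0.
  by rewrite /X scaler_eq0 negb_or l0 out_neq0.
have m0 : m != 0.
  by apply/eqP => m0; have := sim_eq0 S X0; rewrite ZE m0 scale0r eqxx.
have [g2 g20 g21] := ex_kerl1 v1 (ltnW n3).
have [v2' g2v2] := ex_dualr g20; pose v2 := v2' - dt g1 v2' *: v1.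
have g22 : dt g2 v2 = 1 by rewrite /v2 !dtL g2v2 g21; ring.
have g12 : dt g1 v2 = 0 by rewrite /v2 !dtL g11; ring.
have li0 : l^-1 != 0 by rewrite invr_eq0.
have YF := two_fix li0 g11 g22 g12 g21; set Y := _ *: (_ - _) in YF.
have Yv : Y *m v1 = l^-1 *: v1.
  by rewrite /Y -scalemxAl mulmxBl !outv g11 g21 scale0r subr0 scale1r.
have gY : g1 *m Y = l^-1 *: g1.
  by rewrite /Y -scalemxAr mulmxBr !outg g11 g12 scale0r subr0 scale1r.
have : jo Z Y.
  by apply/(S _ YF)/joC/(jo_outc _ l0 g11); left; rewrite Yv scalerA mulfV // scale1r.
rewrite ZE => /joC/(jo_outc _ m0 g11).
have mE : m / l = 1 -> m *: (v1 *m g1) = X by move=> E; rewrite /X -[m](divfK l0) E mul1r.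
case=> [|[|[]]].
- rewrite Yv scalerA -{2}[v1]scale1r => /eqP; rewrite -subr_eq0 -scalerBl scaler_eq0 (negPf v10) orbF subr_eq0.
  by move=> /eqP.
- rewrite gY scalerA -{2}[g1]scale1r => /eqP; rewrite -subr_eq0 -scalerBl scaler_eq0 (negPf g10) orbF subr_eq0.
  by move=> /eqP.
by rewrite Yv => /eqP; rewrite scaler_eq0 (negPf li0) (negPf v10).
Qed.

Lemma eig X Z x a : sim X Z -> a != 0 -> X *m x = a *: x -> Z *m x = a *: x.
Proof.
move=> S a0 Xx; have [->|x0] := eqVneq x 0; first by rewrite mulmx0 scaler0.
by apply: (sim_eig _ S) => // k kx; apply: scale_fix; rewrite // invr_eq0.
Qed.

Lemma eigl X Z g a : sim X Z -> a != 0 -> g *m X = a *: g -> g *m Z = a *: g.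
Proof.
move=> S a0 Xx; have [->|x0] := eqVneq g 0; first by rewrite mul0mx scaler0.
by apply: (sim_eigl _ S) => // k kx; apply: scale_fix; rewrite // invr_eq0.
Qed.

Lemma ker2 X Z x k : sim X Z -> x != 0 -> k != 0 -> X *m x = 0 -> k *m X = 0 ->
  Z *m x = 0 /\ k *m Z = 0.
Proof.
move=> S x0 k0 Xx kX; have [kx|kx] := eqVneq (dt k x) 0; last first.
  have kx1 : dt ((dt k x)^-1 *: k) x = 1 by rewrite dtZl mulVf.
  have kX1 : (dt k x)^-1 *: k *m X = 0 by rewrite -scalemxAl kX scaler0.
  have [-> /eqP] := sim_ker S kx1 Xx kX1.
  by rewrite -scalemxAl scaler_eq0 invr_eq0 (negPf kx) => /eqP.
have [||c [E1 E2]] := @sim_nil1 _ _ _ _ 0 S kx x0 k0.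
- by rewrite scale0r.
- by rewrite kX oppr0 scale0r.
have [c0|c0] := eqVneq c 0; first by rewrite E1 E2 c0 oppr0 !scale0r.
have := eig (simC S) c0 E1; rewrite Xx => /esym/eqP.
by rewrite scaler_eq0 (negPf c0) (negPf x0).
Qed.

Lemma eig0 X Z x : sim X Z -> X *m x = 0 -> Z *m x = 0.
Proof.
move=> S Xx; have [->|x0] := eqVneq x 0; first by rewrite mulmx0.
have [k k0 kX] := ex_lker x0 Xx.
by have [] := ker2 S x0 k0 Xx kX.
Qed.

Lemma eig_all X Z x a : sim X Z -> X *m x = a *: x -> Z *m x = a *: x.
Proof.
have [->|a0] := eqVneq a 0; last by move=> S; apply: eig.
by rewrite scale0r; apply: eig0.
Qed.
End Ext.

(** * Jordan blocks of size two and short Jordan chains *)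

Section Ext2.
Variables (K : numClosedFieldType) (n : nat).
Implicit Types (X Y Z D : 'M[K]_n) (u v w x y : 'cV[K]_n) (f g h k : 'rV[K]_n) (a b c e : K).
Hypothesis n3 : (2 < n)%N.
Variable chi : 'M[K]_n -> 'M[K]_n.
Hypothesis hjo : forall X Y, jo X Y <-> jo (chi X) (chi Y).
Hypothesis hfix : forall e v g, e * e = 1 -> dt g v = 1 -> chi (e *: (v *m g)) = e *: (v *m g).
Notation sim := (sim chi).

Lemma jpE X Y x : jp X Y *m x = 2^-1 *: (X *m (Y *m x) + Y *m (X *m x)).
Proof. by rewrite /jp -scalemxAl mulmxDl -!mulmxA. Qed.

Lemma span2 v1 g1 v2 g2 w : dt g1 v1 = 1 -> dt g2 v2 = 1 -> dt g1 v2 = 0 -> dt g2 v1 = 0 ->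
  (forall d : 'rV_n, dt d v1 = 0 -> dt d v2 = 0 -> dt d w = 0) -> w = dt g1 w *: v1 + dt g2 w *: v2.
Proof.
move=> g11 g22 g12 g21 h; apply/eqP; rewrite -subr_eq0; apply/eqP/col_eq0 => k.
have := h (k - dt k v1 *: g1 - dt k v2 *: g2); rewrite !dtL g11 g12 g21 g22.
rewrite !mulr0 !mulr1 !subr0 !subrr => /(_ erefl erefl) E.
by rewrite -[RHS]E; ring.
Qed.

Lemma jordan_fix1 a v1 g1 v2 g2 : a != 0 -> dt g1 v1 = 1 -> dt g2 v2 = 1 -> dt g1 v2 = 0 -> dt g2 v1 = 0 ->
  chi (a *: (v1 *m g1) + a *: (v2 *m g2) + v1 *m g2) = a *: (v1 *m g1) + a *: (v2 *m g2) + v1 *m g2.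
Proof.
move=> a0 g11 g22 g12 g21; set X := _ + _; have S : sim X (chi X) := sim_chi hjo X.
set Z := chi X in S *.
have XE x : X *m x = (a * dt g1 x + dt g2 x) *: v1 + (a * dt g2 x) *: v2.
  by rewrite /X !mulmxDl -!scalemxAl !outv; mxl; ring.
have gX k : k *m X = (a * dt k v1) *: g1 + (a * dt k v2 + dt k v1) *: g2.
  by rewrite /X !mulmxDr -!scalemxAr !outg; mxl; ring.
have Zv1 : Z *m v1 = a *: v1.
  by apply: (eig n3 hjo hfix S a0); rewrite XE g11 g21; mxl; ring.
have g2Z : g2 *m Z = a *: g2.
  by apply: (eigl n3 hjo hfix S a0); rewrite gX g21 g22; mxl; ring.
have lker k : dt k v1 = 0 -> dt k v2 = 0 -> k *m Z = 0.
  move=> kv1 kv2; have [->|k0] := eqVneq k 0; first by rewrite mul0mx.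
  have [x0 k0x] := ex_dualr k0.
  have [x [kx g1x g2x]] : exists x, [/\ dt k x = 1, dt g1 x = 0 & dt g2 x = 0].
    by exists (x0 - dt g1 x0 *: v1 - dt g2 x0 *: v2); rewrite !dtL kv1 kv2 k0x g11 g12 g21 g22; split; ring.
  have [] := sim_ker hfix S kx => //; first by rewrite XE g1x g2x; mxl; ring.
  by rewrite gX kv1 kv2; mxl; ring.
have ker x : dt g1 x = 0 -> dt g2 x = 0 -> Z *m x = 0.
  by move=> e1 e2; apply: (eig0 n3 hjo hfix S); rewrite XE e1 e2; mxl; ring.
pose z := dt g1 (Z *m v2).
have Zv2 : Z *m v2 = z *: v1 + a *: v2.
  have := @span2 v1 g1 v2 g2 (Z *m v2) g11 g22 g12 g21.
  rewrite -/z -[dt g2 (Z *m v2)]dtA g2Z dtZl g22 mulr1; apply => d d1 d2.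
  by rewrite -dtA lker // dt0l.
have ZE x : Z *m x = (a * dt g1 x + z * dt g2 x) *: v1 + (a * dt g2 x) *: v2.
  have := ker (x - dt g1 x *: v1 - dt g2 x *: v2); rewrite !dtL g11 g12 g21 g22.
  rewrite !mulr0 !mulr1 !subr0 !subrr => /(_ erefl erefl)/eqP.
  rewrite !mulmxBr -!scalemxAr Zv1 Zv2 !subr_eq0 subr_eq => /eqP ->.
  by mxl; ring.
suff z1 : z = 1 by apply: mx_eqv => x; rewrite ZE XE z1 mul1r.
(* Y is of the form treated in [two_fix], chosen so that its Jordan product with X is the idempotent
   v2 (a g1 + g2); the same product with Z is idempotent only for z = 1. *)
pose t := (2 * a)^-1; have a20 : 2 * a != 0 by rewrite mulf_neq0 // two0.
have t0 : t != 0 by rewrite invr_eq0.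
have YF : chi (t *: (v2 *m (g2 + a *: g1) - (v1 - a *: v2) *m g1)) = t *: (v2 *m (g2 + a *: g1) - (v1 - a *: v2) *m g1).
  by apply: (two_fix n3 hjo hfix t0); rewrite ?(dtDl, dtDr, dtZl, dtZr, dtNl, dtNr) ?g11 ?g12 ?g21 ?g22 => //; ring.
set Y := t *: _ in YF.
have YE x : Y *m x = t *: ((dt g2 x + a * dt g1 x) *: v2 - dt g1 x *: (v1 - a *: v2)).
  by rewrite /Y -scalemxAl mulmxBl !outv dtDl dtZl.
have : jo X Y.
  have M : jp X Y = v2 *m (a *: g1 + g2).
    apply: mx_eqv => x; rewrite jpE outv XE !YE XE !dtL g11 g12 g21 g22 /t.
    by mxl; field.
  by rewrite /jo M /idempotent_mx outo !dtL g12 g22 mulr0 add0r scale1r.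
move/(S _ YF); rewrite /jo /idempotent_mx => /(congr1 (mulmx^~ v1)); rewrite /= -mulmxA.
have M1 : jp Z Y *m v1 = ((z - 1) / 2) *: v1 + a *: v2.
  by rewrite jpE ZE !YE Zv1 !dtL g11 g12 g21 g22 /t; mxl; field.
have M2 : jp Z Y *m v2 = ((z + 1) / 2) *: v2.
  by rewrite jpE ZE !YE Zv2 !dtL g11 g12 g21 g22 /t; mxl; field.
rewrite M1 mulmxDr -!scalemxAr M1 M2 => /(congr1 (dt g2)).
rewrite !dtL g21 g22 => E; apply: (mulfI a0).
by apply: (lcomb (k := 1) E); field.
Qed.

Lemma jordan_fix a c v1 g1 v2 g2 : a != 0 -> c != 0 ->
  dt g1 v1 = 1 -> dt g2 v2 = 1 -> dt g1 v2 = 0 -> dt g2 v1 = 0 ->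
  chi (a *: (v1 *m g1) + a *: (v2 *m g2) + c *: (v1 *m g2)) =
  a *: (v1 *m g1) + a *: (v2 *m g2) + c *: (v1 *m g2).
Proof.
move=> a0 c0 g11 g22 g12 g21.
have := @jordan_fix1 a (c *: v1) (c^-1 *: g1) v2 g2 a0.
rewrite !dtL g11 g12 g21 !mulr0 mulr1 ?mulVf ?mulfV // => /(_ erefl g22 erefl erefl).
by rewrite -!scalemxAl -scalemxAr !scalerA mulrAC -mulrA mulVf // mulr1.
Qed.

(** The tests [Y d] invert X on the span of v1 and v2, so that their Jordan product with X is a
    projection onto that span; d is any functional vanishing there. Varying d confines Z v2 to the
    span, then the eigenvalue and the idempotency for d = 0 fix its coordinates. *)
Lemma chain2a X Z a v1 v2 : sim X Z -> a != 0 -> v1 != 0 -> X *m v1 = a *: v1 ->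
  X *m v2 = a *: v2 + v1 -> Z *m v2 = a *: v2 + v1.
Proof.
move=> S a0 v10 X1 X2.
have ind : ~ exists c, v2 = c *: v1.
  case=> c E; move: X2; rewrite E -scalemxAr X1 !scalerA mulrC -{1}[_ *: v1]addr0 => /addrI/esym/eqP.
  by rewrite (negPf v10).
have [g1 [g11 g12]] := ex_dual2 1 0 v10 ind; have [g2 [g21 g22]] := ex_dual2 0 1 v10 ind.
have Z1 : Z *m v1 = a *: v1 := eig n3 hjo hfix S a0 X1.
pose b := a^-1; have b0 : b != 0 by rewrite invr_eq0.
have bb0 : - (b * b) != 0 by rewrite oppr_eq0 mulf_neq0.
have [y [yE Xy]] : exists y, y = b *: v2 - (b * b) *: v1 /\ X *m y = v2.
  by exists (b *: v2 - (b * b) *: v1); split; rewrite // mulmxBr -!scalemxAr X1 X2 /b; mxl; field.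
pose Y d := b *: (v1 *m g1) + b *: (v2 *m (g2 + d)) + - (b * b) *: (v1 *m (g2 + d)).
have YE d x : Y d *m x = (b * dt g1 x) *: v1 + (dt g2 x + dt d x) *: y.
  by rewrite /Y yE !mulmxDl -!scalemxAl !outv !dtDl; mxl; ring.
have J d : dt d v1 = 0 -> dt d v2 = 0 -> jo Z (Y d).
  move=> d1 d2; have YF : chi (Y d) = Y d.
    by apply: jordan_fix; rewrite // dtDl ?g21 ?g22 ?d1 ?d2 addr0.
  apply/(S _ YF); set M := jp X (Y d); rewrite /jo -/M.
  have Y1 : Y d *m v1 = b *: v1 by rewrite YE g11 g21 d1; mxl; ring.
  have Y2 : Y d *m v2 = y by rewrite YE g12 g22 d2; mxl; ring.
  have M1 : M *m v1 = v1.
    by rewrite /M jpE Y1 X1 -!scalemxAr X1 Y1 /b; mxl; field.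
  have M2 : M *m v2 = v2.
    rewrite /M jpE Y2 X2 mulmxDr -scalemxAr Y1 Y2 Xy yE /b; by mxl; field.
  have ME x : exists p q, M *m x = p *: v1 + q *: v2.
    exists (2^-1 * (b * dt g1 (X *m x) + dt g1 x - (b * b) * (dt g2 (X *m x) + dt d (X *m x)))),
      (2^-1 * (dt g2 x + dt d x + b * (dt g2 (X *m x) + dt d (X *m x)))).
    rewrite /M jpE !YE mulmxDr -!scalemxAr X1 Xy yE /b.
    move: (dt g2 (X *m x)) (dt d (X *m x)) (dt g1 (X *m x)) => r1 r2 r3.
    by mxl; field.
  rewrite /idempotent_mx; apply: mx_eqv => x; have [p [q E]] := ME x.
  by rewrite -mulmxA E mulmxDr -!scalemxAr M1 M2.
have dZ d : dt d v1 = 0 -> dt d v2 = 0 -> dt d (Z *m v2) = 0.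
  move=> d1 d2; have [->|d0] := eqVneq d 0; first by rewrite dt0l.
  have dy : dt d y = 0 by rewrite yE !dtL d1 d2; ring.
  set M0 := jp Z (Y 0); set M1 := jp Z (y *m d).
  have JE t : jp Z (Y (t *: d)) = M0 + t *: M1.
    rewrite /M0 /M1 -jpZr -jpDr; congr (jp _ _); apply: mx_eqv => x.
    by rewrite YE mulmxDl YE -scalemxAl outv !dtL; mxl; ring.
  have I t : idempotent_mx (M0 + t *: M1).
    by rewrite -JE; apply: J; rewrite dtZl ?d1 ?d2 mulr0.
  have M11 : M1 *m M1 = 0.
    have := I 0; have := I 1; have := I (-1); rewrite /idempotent_mx scale0r addr0 scale1r scaleN1r.
    move=> e1 e2 e3; apply: (scalerI (two0 K)); rewrite scaler0.
    have : (M0 - M1) *m (M0 - M1) + (M0 + M1) *m (M0 + M1) - (M0 *m M0) - (M0 *m M0) = 0.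
      by rewrite e1 e2 e3; mxl; ring.
    by rewrite !(mulmxDl, mulmxDr, mulmxBl, mulmxBr, mulNmx, mulmxN) => <-; mxl; ring.
  have dM1 : d *m M1 = (2^-1 * dt d (Z *m y)) *: d.
    by rewrite /M1 jp_out -scalemxAr mulmxDr outg (mulmxA d y) dtE dy mul_scalar_mx scale0r addr0 scalerA.
  have dm : dt d (Z *m y) = 0.
    have := congr1 (mulmx d) M11; rewrite mulmx0 mulmxA dM1 -scalemxAl dM1 scalerA => /eqP.
    rewrite scaler_eq0 (negPf d0) orbF mulf_eq0 orbb mulf_eq0 invr_eq0 (negPf (two0 K)).
    by move/eqP.
  move: dm; rewrite yE mulmxBr -!scalemxAr Z1 !dtL d1 !mulr0 subr0 => /eqP.
  by rewrite mulf_eq0 (negPf b0) => /eqP.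
have Z2 := span2 g11 g22 g12 g21 dZ.
set s := dt g2 (Z *m v2) in Z2; set t := dt g1 (Z *m v2) in Z2.
have sa : s = a.
  apply/eqP; rewrite -subr_eq0; apply: contraT => sa.
  pose w := v2 + (t / (s - a)) *: v1.
  have Zw : Z *m w = s *: w by rewrite /w mulmxDr -scalemxAr Z1 Z2; mxl; field.
  have := eig_all n3 hjo hfix (simC S) Zw.
  rewrite /w mulmxDr -scalemxAr X1 X2 => /(congr1 (dt g2)); rewrite !dtL g21 g22 => E.
  by case/eqP: sa; apply: (lcomb (k := -1) E); ring.
suff t1 : t = 1 by rewrite Z2 sa t1 scale1r addrC.
have := J 0 (dt0l _) (dt0l _); rewrite /jo /idempotent_mx => /(congr1 (mulmx^~ v2)); rewrite /= -mulmxA.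
have Zy : Z *m y = v2 + (b * (t - 1)) *: v1.
  by rewrite yE mulmxBr -!scalemxAr Z1 Z2 sa /b; mxl; field.
have Y1 : Y 0 *m v1 = b *: v1 by rewrite YE g11 g21 dt0l; mxl; ring.
have Y2 : Y 0 *m v2 = y by rewrite YE g12 g22 dt0l; mxl; ring.
have M1 : jp Z (Y 0) *m v1 = v1.
  by rewrite jpE Z1 Y1 -!scalemxAr Z1 Y1 /b; mxl; field.
have M2 : jp Z (Y 0) *m v2 = v2 + (b * (t - 1)) *: v1.
  by rewrite jpE Z2 sa Y2 Zy mulmxDr -!scalemxAr Y1 Y2 yE /b; mxl; field.
rewrite M2 mulmxDr -scalemxAr M1 M2 => /(congr1 (dt g1)); rewrite !dtL g11 g12 => E.
by apply: (mulfI b0); apply: (lcomb (k := 1) E); ring.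
Qed.

(** X is not invertible on the chain, so the tests are nilpotents v2 g with g v2 = 0 and g v1 =
    2. *)
Lemma chain2z X Z v1 v2 : sim X Z -> v1 != 0 -> X *m v1 = 0 -> X *m v2 = v1 -> Z *m v2 = v1.
Proof.
move=> S v10 X1 X2.
have ind : ~ exists c, v2 = c *: v1.
  by case=> c E; move: X2; rewrite E -scalemxAr X1 scaler0 => /esym/eqP; rewrite (negPf v10).
have v20 : v2 != 0.
  by apply/eqP => v20; apply: ind; exists 0; rewrite v20 scale0r.
have [g1 [g11 g12]] := ex_dual2 1 0 v10 ind; have [g2 [g21 g22]] := ex_dual2 0 1 v10 ind.
have Z1 : Z *m v1 = 0 := eig0 n3 hjo hfix S X1.
have T g : dt g v2 = 0 -> dt g v1 = 2 -> dt g (Z *m v2) = 2 /\ dt g (Z *m (Z *m v2)) = 0.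
  move=> gv2 gv1; have g0 : g != 0.
    by apply/eqP => g0; move: gv1; rewrite g0 dt0l => /esym/eqP; rewrite (negPf (two0 K)).
  have : jo Z (v2 *m g).
    apply/(sim_nil n3 hjo hfix S gv2 v20 g0)/(jo_nil _ gv2 v20 g0); right.
    by rewrite X2 X1 dt0r.
  move=> /(jo_nil _ gv2 v20 g0)[[c [E _]]|//].
  have := eig_all n3 hjo hfix (simC S) E; rewrite X2 => /(congr1 (dt g)).
  by rewrite gv1 dtZr gv2 mulr0 => /eqP; rewrite (negPf (two0 K)).
have [g0 [g0v1 g0v2 g01]] : exists g0, [/\ dt g0 v1 = 2, dt g0 v2 = 0 & g0 = 2 *: g1].
  by exists (2 *: g1); rewrite !dtZl g11 g12 mulr1 mulr0.
have dr d : dt d v1 = 0 -> dt d v2 = 0 -> dt d (Z *m v2) = 0.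
  move=> d1 d2; have [E1 _] := T g0 g0v2 g0v1.
  have [||E2 _] := T (g0 + d); rewrite ?dtDl ?g0v2 ?g0v1 ?d1 ?d2 ?addr0 //.
  by move: E2; rewrite dtDl E1 => /eqP; rewrite -subr_eq0 addrAC subrr add0r => /eqP.
have := span2 g11 g22 g12 g21 dr.
have [E1 E2] := T g0 g0v2 g0v1.
have p1 : dt g1 (Z *m v2) = 1.
  by move: E1; rewrite g01 dtZl => E1; apply: (mulfI (two0 K)); rewrite E1 mulr1.
rewrite p1; set q := dt g2 _ => ZE; rewrite ZE.
suff q0 : q = 0 by rewrite q0 scale0r addr0 scale1r.
move: E2; rewrite ZE mulmxDr -!scalemxAr Z1 ZE !dtL g0v1 g0v2 => /eqP.
rewrite !mulr0 add0r addr0 mul1r mulf_eq0 (negPf (two0 K)) orbF.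
by move/eqP.
Qed.

Section Chain3.
Variables (X Z : 'M[K]_n) (a : K) (v0 v1 v2 v3 : 'cV[K]_n) (g0 g1 g2 : 'rV[K]_n).
Hypotheses (S : sim X Z) (X0 : X *m v0 = a *: v0 + v1) (X1 : X *m v1 = a *: v1 + v2)
  (X2 : X *m v2 = a *: v2 + v3).
Hypotheses (Z1 : Z *m v1 = a *: v1 + v2) (Z2 : Z *m v2 = a *: v2 + v3).
Hypotheses (g00 : dt g0 v0 = 1) (g01 : dt g0 v1 = 0) (g02 : dt g0 v2 = 0).
Hypotheses (g10 : dt g1 v0 = 0) (g11 : dt g1 v1 = 1) (g12 : dt g1 v2 = 0).
Hypotheses (g20 : dt g2 v0 = 0) (g21 : dt g2 v1 = 0) (g22 : dt g2 v2 = 1).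

(** The values 0, 2, -4a are those for which gXv0 = 2 and gXXv0 = 0, where XXv0 = a^2 v0 + 2a v1 +
    v2. *)
Let test g : dt g v0 = 0 -> dt g v1 = 2 -> dt g v2 = - (4 * a) ->
  dt g (Z *m v0) = 2 /\ dt g (Z *m (Z *m v0)) = 0.
Proof.
move=> gv0 gv1 gv2; have v00 := dt1_neq0r g00.
have gn0 : g != 0.
  by apply/eqP => gn; move: gv1; rewrite gn dt0l => /esym/eqP; rewrite (negPf (two0 K)).
have : jo Z (v0 *m g).
  apply/(sim_nil n3 hjo hfix S gv0 v00 gn0)/(jo_nil _ gv0 v00 gn0); right.
  rewrite X0 mulmxDr -scalemxAr X0 X1 !dtL gv0 gv1 gv2.
  by split; ring.
move=> /(jo_nil _ gv0 v00 gn0)[[c [E _]]|//].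
have := eig_all n3 hjo hfix (simC S) E; rewrite X0 => /(congr1 (dt g1)).
rewrite !dtL g10 g11 !mulr0 add0r => /eqP.
by rewrite oner_eq0.
Qed.

Let ex_gs : exists g, [/\ dt g v0 = 0, dt g v1 = 2 & dt g v2 = - (4 * a)].
Proof.
exists (2 *: g1 - (4 * a) *: g2); rewrite !dtL g10 g20 g11 g21 g12 g22.
by split; ring.
Qed.

Lemma chain3_form : exists al ga, Z *m v0 = al *: v0 + (1 + 2 * a * ga) *: v1 + ga *: v2.
Proof.
have [gs [gs0 gs1 gs2]] := ex_gs.
have dr d : dt d v0 = 0 -> dt d v1 = 0 -> dt d v2 = 0 -> dt d (Z *m v0) = 0.
  move=> d0 d1 d2; have [E1 _] := test gs0 gs1 gs2.
  have [|||E2 _] := @test (gs + d); rewrite ?(dtDl gs) ?gs0 ?gs1 ?gs2 ?d0 ?d1 ?d2 ?addr0 //.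
  by move: E2; rewrite (dtDl gs) E1 => /eqP; rewrite -subr_eq0 addrAC subrr add0r => /eqP.
exists (dt g0 (Z *m v0)), (dt g2 (Z *m v0)).
have ZE : Z *m v0 = dt g0 (Z *m v0) *: v0 + dt g1 (Z *m v0) *: v1 + dt g2 (Z *m v0) *: v2.
  apply/eqP; rewrite -subr_eq0; apply/eqP/col_eq0 => k.
  have := dr (k - dt k v0 *: g0 - dt k v1 *: g1 - dt k v2 *: g2).
  rewrite !dtL g00 g01 g02 g10 g11 g12 g20 g21 g22.
  rewrite !mulr0 !mulr1 !subr0 !subrr => /(_ erefl erefl erefl) E.
  by rewrite -[RHS]E; ring.
rewrite {1}ZE; congr (_ + _ *: _ + _).
have [E1 _] := test gs0 gs1 gs2; move: E1; rewrite {1}ZE !dtL gs0 gs1 gs2 => E.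
by apply: (mulfI (two0 K)); apply: (lcomb (k := 1) E); ring.
Qed.

(** Adding d to a test functional changes only its value on v3, which isolates the coefficient
    ga. *)
Lemma chain3_long d : dt d v0 = 0 -> dt d v1 = 0 -> dt d v2 = 0 -> dt d v3 = 1 ->
  Z *m v0 = a *: v0 + v1.
Proof.
move=> d0 d1 d2 d3; have [al [ga ZE]] := chain3_form.
have ZZ g : dt g v0 = 0 -> dt g v1 = 2 -> dt g v2 = - (4 * a) ->
   al * (2 * (1 + 2 * a * ga) - 4 * a * ga) - 2 * a * (1 + 2 * a * ga) + ga * (- (4 * a * a) + dt g v3) = 0.
  move=> e0 e1 e2; have [_] := test e0 e1 e2.
  rewrite ZE !mulmxDr -!scalemxAr ZE Z1 Z2 !dtL e0 e1 e2 => E.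
  by apply: (lcomb (k := 1) E); ring.
have [gs [gs0 gs1 gs2]] := ex_gs.
have E1 := ZZ gs gs0 gs1 gs2.
have E2 := ZZ (gs + d); rewrite !(dtDl gs) gs0 gs1 gs2 d0 d1 d2 d3 !addr0 in E2.
move: (E2 erefl erefl erefl) => {}E2.
have ga0 : ga = 0 by apply: (lcomb (k := 1) (etrans E2 (esym E1))); ring.
move: E1; rewrite ZE ga0 => E1.
have -> : al = a by apply: (mulfI (two0 K)); apply: (lcomb (k := 1) E1); ring.
by rewrite mulr0 addr0 scale1r scale0r addr0.
Qed.

(** An eigenvalue al of Z different from a would give an eigenvector that X does not share. For a =
    0 these tests leave ga free; [no_gamma] settles that case. *)
Lemma chain3_short : v3 = 0 -> exists ga, a * ga = 0 /\ Z *m v0 = a *: v0 + v1 + ga *: v2.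
Proof.
move=> v30; have [al [ga ZE]] := chain3_form; exists ga.
have Z2' : Z *m v2 = a *: v2 by rewrite Z2 v30 addr0.
have E1 : al = a + 4 * a * a * ga.
  have [gs [gs0 gs1 gs2]] := ex_gs.
  have [_] := test gs0 gs1 gs2; rewrite ZE !mulmxDr -!scalemxAr ZE Z1 Z2' !dtL gs0 gs1 gs2 => E.
  by apply: (mulfI (two0 K)); apply: (lcomb (k := 1) E); ring.
have ala : al = a.
  apply/eqP; rewrite -subr_eq0; apply: contraT => r0; set r := al - a in r0.
  have alE : al = a + r by rewrite /r addrC subrK.
  pose w := v0 + ((1 + 2 * a * ga) / r) *: v1 + ((ga + (1 + 2 * a * ga) / r) / r) *: v2.
  have Zw : Z *m w = al *: w.
    clearbody r; rewrite /w !mulmxDr -!scalemxAr ZE Z1 Z2' alE.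
    by mxl; field.
  have := eig_all n3 hjo hfix (simC S) Zw.
  rewrite /w !mulmxDr -!scalemxAr X0 X1 X2 v30 addr0 => /(congr1 (dt g0)).
  rewrite !dtL g00 g01 g02 => E.
  by case/eqP: r0; rewrite /r; apply: (lcomb (k := -1) E); ring.
have aga : a * ga = 0.
  have := E1; rewrite ala => E2; have [->|a0] := eqVneq a 0; first by rewrite mul0r.
  have f0 : 4 * a != 0 by rewrite mulf_neq0 // pnatr_eq0.
  by apply: (mulfI f0); rewrite mulr0; apply: (lcomb (k := -1) E2); ring.
by split=> //; rewrite ZE ala -mulrA aga mulr0 addr0 scale1r.
Qed.
End Chain3.
End Ext2.

(** * Maximal Jordan chains and generalized eigenvectors *)

Section Pw.
Variables (K : numClosedFieldType) (n : nat).
Implicit Types (X Y Z D : 'M[K]_n) (u v w x y : 'cV[K]_n) (f g h k : 'rV[K]_n) (a b c e : K).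

Definition pw X m : 'M[K]_n := iter m (mulmx X) 1%:M.
Lemma pwS X m : pw X m.+1 = X *m pw X m. Proof. by []. Qed.
Lemma pw0 X : pw X 0 = 1%:M. Proof. by []. Qed.
Lemma pwD X i j : pw X (i + j) = pw X i *m pw X j.
Proof. by elim: i => [|i IH]; rewrite ?mul1mx // addSn !pwS IH mulmxA. Qed.
Lemma pwSr X m : pw X m.+1 = pw X m *m X.
Proof. by rewrite -addn1 pwD pwS pw0 mulmx1. Qed.
Lemma pw_gt X y m l : pw X m.+1 *m y = 0 -> (m < l)%N -> pw X l *m y = 0.
Proof. by move=> h ml; rewrite -(subnK ml) pwD -mulmxA h mulmx0. Qed.

(** A functional that is 1 on the last vector of the chain produces a triangular pairing matrix with
    unit diagonal, of size m + 1 and rank at most n. *)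
Lemma chain_bound X y m : pw X m *m y != 0 -> pw X m.+1 *m y = 0 -> (m < n)%N.
Proof.
move=> ne z; have [f fy] := ex_dual ne.
pose V : 'M[K]_(n, m.+1) := \matrix_(i, j) (pw X j *m y) i 0.
pose G : 'M[K]_(m.+1, n) := \matrix_(i, j) (f *m pw X (m - i)) 0 j.
have GV (i j : 'I_m.+1) : (G *m V) i j = dt f (pw X (m - i + j) *m y).
  rewrite pwD -mulmxA -dtA /dt [LHS]mxE [RHS]mxE; apply: eq_bigr => l _.
  by rewrite !mxE.
have tr : is_trig_mx (G *m V).
  apply/is_trig_mxP => i j ij; rewrite GV (pw_gt z) ?dt0r //.
  by have := ltn_ord i; have := ltn_ord j; move: ij; clear; lia.
have : G *m V \in unitmx.
  rewrite unitmxE (det_trig tr) big1 ?unitr1 // => i _.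
  by rewrite GV subnK ?fy // -ltnS.
rewrite -row_free_unit -row_leq_rank => h.
exact: leq_trans h (leq_trans (mxrankM_maxl _ _) (rank_leq_col _)).
Qed.

Lemma ex_annih X w : ~ (exists y, X *m y = w) -> exists k : 'rV_n, k *m X = 0 /\ dt k w = 1.
Proof.
move=> N; have ne : w^T *m cokermx X^T != 0.
  rewrite -submxE; apply/negP => /submxP[d E]; apply: N; exists d^T.
  by apply: trmx_inj; rewrite trmx_mul trmxK E.
have [z wz] : exists z : 'cV[K]_n, w^T *m cokermx X^T *m z != 0.
  apply: contrapT => N'; move/eqP: ne; apply; apply: mx_eqv => z.
  by rewrite mul0mx; apply/eqP; apply: contraT => h; case: N'; exists z.
pose k := (cokermx X^T *m z)^T; have kX : k *m X = 0.
  by apply: trmx_inj; rewrite trmx_mul trmxK mulmxA mulmx_coker mul0mx trmx0.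
have kw : dt k w != 0.
  by apply: contra wz => /eqP e; rewrite -mulmxA dtE -[dt _ _]dtT trmxK -/k e raddf0.
exists ((dt k w)^-1 *: k); rewrite -scalemxAl kX scaler0 dtZl mulVf //.
Qed.

(** Since the chain cannot be prolonged, some functional kills the image of X^(m+1) but not X^m y.
    Its values on the earlier chain vectors are cleared one at a time, by subtracting multiples of k
    X^(i+1). *)
Lemma ex_kappa X y m : pw X m.+1 *m y = 0 -> ~ (exists z, pw X m.+1 *m z = pw X m *m y) ->
  exists k : 'rV_n, [/\ k *m pw X m.+1 = 0, dt k (pw X m *m y) = 1 &
    forall j, (j < m)%N -> dt k (pw X j *m y) = 0].
Proof.
move=> yz /ex_annih[k0 [k0X k0y]].
have claim i : (i <= m)%N -> exists k : 'rV_n, [/\ k *m pw X m.+1 = 0, dt k (pw X m *m y) = 1 &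
    forall j, (m - i <= j < m)%N -> dt k (pw X j *m y) = 0].
  elim: i => [|i IH] im.
    by exists k0; split=> // j; rewrite subn0 leqNgt => /andP[/negPf ->].
  have [k [kX ky kj]] := IH (ltnW im); set c := dt k (pw X (m - i.+1) *m y).
  exists (k - c *: (k *m pw X i.+1)); split.
  - rewrite mulmxBl -scalemxAl -(mulmxA k) -pwD addnC pwD mulmxA kX mul0mx scaler0.
    by rewrite subr0.
  - by rewrite !dtL ky dtA mulmxA -pwD (pw_gt yz) ?dt0r ?mulr0 ?subr0 //; lia.
  move=> j /andP[j1 j2]; rewrite !dtL dtA mulmxA -pwD.
  have [e|ne] := eqVneq j (m - i.+1)%N.
    by rewrite e -/c addnC subnK // ky mulr1 subrr.
  rewrite (pw_gt (l := (i.+1 + j)%N) yz) ?dt0r ?mulr0 ?subr0; last by lia.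
  apply: kj; lia.
have [k [h1 h2 h3]] := claim m (leqnn m); exists k; split=> // j jm.
by apply: h3; rewrite subnn.
Qed.
End Pw.

Section Ext3.
Variables (K : numClosedFieldType) (n : nat).
Implicit Types (X Y Z D : 'M[K]_n) (u v w x y : 'cV[K]_n) (f g h k : 'rV[K]_n) (a b c e : K).
Hypothesis n3 : (2 < n)%N.
Variable chi : 'M[K]_n -> 'M[K]_n.
Hypothesis hjo : forall X Y, jo X Y <-> jo (chi X) (chi Y).
Hypothesis hfix : forall e v g, e * e = 1 -> dt g v = 1 -> chi (e *: (v *m g)) = e *: (v *m g).
Notation sim := (sim chi).

Section Alternating.
Variables (X : 'M[K]_n) (y : 'cV[K]_n) (m : nat) (k : 'rV[K]_n).
Hypotheses (yz : pw X m.+1 *m y = 0) (kX : k *m pw X m.+1 = 0) (ky : dt k (pw X m *m y) = 1)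
  (kj : forall j, (j < m)%N -> dt k (pw X j *m y) = 0).

(* An involution on a Jordan chain of [X] of maximal length, with alternating signs
   and hence anticommuting with [X]. *)
Definition altD : 'M[K]_n := \sum_(i < m.+1) (-1) ^+ i *: ((pw X i *m y) *m (k *m pw X (m - i))).

Lemma altD_pw j : (j <= m)%N -> altD *m (pw X j *m y) = (-1) ^+ j *: (pw X j *m y).
Proof.
move=> jm; pose j' : 'I_m.+1 := Ordinal (jm : (j < m.+1)%N).
rewrite /altD mulmx_suml (bigD1 j') //= big1 ?addr0.
  by rewrite -scalemxAl outv dtA mulmxA -pwD subnK // ky scale1r.
move=> i ij; rewrite -scalemxAl outv dtA mulmxA -pwD.
have ne : (i : nat) <> j by move=> e; move: ij; rewrite -(inj_eq val_inj) /= e eqxx.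
have im := ltn_ord i; have [l|l] := ltnP (m - i + j) m; first by rewrite kj // scale0r scaler0.
by rewrite (pw_gt yz) ?dt0r ?scale0r ?scaler0 //; lia.
Qed.

Lemma altD3 : altD *m altD *m altD = altD.
Proof.
have step i r : (i <= m)%N -> altD *m (altD *m (pw X i *m y *m r)) = pw X i *m y *m r.
  move=> im; rewrite (mulmxA altD _ r) altD_pw // -scalemxAl -scalemxAr (mulmxA altD _ r) altD_pw //.
  by rewrite -scalemxAl scalerA -exprD addnn -mul2n exprM sqrrN expr1n expr1n scale1r.
rewrite -mulmxA [X in _ *m (_ *m X)]/altD !mulmx_sumr; apply: eq_bigr => i _.
by rewrite -!scalemxAr step // -ltnS.
Qed.

Lemma altD_perp : perp X altD.
Proof.
(* The anticommutator is a telescoping sum of [t]; its end terms vanish because X^(m+1) kills y on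
   the right and k on the left. *)
pose t i := (-1) ^+ i *: ((pw X i *m y) *m (k *m pw X (m.+1 - i))).
have tl : \sum_(0 <= i < m.+1) (t i.+1 - t i) = 0.
  rewrite telescope_sumr // /t yz subn0 kX mul0mx mulmx0 !scaler0 subrr.
  by [].
rewrite /perp; apply/eqP; rewrite -oppr_eq0 -tl big_mkord /altD mulmx_sumr mulmx_suml -big_split /= -sumrN.
apply/eqP/eq_bigr => i _; have im : (i <= m)%N by rewrite -ltnS.
rewrite -scalemxAr -scalemxAl !mulmxA -pwS -[_ *m k *m _ *m X]mulmxA -pwSr -subSn //.
by rewrite /t !mulmxA exprS mulN1r scaleNr subSS opprD.
Qed.
End Alternating.

(** Take a longest chain ending in v2; its alternating tripotent D anticommutes with X, hence with
    Z. The chain vector p two steps before v2 differs from v0 by an element of the kernel of X^2, so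
    Zp = Xp + c v2, and anticommutation with D gives 2 s c v2 = 0. *)
Lemma no_gamma X Z v0 v1 v2 c : sim X Z -> X *m v0 = v1 -> X *m v1 = v2 -> X *m v2 = 0 -> v2 != 0 ->
  Z *m v2 = 0 -> Z *m v1 = v2 -> Z *m v0 = v1 + c *: v2 ->
  (forall x, X *m (X *m x) = 0 -> Z *m x = X *m x) -> c = 0.
Proof.
move=> S X0 X1 X2 v20 Z2 Z1 Z0 kk.
pose P m := `[< exists y, pw X m *m y = v2 >].
have P2 : P 2 by apply/asboolP; exists v0; rewrite !pwS pw0 mulmx1 -mulmxA X0.
have Pb m : P m -> (m <= n)%N.
  move=> /asboolP[y E]; apply/ltnW/(@chain_bound _ _ X y); first by rewrite E.
  by rewrite pwS -mulmxA E.
have exP : exists m, P m by exists 2.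
case: (ex_maxnP exP Pb) => m /asboolP[y yE] mmax.
have m2 : (2 <= m)%N := mmax 2 P2.
have yz : pw X m.+1 *m y = 0 by rewrite pwS -mulmxA yE.
have [|k [kX ky kj]] := ex_kappa yz.
  rewrite yE => -[z zE]; have : (m.+1 <= m)%N by apply: mmax; apply/asboolP; exists z.
  by rewrite ltnn.
set D := altD X y m k.
have DD : D *m D *m D = D := altD3 yz ky kj.
have pXD : perp X D := altD_perp yz kX.
have pZD : perp Z D.
  apply: jo_perpN.
    by apply/(S _ (fix_tripotent hjo hfix DD)); apply: perp_jo.
  have DN : chi (- D) = - D.
    by apply: (fix_tripotent hjo hfix); rewrite !(mulNmx, mulmxN) opprK DD.
  by apply/(S _ DN); apply: perp_jo; apply/perpNr.
have [m' mE] : exists m', m = m'.+2 by exists (m - 2)%N; lia.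
set p := pw X m' *m y; set s := (-1) ^+ m' : K.
have ss : s * s = 1 by rewrite -expr2 sqrr_sign.
have Xp : X *m (X *m p) = v2 by rewrite -yE mE !pwS /p -!mulmxA.
have Dp : D *m p = s *: p by rewrite /D altD_pw //; lia.
have DXp : D *m (X *m p) = - s *: (X *m p).
  have -> : X *m p = pw X m'.+1 *m y by rewrite /p mulmxA.
  by rewrite /D altD_pw ?exprS ?mulN1r //; lia.
have Dv : D *m v2 = s *: v2.
  by rewrite -yE /D altD_pw // mE !exprS !mulN1r opprK.
have Zp : Z *m p = X *m p + c *: v2.
  have := kk (v0 - p); rewrite !mulmxBr X0 X1 Xp subrr => /(_ erefl)/eqP.
  by rewrite subr_eq Z0 => /eqP E; apply: (lcombm (k := -1) E); mxl; ring.
have : D *m (Z *m p) + Z *m (D *m p) = 0.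
  by have := congr1 (mulmx^~ p) pZD; rewrite /= mul0mx mulmxDl -!mulmxA addrC.
rewrite Dp -scalemxAr Zp mulmxDr -scalemxAr DXp Dv => E.
have /eqP : (2 * (s * c)) *: v2 = 0 by apply: (lcombm (k := 1) E); mxl; ring.
rewrite scaler_eq0 (negPf v20) orbF mulf_eq0 (negPf (two0 K)) mulf_eq0 (negPf (sgn_neq0 ss)).
by move/eqP.
Qed.

(** Induction on the order of v: the later vectors of its chain are already known to agree, and the
    first three or four decide the value at v. *)
Lemma gen_eig X Z a (k : nat) v : sim X Z -> pw (X - a%:M) k *m v = 0 -> Z *m v = X *m v.
Proof.
move=> S; set D := X - a%:M; have XD x : X *m x = a *: x + D *m x.
  by rewrite /D mulmxBl mul_scalar_mx addrC subrK.
elim: k v => [|k IH] v Dv; first by move: Dv; rewrite pw0 mul1mx => ->; rewrite !mulmx0.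
have [/IH //|Dk] := eqVneq (pw D k *m v) 0.
case: k => [|k] in IH Dv Dk *.
  have Xv : X *m v = a *: v by rewrite XD; move: Dv; rewrite pwS pw0 mulmx1 => ->; rewrite addr0.
  by rewrite (eig_all n3 hjo hfix S Xv) Xv.
set v1 := D *m v; have v1k : pw D k.+1 *m v1 = 0 by rewrite mulmxA -pwSr.
have X0 : X *m v = a *: v + v1 := XD v.
have [v1nz Z1] : v1 != 0 /\ Z *m v1 = X *m v1.
  split; last exact: IH.
  by apply: contra Dk => /eqP e; rewrite pwSr -mulmxA -/v1 e mulmx0.
case: k => [|k] in IH Dv Dk v1k *.
  have Xv1 : X *m v1 = a *: v1.
    by rewrite XD; move: v1k; rewrite pwS pw0 mulmx1 => ->; rewrite addr0.
  have [a0|a0] := eqVneq a 0.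
    rewrite X0 a0 scale0r add0r; apply: (chain2z n3 hjo hfix S v1nz).
      by rewrite Xv1 a0 scale0r.
    by rewrite X0 a0 scale0r add0r.
  by rewrite X0; apply: (chain2a n3 hjo hfix S a0 v1nz Xv1 X0).
set v2 := D *m v1; have v2k : pw D k.+1 *m v2 = 0 by rewrite mulmxA -pwSr.
have X1 : X *m v1 = a *: v1 + v2 := XD v1.
have v2nz : v2 != 0.
  by apply: contra Dk => /eqP e; rewrite !pwSr -!mulmxA -/v1 -/v2 e mulmx0.
have Z2 : Z *m v2 = X *m v2 by apply: IH; rewrite pwS -mulmxA v2k mulmx0.
set v3 := D *m v2; have X2 : X *m v2 = a *: v2 + v3 := XD v2.
have vE i : pw D i *m v1 = pw D i.+1 *m v by rewrite pwSr -mulmxA.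
have vE2 i : pw D i *m v2 = pw D i.+2 *m v by rewrite -vE pwSr -mulmxA.
have vE3 i : pw D i *m v3 = pw D i.+3 *m v by rewrite -vE2 pwSr -mulmxA.
have vz i : (k.+2 < i)%N -> pw D i *m v = 0 by apply: pw_gt.
have [f fv] := ex_dual Dk.
have fE i x : dt (f *m pw D i) x = dt f (pw D i *m x) by rewrite dtA.
have [g0 [g00 g01 g02 g03]] : exists g, [/\ dt g v = 1, dt g v1 = 0, dt g v2 = 0 & dt g v3 = 0].
  exists (f *m pw D k.+2); rewrite !fE fv vE vE2 vE3.
  by rewrite !(vz _ _) ?dt0r //; lia.
have [g1 [g10 g11 g12 g13]] : exists g, [/\ dt g v = 0, dt g v1 = 1, dt g v2 = 0 & dt g v3 = 0].
  pose h := f *m pw D k.+1; have h1 : dt h v1 = 1 by rewrite fE vE.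
  have h2 : dt h v2 = 0 by rewrite fE vE2 vz ?dt0r.
  have h3 : dt h v3 = 0 by rewrite fE vE3 vz ?dt0r //; lia.
  clearbody h; exists (h - dt h v *: g0); rewrite !dtL h1 h2 h3 g00 g01 g02 g03.
  by split; ring.
have [g2 [g20 g21 g22 g23]] : exists g, [/\ dt g v = 0, dt g v1 = 0, dt g v2 = 1 & dt g v3 = 0].
  pose h := f *m pw D k; have h2 : dt h v2 = 1 by rewrite fE vE2.
  have h3 : dt h v3 = 0 by rewrite fE vE3 vz ?dt0r.
  clearbody h; exists (h - dt h v *: g0 - dt h v1 *: g1); rewrite !dtL h2 h3 g00 g01 g02 g03 g10 g11 g12 g13.
  by split; ring.
rewrite X1 in Z1; rewrite X2 in Z2; rewrite X0.
case: k => [|k] in IH Dv Dk v1k v2k vz fv *; last first.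
  have [d [d0 d1 d2 d3]] : exists g, [/\ dt g v = 0, dt g v1 = 0, dt g v2 = 0 & dt g v3 = 1].
    pose h := f *m pw D k; have h3 : dt h v3 = 1 by rewrite fE vE3.
    clearbody h; exists (h - dt h v *: g0 - dt h v1 *: g1 - dt h v2 *: g2).
    by rewrite !dtL h3 g00 g01 g02 g03 g10 g11 g12 g13 g20 g21 g22 g23; split; ring.
  by apply: (chain3_long n3 hjo hfix S X0 X1 Z1 Z2 g00 g01 g02 g10 g11 g12 g20 g21 g22 d0 d1 d2 d3).
have v30 : v3 = 0 by move: v2k; rewrite pwS pw0 mulmx1.
have [ga [aga Z0]] := chain3_short n3 hjo hfix S X0 X1 X2 Z1 Z2 g00 g01 g02 g10 g11 g12 g20 g21 g22 v30.
suff ga0 : ga = 0 by rewrite Z0 ga0 scale0r addr0.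
move/eqP: aga; rewrite mulf_eq0 => /orP[/eqP a0|/eqP //].
have DX : D = X by rewrite /D a0 raddf0 subr0.
move: X0 X1 X2 Z0 Z1 Z2; rewrite v30 a0 !scale0r !add0r => X0 X1 X2 Z0 Z1 Z2.
apply: (no_gamma S X0 X1 X2 v2nz Z2 Z1 Z0) => x Xx; apply: IH.
by rewrite !pwS pw0 mulmx1 -mulmxA DX.
Qed.
End Ext3.

Section Ext4.
Variables (K : numClosedFieldType) (n : nat).
Hypothesis n3 : (2 < n.+1)%N.
Variable chi : 'M[K]_n.+1 -> 'M[K]_n.+1.
Hypothesis hjo : forall X Y, jo X Y <-> jo (chi X) (chi Y).
Hypothesis hfix : forall e (v : 'cV[K]_n.+1) (g : 'rV[K]_n.+1), e * e = 1 -> dt g v = 1 -> chi (e *: (v *m g)) = e *: (v *m g).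

Lemma pw_exp (X : 'M[K]_n.+1) k : pw X k = X ^+ k.
Proof. by elim: k => [|k IH] //; rewrite pwS IH exprS. Qed.

(** By Cayley-Hamilton and Bezout, every vector is a sum of generalized eigenvectors. *)
Lemma fix_all X : chi X = X.
Proof.
have S : sim chi X (chi X) := sim_chi hjo X; set Z := chi X in S *.
have claim (s : seq K) (c : K -> nat) (v : 'cV[K]_n.+1) : uniq s ->
    horner_mx X (\prod_(a <- s) ('X - a%:P) ^+ c a) *m v = 0 -> Z *m v = X *m v.
  elim: s v => [|a s IH] v.
    by rewrite big_nil rmorph1 mul1mx => _ ->; rewrite !mulmx0.
  rewrite big_cons /= => /andP[as_ us]; set p := _ ^+ _; set q := \prod_(_ <- _) _ => pq.
  have /Bezout_eq1_coprimepP[[u w] /= uw] : coprimep p q.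
    apply: coprimep_expl; rewrite /q; elim: s as_ {us IH q pq} => [|b s IHs].
      by rewrite big_nil coprimep1.
    rewrite inE negb_or big_cons coprimepMr => /andP[ab bs]; rewrite IHs // andbT.
    by apply: coprimep_expr; apply: coprimep_XsubC2; rewrite subr_eq0 eq_sym.
  have -> : v = horner_mx X (u * p) *m v + horner_mx X (w * q) *m v.
    by rewrite -mulmxDl -rmorphD uw rmorph1 mul1mx.
  rewrite !mulmxDr; congr (_ + _).
    apply: IH => //; rewrite mulmxA -[_ *m horner_mx X _]/(_ * _) -rmorphM mulrCA (mulrC q).
    by rewrite rmorphM -[_ * _]/(_ *m _) -mulmxA pq mulmx0.
  apply: (gen_eig n3 hjo hfix S (a := a) (k := c a)).
  have -> : pw (X - a%:M) (c a) = horner_mx X p.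
    by rewrite pw_exp /p rmorphXn rmorphB /= horner_mx_X horner_mx_C.
  rewrite mulmxA -[_ *m horner_mx X _]/(_ * _) -rmorphM mulrCA rmorphM -[_ * _]/(_ *m _).
  by rewrite -mulmxA pq mulmx0.
apply: mx_eqv => v; have [r rE] := closed_field_poly_normal (char_poly X).
apply: (@claim (undup r) (fun a => count_mem a r)); first exact: undup_uniq.
have -> : \prod_(a <- undup r) ('X - a%:P) ^+ count_mem a r = char_poly X.
  rewrite (prodr_undup_exp_count r xpredT (fun a => 'X - a%:P)) [RHS]rE.
  by rewrite (monicP (char_poly_monic X)) scale1r.
by rewrite Cayley_Hamilton mul0mx.
Qed.
End Ext4.

(** * Undoing the normalisations *)

Section Core.
Variables (K : numClosedFieldType).

Lemma jo_map n (sigma : {rmorphism K -> K}) (X Y : 'M[K]_n) :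
  jo (map_mx sigma X) (map_mx sigma Y) <-> jo X Y.
Proof.
have E A B : jp (map_mx sigma A) (map_mx sigma B) = map_mx sigma (jp A B).
  by move=> *; rewrite /jp map_mxZ map_mxD !map_mxM fmorphV rmorph_nat.
rewrite /jo /idempotent_mx E -map_mxM; split=> [|->//].
exact: map_mx_inj.
Qed.

Lemma jo_conj n (T X Y : 'M[K]_n) : T \in unitmx ->
  jo (invmx T *m X *m T) (invmx T *m Y *m T) <-> jo X Y.
Proof.
move=> Tu; have M A B : (invmx T *m A *m T) *m (invmx T *m B *m T) = invmx T *m (A *m B) *m T.
  by rewrite -!mulmxA (mulmxA T (invmx T)) mulmxV // mul1mx.
have E : jp (invmx T *m X *m T) (invmx T *m Y *m T) = invmx T *m (jp X Y) *m T.
  by rewrite /jp !M -mulmxDl -mulmxDr -scalemxAr -scalemxAl.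
rewrite /jo /idempotent_mx E M; split=> [h|-> //].
have := congr1 (fun A => T *m A *m invmx T) h.
by rewrite /= -!mulmxA mulmxV // !mulmx1 !mulmxA mulmxV // !mul1mx.
Qed.

Lemma world_conj n (psi th : 'M[K]_n.+1 -> 'M[K]_n.+1) : (2 < n.+1)%N -> rep psi th -> world th 1 ->
  exists (sigma : {rmorphism K -> K}) (T : 'M[K]_n.+1), [/\ bijective sigma, T \in unitmx &
    forall X, psi X = T *m map_mx sigma X *m invmx T].
Proof.
move=> n3 H W; have [U [F [pU pF pUF sU psiE]]] := world_psi n3 H W.
have [sigma [T [bs Tu UE FE]]] := FT n3 pU pF pUF sU.
exists sigma, T; split=> //; have [tau sK tK] := bs.
pose chi X := map_mx tau (invmx T *m psi X *m T).
have sc X : map_mx sigma (chi X) = invmx T *m psi X *m T.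
  by apply/matrixP => i j; rewrite [LHS]mxE [in LHS]mxE tK.
suff chiE X : chi X = X.
  by move=> X; rewrite -{2}(chiE X) sc -!mulmxA mulmxV // mulmx1 mulKVmx.
apply: (fix_all n3) => [{}X Y|e v g ee gv].
  by rewrite (rep_jo H) -(jo_conj _ _ Tu) -!sc jo_map.
apply: (map_mx_inj (f := sigma)); rewrite sc psiE //.
have [c c0 ->] := UE v (dt1_neq0r gv); have [d d0 ->] := FE g (dt1_neq0l gv).
have -> : dt (d *: (map_mx sigma g *m invmx T)) (c *: (T *m map_mx sigma v)) = d * c.
  rewrite !dtL dtA mulKmx //; have -> : dt (map_mx sigma g) (map_mx sigma v) = sigma (dt g v).
    by rewrite /dt -map_mxM mxE.
  by rewrite gv rmorph1 mulr1.
rewrite map_mxZ map_mxM -[(c *: _) *m _]scalemxAl -[_ *m (d *: _)]scalemxAr !scalerA.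
rewrite -[invmx T *m (_ *: _)]scalemxAr -[(_ *: _) *m T]scalemxAl.
rewrite -!mulmxA mulKmx // mulVmx // mulmx1; congr (_ *: _).
by case/sqr1P: ee => ->; rewrite ?rmorphN1 ?rmorph1; field; rewrite d0 c0.
Qed.

Lemma world_opp n (th : 'M[K]_n -> 'M[K]_n) a : world th a -> world (fun P => - th P) (- a).
Proof.
case=> hR hL hC hR'; split.
- move=> v /hR[u u0 R]; exists u => // f fu.
  by rewrite mulNmx R // scaleNr.
- move=> v /hL[u u0 R]; exists u => // f fu.
  by rewrite mulmxN R // scaleNr.
- move=> b v f bb v0 f0 C; apply: (hC (- b) v f); rewrite ?mulrNN // => u fu.
  by rewrite scaleNr -(C _ fu) mulNmx opprK.
move=> b v f bb v0 f0 C; apply: (hR' (- b) v f); rewrite ?mulrNN // => u fu.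
by rewrite scaleNr -(C _ fu) mulmxN opprK.
Qed.

Lemma world_conj_sgn n (psi th : 'M[K]_n.+1 -> 'M[K]_n.+1) a : (2 < n.+1)%N -> rep psi th ->
  a * a = 1 -> world th a ->
  exists (sigma : {rmorphism K -> K}) (T : 'M[K]_n.+1), [/\ bijective sigma, T \in unitmx &
    forall X, psi X = a *: (T *m map_mx sigma X *m invmx T)].
Proof.
move=> n3 H /sqr1P[->|->] W.
  have [sigma [T [bs Tu E]]] := world_conj n3 H W.
  by exists sigma, T; split=> // X; rewrite scale1r.
have W' := world_opp W; rewrite opprK in W'.
have [sigma [T [bs Tu E]]] := world_conj n3 (rep_opp H) W'.
exists sigma, T; split=> // X; rewrite -[X]opprK E opprK.
by rewrite map_mxN mulmxN mulNmx scaleN1r.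
Qed.

Lemma rank_out n (u : 'cV[K]_n) (f : 'rV[K]_n) : dt f u = 1 -> \rank (u *m f) = 1%N.
Proof.
move=> fu; apply/eqP; rewrite eqn_leq (leq_trans (mxrankM_maxl _ _) (rank_leq_col _)) /=.
by rewrite lt0n mxrank_eq0 out_neq0 ?(dt1_neq0r fu) ?(dt1_neq0l fu).
Qed.

Lemma rank1_pm_out n e (u : 'cV[K]_n) (f : 'rV[K]_n) : e * e = 1 -> dt f u = 1 ->
  rank1_pm_idempotent_mx (e *: (u *m f)).
Proof.
move=> ee fu; have r1 := rank_out fu; case/sqr1P: ee => ->.
  by left; rewrite scale1r /idempotent_mx outo fu scale1r.
right; rewrite scaleN1r mxrank_opp; split=> //; split.
  by rewrite mulNmx mulmxN !opprK outo fu scale1r.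
by apply/eqP; rewrite oppr_eq0 out_neq0 ?(dt1_neq0r fu) ?(dt1_neq0l fu).
Qed.

Lemma jordan_preserver n (alpha : K) (phi : 'M[K]_n.+1 -> 'M[K]_n.+1) (t : K) :
  (2 < n.+1)%N -> alpha != 0 -> t * t = (2 * alpha)^-1 ->
  (forall P, rank1_pm_idempotent_mx P -> exists A, phi A = t *: P) ->
  (forall A B, idempotent_mx (alpha *: (A *m B + B *m A)) <->
     idempotent_mx (alpha *: (phi A *m phi B + phi B *m phi A))) ->
  exists (sigma : {rmorphism K -> K}) (T : 'M[K]_n.+1) (c : K) (diamond : 'M[K]_n.+1 -> 'M[K]_n.+1),
  [/\ bijective sigma, T \in unitmx, c ^+ 2 = sigma alpha / alpha, diamond = id \/ diamond = trmx
    & forall X, phi X = c *: (T *m diamond (map_mx sigma X) *m invmx T)].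
Proof.
move=> n3 al0 tt hr hj; have two := two0 K.
have t0 : t != 0.
  by apply/eqP => t0; move/eqP: tt; rewrite t0 mul0r eq_sym invr_eq0 mulf_eq0 (negPf two) (negPf al0).
have alt : alpha * (t * t) = 2^-1 by rewrite tt; field; rewrite al0.
pose psi X := t^-1 *: phi (t *: X).
have phiE A : phi A = t *: psi (t^-1 *: A).
  by rewrite /psi !scalerA !mulfV // !scale1r.
have jpE X Y : alpha *: ((t *: X) *m (t *: Y) + (t *: Y) *m (t *: X)) = jp X Y.
  by rewrite /jp -!scalemxAl -!scalemxAr -!scalerDr !scalerA -mulrA alt.
have psi_jo X Y : jo X Y <-> jo (psi X) (psi Y).
  have pE Z : phi (t *: Z) = t *: psi Z by rewrite /psi scalerA mulfV // scale1r.
  by have := hj (t *: X) (t *: Y); rewrite !pE !jpE.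
have exth P : exists X, rank1_pm_idempotent_mx P -> psi X = P.
  have [/hr[A E]|N] := pselect (rank1_pm_idempotent_mx P); last by exists 0.
  by exists (t^-1 *: A) => _; rewrite /psi scalerA mulfV // scale1r E scalerA mulVf // scale1r.
have [th thE] := choice exth.
have H : rep psi th by split=> // e u f ee fu; apply/thE/rank1_pm_out.
(* The constant arises from phi(A) = t psi(A/t), where the inner factor 1/t leaves the semilinear
   map as 1/sigma(t); a is the sign of the world. *)
have csq (sigma : {rmorphism K -> K}) a : a * a = 1 -> (a * t / sigma t) ^+ 2 = sigma alpha / alpha.
  move=> aa; have st : sigma t * sigma t = (2 * sigma alpha)^-1.
    by rewrite -rmorphM tt fmorphV rmorphM rmorph_nat.
  have sal : sigma alpha != 0 by rewrite fmorph_eq0.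
  have -> : (a * t / sigma t) ^+ 2 = (a * a) * (t * t) * (sigma t * sigma t)^-1.
    by rewrite invfM; ring.
  by rewrite aa st tt; field; rewrite al0.
have [a aa [W|W]] := world_or n3 H.
  have [sigma [T [bs Tu E]]] := world_conj_sgn n3 H aa W.
  exists sigma, T, (a * t / sigma t), id; split=> //; [exact: csq|by left|move=> X].
  rewrite phiE E map_mxZ fmorphV -scalemxAr -scalemxAl !scalerA.
  by congr (_ *: _); ring.
have [sigma [T [bs Tu E]]] := world_conj_sgn n3 (rep_ttr H) aa W.
exists sigma, (invmx T)^T, (a * t / sigma t), trmx; split=> //.
- by rewrite unitmx_tr unitmx_inv.
- exact: csq.
- by right.
move=> X; have E' Y : psi Y = a *: ((invmx T)^T *m (map_mx sigma Y)^T *m invmx (invmx T)^T).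
  by apply: trmx_inj; rewrite E linearZ /= !trmx_mul !trmxK -trmx_inv trmxK invmxK mulmxA.
rewrite phiE E' map_mxZ fmorphV [(_ *: map_mx _ _)^T]linearZ -scalemxAr -scalemxAl !scalerA.
by congr (_ *: _); ring.
Qed.
End Core.

Theorem theorem5 (R : realType) (alpha : R[i]) (halpha : alpha <> 0)
    (n : nat) (hn : (3 <= n)%N) (phi : 'M[R[i]]_n -> 'M[R[i]]_n)
    (hrange : forall P : 'M[R[i]]_n, rank1_pm_idempotent_mx P ->
       exists A : 'M[R[i]]_n, phi A = sqrtC ((2 * alpha)^-1) *: P)
    (hphi : forall A B : 'M[R[i]]_n,
       idempotent_mx (alpha *: (A *m B + B *m A)) <->
       idempotent_mx (alpha *: (phi A *m phi B + phi B *m phi A))) :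
  exists (sigma : {rmorphism R[i] -> R[i]}) (T : 'M[R[i]]_n) (c : R[i])
         (diamond : 'M[R[i]]_n -> 'M[R[i]]_n),
    [/\ bijective sigma,
        T \in unitmx,
        c ^+ 2 = sigma alpha / alpha,
        diamond = id \/ diamond = trmx
      & forall X : 'M[R[i]]_n,
          phi X = c *: (T *m diamond (map_mx sigma X) *m invmx T)].
Proof.
case: n hn phi hrange hphi => // n hn phi hrange hphi.
apply: (jordan_preserver hn _ _ hrange hphi); first exact/eqP.
by rewrite -expr2 sqrtCK.
Qed.
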